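(* Let $R$ be a hereditary $A$-order in $D$ and let $\mathbf g=(\mathbf g_v)_{v\ne\infty}$ with $\mathbf g_v=(g_{v,1},\dots,g_{v,r_v})\in\mathbb Z_{\ge0}^{r_v}$ and $\sum_{i=1}^{r_v}g_{v,i}=m_v$ for every finite place $v$, where $r_v$ is the period of $R_v$. For each finite place $v$ of $K$, $$R_{I(\mathbf g),v}=R_{I(\mathbf g)}\otimes_AO_v\cong\mathrm{Mat}(\mathbf g_v^{o},O_{\Delta_v}).$$ In particular, $R_{I(\mathbf g)}$ is a hereditary $A$-order in $D$ whose local invariant at $v$ is equal to $\mathbf g_v^{o}$.
   Context: $K$ is a global function field with (full) finite constant field $\mathbb F_q$, $\infty$ a fixed place, $A\subset K$ the subring of functions regular outside $\infty$; for a finite place $v\neq\infty$, $O_v$ is the valuation ring of the completion $K_v$. $D$ is a central simple $K$-algebra with $\dim_KD=n^2$, definite with respect to $\infty$, i.e. $D\otimes_KK_\infty$ is a division algebra. $D_v=D\otimes_KK_v\simeq\mathrm{Mat}_{m_v}(\Delta_v)$ with $\Delta_v$ a central division $K_v$-algebra, $O_{\Delta_v}$ its maximal order, $\mathfrak P_v$ the maximal ideal of $O_{\Delta_v}$. For a vector $\vec h=(h_1,\dots,h_r)\in\mathbb Z_{>0}^{r}$ with $\sum h_i=m_v$, $\mathrm{Mat}(\vec h,O_{\Delta_v})$ is the ring of block matrices $(X_{i,j})_{1\le i,j\le r}$ in $\mathrm{Mat}_{m_v}(O_{\Delta_v})$ with $X_{i,j}$ of size $h_i\times h_j$, with entries in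 $O_{\Delta_v}$ if $i\le j$ and in $\mathfrak P_v$ if $i>j$. An $A$-order $R$ is hereditary if all its left (equivalently right) ideals are projective $R$-modules; then for each finite $v$, $R_v=R\otimes_AO_v\cong\mathrm{Mat}(\vec f_v,O_{\Delta_v})$ for a vector $\vec f_v=(f_{v,1},\dots,f_{v,r_v})$, unique up to cyclic permutation, called the invariant of $R$ at $v$; $r_v$ is the period of $R_v$ ($r_v=1$ for almost all $v$). Identify $R_v$ with $\mathrm{Mat}(\vec f_v,O_{\Delta_v})$. A right ideal of $R$ is an $A$-lattice $I$ in $D$ that is also a right $R$-submodule of $D$; its left order is $R_I=\{x\in D: xI\subseteq I\}$. Let $M_1=O_{\Delta_v}^{m_v}$ (row vectors, a right $R_v$-module) and $M_i=M_{i-1}\cdot\mathrm{rad}(R_v)$ for $1<i\le r_v$, with $\mathrm{rad}(R_v)$ the Jacobson radical. $I(\mathbf g)$ denotes a right ideal of $R$ such that for all finite $v$, $I(\mathbf g)_v\cong M_1^{g_{v,1}}\oplus\cdots\oplus M_{r_v}^{g_{v,r_v}}$ as right $R_v$-modules. $\mathbf g_v^{o}$ is the vector obtained from $\mathbf g_v$ by removing the zero entries (keeping the order). *)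

(* Defs.v *)
From HB Require Import structures.
From mathcomp Require Import all_boot all_order all_algebra all_field.
From mathcomp Require Import boolp.

Set Implicit Arguments.
Unset Strict Implicit.
Unset Printing Implicit Defensive.

Import Order.TTheory GRing.Theory Num.Theory.
Local Open Scope ring_scope.

(* Subsets of rings and modules are boolean predicates {pred T}; a set given
   by an undecidable condition P is written [pred x | `[< P x >]]. *)

(** * Function fields, places, completions *)

Definition is_global_function_field (F : finFieldType) (K : fieldType)
    (iota : {rmorphism F -> K}) : Prop :=
  (exists t : K,
     ~ algebraicOver iota t /\
     exists (n : nat) (b : 'I_n -> K), forall x : K,
       exists p s : 'I_n -> {poly F},
         (forall i, s i != 0) /\
         x = \sum_i (map_poly iota (p i)).[t] / (map_poly iota (s i)).[t] * b i)
  /\ (forall x : K, algebraicOver iota x -> exists c : F, x = iota c).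

(* A place of a global function field is represented by its normalized
   discrete valuation.  The value at 0, morally +oo, is set to 0, so that
   [0 <= v x] is the condition of lying in the valuation ring for every x,
   and two places are equal as soon as their valuations agree off 0. *)
Record place (K : fieldType) := Place {
  val_of :> K -> int;
  val_of0 : val_of 0 = 0;
  val_ofM : forall x y, x != 0 -> y != 0 -> val_of (x * y) = val_of x + val_of y;
  val_ofD : forall x y, x != 0 -> y != 0 -> x + y != 0 ->
    Order.min (val_of x) (val_of y) <= val_of (x + y);
  val_of_normalized : exists2 x, x != 0 & val_of x = 1 }.

Definition val_ring (K : fieldType) (v : place K) : {pred K} :=
  [pred x | 0 <= v x].

(* |x - y| <= |pi|^N *)
Definition v_close (K : fieldType) (v : place K) (N : int) (x y : K) : Prop :=
  x = y \/ N <= v (x - y).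

Definition v_cauchy (K : fieldType) (v : place K) (u : nat -> K) : Prop :=
  forall N : int, exists m : nat, forall i j : nat,
    (m <= i)%N -> (m <= j)%N -> v_close v N (u i) (u j).

Definition v_converges (K : fieldType) (v : place K) (u : nat -> K) (l : K) :
    Prop :=
  forall N : int, exists m : nat, forall i : nat,
    (m <= i)%N -> v_close v N (u i) l.

Record completion (K : fieldType) (v : place K) := Completion {
  cfield :> fieldType;
  cincl : {rmorphism K -> cfield};
  cplace : place cfield;
  cplace_incl : forall x, cplace (cincl x) = v x;
  cplace_dense : forall (y : cfield) (N : int),
    exists x : K, v_close cplace N (cincl x) y;
  cplace_complete : forall u : nat -> cfield,
    v_cauchy cplace u -> exists l, v_converges cplace u l }.

Definition finite_place (K : fieldType) (oo : place K) :=
  {v : place K | v <> oo}.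

(* The ring A of functions regular outside oo. *)
Definition regular_outside (K : fieldType) (oo : place K) : {pred K} :=
  [pred x | `[< forall v : place K, v <> oo -> x \in val_ring v >]].

(** * Ideals of a ring S given as a subset of an ambient ring T *)

Definition left_ideal (T : pzRingType) (S J : {pred T}) : Prop :=
  [/\ {subset J <= S}, zmod_closed J
    & forall a x, a \in S -> x \in J -> a * x \in J].

Definition two_sided_ideal (T : pzRingType) (S J : {pred T}) : Prop :=
  left_ideal S J /\ (forall x a, x \in J -> a \in S -> x * a \in J).

Definition maximal_for (T : pzRingType) (ideal : {pred T} -> Prop)
    (S J : {pred T}) : Prop :=
  [/\ ideal J, ~ {subset S <= J}
    & forall J' : {pred T}, ideal J' -> {subset J <= J'} ->
        ~ {subset S <= J'} -> {subset J' <= J}].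

Definition maximal_ideal (T : pzRingType) (S J : {pred T}) : Prop :=
  maximal_for (two_sided_ideal S) S J.

Definition jacobson_radical (T : pzRingType) (S : {pred T}) : {pred T} :=
  [pred x | `[< x \in S /\
    forall J : {pred T}, maximal_for (left_ideal S) S J -> x \in J >]].

(** * Central simple algebras, lattices, orders *)

Definition is_central (K : fieldType) (D : falgType K) : Prop :=
  forall z : D, (forall x, z * x = x * z) -> exists a : K, z = a%:A.

Definition is_simple (T : nzRingType) : Prop :=
  forall J : {pred T}, two_sided_ideal predT J ->
    (forall x, x \in J -> x = 0) \/ (forall x, x \in J).

Definition is_division (T : unitRingType) : Prop :=
  forall x : T, x != 0 -> x \is a GRing.unit.

(* A (full) A-lattice in V: a finitely generated A-submodule spanning V. *)
Definition is_lattice (K : fieldType) (A : {pred K}) (V : lmodType K)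
    (L : {pred V}) : Prop :=
  exists (n : nat) (b : 'I_n -> V),
    (forall x, x \in L <->
       exists2 a : 'I_n -> K, (forall i, a i \in A) & x = \sum_i a i *: b i)
    /\ (forall x, exists a : 'I_n -> K, x = \sum_i a i *: b i).

Definition is_order (K : fieldType) (A : {pred K}) (D : falgType K)
    (R : subringClosed D) : Prop :=
  is_lattice A R.

Definition is_maximal_order (K : fieldType) (A : {pred K}) (D : falgType K)
    (R : subringClosed D) : Prop :=
  is_order A R /\
  forall R' : subringClosed D,
    is_order A R' -> {subset R <= R'} -> {subset R' <= R}.

Definition is_right_ideal (K : fieldType) (A : {pred K}) (D : falgType K)
    (R : subringClosed D) (I : zmodClosed D) : Prop :=
  is_lattice A I /\ (forall x y, x \in I -> y \in R -> x * y \in I).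

Definition left_order (D : nzRingType) (I : zmodClosed D) : {pred D} :=
  [pred x | `[< forall y, y \in I -> x * y \in I >]].

Fact left_order_subring (D : nzRingType) (I : zmodClosed D) :
  subring_closed (left_order I).
Proof.
split; first by apply/asboolP => y yI; rewrite mul1r.
- move=> x y /asboolP hx /asboolP hy; apply/asboolP => z zI.
  by rewrite mulrBl rpredB ?hx ?hy.
- move=> x y /asboolP hx /asboolP hy; apply/asboolP => z zI.
  by rewrite -mulrA hx ?hy.
Qed.

HB.instance Definition _ (D : nzRingType) (I : zmodClosed D) :=
  GRing.isSubringClosed.Build D (left_order I) (left_order_subring I).

(** * Hereditary rings *)

Section SubringType.
Variables (D : nzRingType) (S : subringClosed D).
Record subring_type := SubringType {
  subring_val : D; _ : subring_val \in S }.
HB.instance Definition _ := [isSub for subring_val].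
HB.instance Definition _ := [Choice of subring_type by <:].
HB.instance Definition _ := [SubChoice_isSubNzRing of subring_type by <:].
End SubringType.

Section SubmoduleType.
Variables (R : nzRingType) (V : lmodType R) (S : submodClosed V).
Record submod_type := SubmodType { submod_val : V; _ : submod_val \in S }.
HB.instance Definition _ := [isSub for submod_val].
HB.instance Definition _ := [Choice of submod_type by <:].
HB.instance Definition _ := [SubChoice_isSubLmodule of submod_type by <:].
End SubmoduleType.

Definition projective (R : nzRingType) (P : lmodType R) : Prop :=
  forall (M N : lmodType R) (p : {linear M -> N}) (f : {linear P -> N}),
    (forall y, exists x, p x = y) ->
    exists g : {linear P -> M}, forall x, p (g x) = f x.

(* The left ideals of R are the submodules of the regular module R^o. *)
Definition hereditary (R : nzRingType) : Prop :=
  forall J : submodClosed R^o, projective (submod_type J).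

Definition is_hereditary_order (K : fieldType) (A : {pred K}) (D : falgType K)
    (R : subringClosed D) : Prop :=
  is_order A R /\ hereditary (subring_type R).

(** * Tensor products *)

Section Tensor.
Variables (K L : fieldType) (iota : {rmorphism K -> L}) (A : {pred K}).

Section Modules.
Variables (V : lmodType K) (M : {pred V}) (N : {pred L}).

Definition balanced (W : zmodType) (b : V -> L -> W) : Prop :=
  [/\ forall x y a, x \in M -> y \in M -> a \in N ->
        b (x + y) a = b x a + b y a,
      forall x a a', x \in M -> a \in N -> a' \in N ->
        b x (a + a') = b x a + b x a'
    & forall c x a, c \in A -> x \in M -> a \in N ->
        b (c *: x) a = b x (iota c * a)].

Definition additive_on (T W : zmodType) (T0 : {pred T}) (h : T -> W) : Prop :=
  forall s t, s \in T0 -> t \in T0 -> h (s + t) = h s + h t.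

(* The subgroup T0 of T, with tau x a in the role of x (x) a, is the tensor
   product of M and N over A: universal property for A-balanced maps.  Maps
   out of M, N, T0 are total functions whose values elsewhere are ignored. *)
Definition is_tensor (T : zmodType) (T0 : {pred T}) (tau : V -> L -> T) :
    Prop :=
  [/\ zmod_closed T0,
      forall x a, x \in M -> a \in N -> tau x a \in T0,
      balanced tau
    & forall (W : zmodType) (b : V -> L -> W), balanced b ->
        (exists2 h : T -> W, additive_on T0 h
           & forall x a, x \in M -> a \in N -> h (tau x a) = b x a)
        /\ (forall h1 h2 : T -> W, additive_on T0 h1 -> additive_on T0 h2 ->
              (forall x a, x \in M -> a \in N -> h1 (tau x a) = h2 (tau x a)) ->
              forall t, t \in T0 -> h1 t = h2 t)].
End Modules.

(* tau induces an isomorphism of N-algebras from the tensor product R (x)_A N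
   onto the subring T0 of T, where s : L -> T gives the scalars of T. *)
Definition is_alg_tensor (D : falgType K) (R : {pred D}) (N : {pred L})
    (T : pzRingType) (s : L -> T) (T0 : {pred T}) (tau : D -> L -> T) : Prop :=
  [/\ is_tensor R N T0 tau,
      forall x y a b, x \in R -> y \in R -> a \in N -> b \in N ->
        tau x a * tau y b = tau (x * y) (a * b)
    & forall a, a \in N -> tau 1 a = s a].
End Tensor.

(** * Local structure *)

Definition scalar_of (L : fieldType) (Delta : falgType L) (m : nat) (a : L) :
    'M[Delta]_m := (a%:A)%:M.

(* Mat(h, O): the index k < sumn h lies in the block reshape_index h k, the
   blocks being numbered from 0. *)
Definition block_order (Delta : nzRingType) (m : nat) (O P : {pred Delta})
    (h : seq nat) : {pred 'M[Delta]_m} :=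
  [pred X : 'M[Delta]_m | [forall i : 'I_m, forall j : 'I_m,
     if (reshape_index h i <= reshape_index h j)%N
     then X i j \in O else X i j \in P]].

(* D (x)_K K_v ~ Mat_m(Delta), together with the maximal order of Delta and
   its maximal ideal, both of which are unique. *)
Record local_structure (K : fieldType) (D : falgType K) (v : place K)
    (Kv : completion v) := LocalStructure {
  ls_div : falgType Kv;
  ls_m : nat;
  ls_divP : is_division ls_div;
  ls_centralP : is_central ls_div;
  ls_iso : exists tau : D -> Kv -> 'M[ls_div]_ls_m,
    is_alg_tensor (cincl Kv) predT predT predT (@scalar_of _ ls_div ls_m)
      predT tau;
  ls_O : subringClosed ls_div;
  ls_OP : is_maximal_order (val_ring (cplace Kv)) ls_O;
  ls_P : {pred ls_div};
  ls_PP : maximal_ideal ls_O ls_P }.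

Arguments ls_O {K D v Kv} l.
Arguments ls_P {K D v Kv} l.

Section Local.
Variables (K : fieldType) (D : falgType K) (v : place K) (Kv : completion v).
Variables (A : {pred K}) (ls : local_structure D Kv).
Let Delta := ls_div ls.
Let m := ls_m ls.
Let Ov := val_ring (cplace Kv).

Definition Mat_order (h : seq nat) : {pred 'M[Delta]_m} :=
  block_order (ls_O ls) (ls_P ls) h.

Definition is_composition (h : seq nat) : Prop :=
  all (fun k => 0 < k)%N h /\ sumn h = m.

(* rho is an isomorphism of O_v-algebras from R (x)_A O_v onto Mat(h, O). *)
Definition local_identification (R : {pred D}) (h : seq nat)
    (rho : D -> Kv -> 'M[Delta]_m) : Prop :=
  is_alg_tensor (cincl Kv) A R Ov (@scalar_of _ Delta m) (Mat_order h) rho.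

Definition local_iso (R : {pred D}) (h : seq nat) : Prop :=
  exists rho, local_identification R h rho.

Definition local_invariant (R : {pred D}) (h : seq nat) : Prop :=
  is_composition h /\ local_iso R h.

(* The additive span of the products y z, y in M and z in S. *)
Definition row_mul (M : {pred 'rV[Delta]_m}) (S : {pred 'M[Delta]_m}) :
    {pred 'rV[Delta]_m} :=
  [pred x : 'rV[Delta]_m | `[< exists (k : nat) (y : 'I_k -> 'rV[Delta]_m)
                       (z : 'I_k -> 'M[Delta]_m),
     (forall i, y i \in M /\ z i \in S) /\ x = \sum_i y i *m z i >]].

(* M_1 = O^m and M_{i+1} = M_i rad(Mat(f, O)); row_module f i is M_{i+1}. *)
Fixpoint row_module (f : seq nat) (i : nat) : {pred 'rV[Delta]_m} :=
  if i is i'.+1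
  then row_mul (row_module f i') (jacobson_radical (Mat_order f))
  else [pred x : 'rV[Delta]_m | [forall j, x ord0 j \in ls_O ls]].

(* The direct sum of the M_i^{g_i}, where sumn g = m, as the set of matrices
   whose first g_1 rows lie in M_1, the next g_2 rows in M_2, and so on; Mat(f, O)
   acts by right multiplication. *)
Definition row_module_sum (f g : seq nat) : {pred 'M[Delta]_m} :=
  [pred X : 'M[Delta]_m | [forall k : 'I_m, row k X \in row_module f (reshape_index g k)]].

(* I (x)_A O_v is isomorphic to the direct sum of the M_i^{g_i} as a right
   module over R (x)_A O_v, identified with Mat(f, O) through rho. *)
Definition local_module_iso (R I : {pred D}) (f g : seq nat)
    (rho : D -> Kv -> 'M[Delta]_m) : Prop :=
  exists sigma : D -> Kv -> 'M[Delta]_m,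
    is_tensor (cincl Kv) A I Ov (row_module_sum f g) sigma /\
    forall x y a b, x \in I -> y \in R -> a \in Ov -> b \in Ov ->
      sigma (x * y) (a * b) = sigma x a *m rho y b.
End Local.

(* D (x)_K K_oo is a division algebra. *)
Definition is_definite (K : fieldType) (D : falgType K) (oo : place K)
    (Koo : completion oo) : Prop :=
  exists (E : falgType Koo) (tau : D -> Koo -> E),
    is_alg_tensor (cincl Koo) predT predT predT (fun a => a%:A) predT tau
    /\ is_division E.

(* Main.v *)
Require Import Defs.
From HB Require Import structures.
From mathcomp Require Import all_boot all_order all_algebra all_field.
From mathcomp Require Import boolp classical_sets zify ring.
From mathcomp Require generic_quotient ring_quotient finmap monalg.

(* Put I^* = {phi in D | phi I is included in R}.  Everything follows from
   1 in I I^*, that is 1 = sum_i x_i phi_i with x_i in I and phi_i in I^*.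
   The left order is then I I^*, hence a lattice.  It is hereditary: for a left
   ideal J of it, I^* J is isomorphic to a left ideal of R, hence projective,
   and since D is a division algebra a projective ideal has a finite dual basis
   sum_t q_t w_t = 1, which transfers to J = I I^* J.  And after tensoring with
   O_v the left order becomes the ring of left multipliers of I_v, computed
   from the rows of M_1^(g_1) + ... + M_r^(g_r); this uses that O_Delta is
   local, for which idempotents modulo the uniformizer are lifted.

   To prove 1 in I I^*: I_v is visibly projective over R_v, and a dual basis of
   I_v over R_v can be approximated by elements of D, so that I I^* contains,
   for every finite v, an element b of A with v(b) = 0.  Such elements generate
   the unit ideal of A: otherwise a valuation ring of K containing A would have
   them all in its maximal ideal, and every valuation ring of K comes from a
   place. *)

Set Implicit Arguments.
Unset Strict Implicit.
Unset Printing Implicit Defensive.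

Import Order.TTheory GRing.Theory Num.Theory.
Local Open Scope ring_scope.

(** * Places *)

(** No arithmetic of [A] is given beforehand: that it is a Dedekind ring with fraction field K, that
    its primes are the finite places, that residue fields are finite. What is needed of this comes
    from one count, [poly_relation]: sufficiently many elements of K satisfy a nontrivial linear
    relation with coefficients in F[z]. For z in the maximal ideal of a valuation ring it bounds
    chains of values, whence discreteness; for a uniformizer it makes the residue field finite; for
    z in [A] it provides denominators, globally and of value 0 at a given place. Finite residue
    fields matter for O_Delta, whose locality is obtained without extending the valuation to Delta:
    some power of an element is idempotent modulo the uniformizer, by pigeonhole, and a division
    algebra has no idempotents but 0 and 1. Tensor products are known by their universal property
    only, so matrices are extracted from linear maps built out of them. Definiteness makes D a
    division algebra, where functionals on ideals become multiplications by elements of D. *)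

Section PlaceTheory.
Variables (K : fieldType) (v : place K).
Implicit Types (x y : K) (N M : int).

Lemma place1 : v 1 = 0.
Proof.
have := val_ofM v (oner_neq0 K) (oner_neq0 K); rewrite mulr1.
by move/eqP; rewrite -subr_eq subrr => /eqP ->.
Qed.

Lemma placeV x : v x^-1 = - v x.
Proof.
have [->|x0] := eqVneq x 0; first by rewrite invr0 val_of0.
have := val_ofM v x0 (invr_neq0 x0); rewrite divff // place1.
by move/esym/eqP; rewrite addrC addr_eq0 => /eqP.
Qed.

Lemma placeN x : v (- x) = v x.
Proof.
have [->|x0] := eqVneq x 0; first by rewrite oppr0.
have N10 : (-1 : K) != 0 by rewrite oppr_eq0 oner_eq0.
have := val_ofM v N10 N10; rewrite mulrNN mulr1 place1 => h.
by rewrite -mulN1r val_ofM //; lia.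
Qed.

Lemma placeX x n : v (x ^+ n) = v x * n%:Z.
Proof.
elim: n => [|n IHn]; first by rewrite expr0 place1 mulr0.
have [->|x0] := eqVneq x 0; first by rewrite exprS mul0r val_of0 mul0r.
by rewrite exprS val_ofM ?expf_neq0 // IHn; lia.
Qed.

(* x lies in pi^N O_v, zero included: the value at 0 is the junk value 0. *)
Definition vge N x := (x == 0) || (N <= v x).

Lemma vge_closeE N x y : v_close v N x y <-> vge N (x - y).
Proof.
rewrite /v_close /vge subr_eq0; split=> [[->|->]|/orP[/eqP|]]; rewrite ?eqxx ?orbT //.
  by left.
by right.
Qed.

Lemma vge0 N : vge N 0. Proof. by rewrite /vge eqxx. Qed.

Lemma vgeD N x y : vge N x -> vge N y -> vge N (x + y).
Proof.
rewrite /vge; have [->|x0] := eqVneq x 0; first by rewrite add0r.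
have [->|y0] := eqVneq y 0; first by rewrite addr0 (negbTE x0).
have [//|s0] := eqVneq (x + y) 0; rewrite /= => hx hy.
by apply: le_trans (val_ofD v x0 y0 s0); rewrite le_min hx.
Qed.

Lemma vgeN N x : vge N (- x) = vge N x.
Proof. by rewrite /vge oppr_eq0 placeN. Qed.

Lemma vgeB N x y : vge N x -> vge N y -> vge N (x - y).
Proof. by move=> hx hy; rewrite vgeD ?vgeN. Qed.

Lemma vge_distC N x y : vge N (x - y) = vge N (y - x).
Proof. by rewrite -vgeN opprB. Qed.

Lemma vge_trans N x y z : vge N (x - y) -> vge N (y - z) -> vge N (x - z).
Proof. by move=> h1 h2; have := vgeD h1 h2; rewrite addrA subrK. Qed.

Lemma vge_sum N (I : Type) (r : seq I) (P : pred I) (F : I -> K) :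
  (forall i, P i -> vge N (F i)) -> vge N (\sum_(i <- r | P i) F i).
Proof. by move=> h; elim/big_ind: _ => //; [exact: vge0 | exact: vgeD]. Qed.

Lemma vgeM N M x y : vge N x -> vge M y -> vge (N + M) (x * y).
Proof.
rewrite /vge mulf_eq0; have [//|x0] := eqVneq x 0; have [//|y0] := eqVneq y 0.
by rewrite /= val_ofM // => hx hy; exact: lerD.
Qed.

Lemma vge_weak N M x : M <= N -> vge N x -> vge M x.
Proof. by move=> h /orP[/eqP->|h']; rewrite /vge ?eqxx // (le_trans h h') orbT. Qed.

Lemma in_val_ring x : (x \in val_ring v) = vge 0 x.
Proof. by rewrite /val_ring inE /vge; case: eqVneq => [->|] //=; rewrite val_of0. Qed.

Lemma vge01 : vge 0 1. Proof. by rewrite /vge place1 lexx orbT. Qed.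

Lemma vge0M N x y : vge 0 x -> vge N y -> vge N (x * y).
Proof. by move=> hx hy; rewrite -[N]add0r vgeM. Qed.

Lemma vgeX x n : vge 0 x -> vge 0 (x ^+ n).
Proof.
by move=> hx; elim: n => [|n IH]; rewrite ?expr0 ?vge01 // exprS vge0M.
Qed.

Lemma val_ring_subring : subring_closed (val_ring v).
Proof.
split=> [|x y|x y]; rewrite !in_val_ring ?vge01 //.
  exact: vgeB.
exact: vge0M.
Qed.

Lemma vge_all_eq0 x : (forall n : nat, vge n%:Z x) -> x = 0.
Proof.
move=> h; apply/eqP; apply: contraT => x0.
by have := h `|v x|.+1%N; rewrite /vge (negbTE x0) /=; lia.
Qed.


Lemma vge_divX pi n N x : v pi = 1 -> vge N (pi ^- n * x) = vge (N + n%:Z) x.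
Proof.
move=> hpi; have pi0 : pi != 0 by apply/eqP => e; move: hpi; rewrite e val_of0.
rewrite /vge mulf_eq0 invr_eq0 expf_eq0 (negbTE pi0) andbF /=.
case: eqVneq => //= x0; rewrite val_ofM ?invr_neq0 ?expf_neq0 //.
by rewrite placeV placeX hpi; lia.
Qed.

End PlaceTheory.

HB.instance Definition _ (K : fieldType) (v : place K) :=
  GRing.isSubringClosed.Build K (val_ring v) (val_ring_subring v).

Section RegularTheory.
Variables (K : fieldType) (oo : place K).

Lemma regularP x :
  reflect (forall v : place K, v <> oo -> vge v 0 x) (x \in regular_outside oo).
Proof.
apply: (iffP (asboolP _)) => h v vo; have := h v vo; by rewrite in_val_ring.
Qed.

Lemma regular_subring : subring_closed (regular_outside oo).
Proof.
split=> [|x y|x y].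
- by apply/regularP => v _; exact: vge01.
- by move=> /regularP hx /regularP hy; apply/regularP => v vo; rewrite vgeB ?hx ?hy.
- by move=> /regularP hx /regularP hy; apply/regularP => v vo; rewrite vge0M ?hx ?hy.
Qed.

HB.instance Definition _ := GRing.isSubringClosed.Build K
  (regular_outside oo) regular_subring.
End RegularTheory.

Section ConstantField.
Variables (F : finFieldType) (K : fieldType) (iota : {rmorphism F -> K}).

(** Nonzero constants are roots of unity, and the value group is torsion-free. *)
Lemma place_const (v : place K) c : v (iota c) = 0.
Proof.
have [->|c0] := eqVneq c 0; first by rewrite rmorph0 val_of0.
have := placeX v (iota c) #|F|.-1.
have -> : iota c ^+ #|F|.-1 = 1.
  have F1 : (0 < #|F|.-1)%N by rewrite -ltnS prednK ?finNzRing_gt1 // ltnW // finNzRing_gt1.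
  rewrite -rmorphXn; apply: (mulfI (_ : iota c != 0)); first by rewrite fmorph_eq0.
  by rewrite mulr1 -rmorphM -exprS prednK ?expf_card // (ltn_trans _ (finNzRing_gt1 F)).
rewrite place1; have := finNzRing_gt1 F; case: #|F| => [|[|m]] //= _.
by move/esym/eqP; rewrite mulf_eq0 orbF => /eqP.
Qed.

Lemma vge_const (v : place K) c : vge v 0 (iota c).
Proof. by rewrite /vge place_const lexx orbT. Qed.

Lemma const_regular oo c : iota c \in regular_outside oo.
Proof. by apply/regularP => v _; exact: vge_const. Qed.

Lemma vge_poly (v : place K) (z : K) (p : {poly F}) :
  vge v 0 z -> vge v 0 (map_poly iota p).[z].
Proof.
move=> hz; rewrite horner_coef; apply: vge_sum => i _.
by rewrite coef_map vge0M ?vge_const ?vgeX.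
Qed.
End ConstantField.

(** * Valuation rings of a function field *)

Lemma tall_mx_kernel (L : fieldType) (m n : nat) (E : 'M[L]_(m, n))
    (nm : (n < m)%N) : exists2 w : 'rV[L]_m, w != 0 & w *m E = 0.
Proof.
have : kermx E != 0.
  rewrite -mxrank_eq0 mxrank_ker subn_eq0 -ltnNge.
  exact: leq_ltn_trans (rank_leq_col E) nm.
case/rowV0Pn=> w /sub_kermxP wE w0; by exists w.
Qed.

Lemma tall_relation (L : fieldType) (P Q : finType) (E : P -> Q -> L) :
  (#|Q| < #|P|)%N ->
  exists2 w : P -> L, (exists p, w p != 0) & forall q, \sum_p w p * E p q = 0.
Proof.
move=> QP.
have [w w0 wE] := tall_mx_kernel
  (\matrix_(i < #|P|, j < #|Q|) E (enum_val i) (enum_val j)) QP.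
exists (fun p => w ord0 (enum_rank p)).
  case/rV0Pn: w0 => i wi; exists (enum_val i); by rewrite enum_valK.
move=> q; move/matrixP: wE => /(_ ord0 (enum_rank q)); rewrite !mxE => e.
rewrite -[RHS]e (reindex (@enum_val P (mem predT))) /=; last first.
  by exists enum_rank => x _; rewrite ?enum_valK ?enum_rankK.
by apply: eq_bigr => i _; rewrite mxE !enum_valK enum_rankK.
Qed.

(** * Linear relations with polynomial coefficients *)

Section PolyRelation.
Variables (F : finFieldType) (K : fieldType) (iota : {rmorphism F -> K}).
Hypothesis hK : is_global_function_field iota.

Let ev (x : K) : {rmorphism {poly F} -> K} := (horner_eval x \o map_poly iota).

Lemma size_polyM_bound (p q : {poly F}) a b :
  (size p <= a.+1)%N -> (size q <= b.+1)%N -> (size (p * q)%R <= (a + b).+1)%N.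
Proof.
move=> hp hq; apply: (leq_trans (size_polyMleq _ _)).
by rewrite -subn1 leq_subLR add1n -addSn -addnS leq_add.
Qed.

Lemma size_mulmx_bound m n p (X : 'M[{poly F}]_(m, n)) (Y : 'M[{poly F}]_(n, p)) a b :
  (forall i j, size (X i j) <= a.+1)%N -> (forall i j, size (Y i j) <= b.+1)%N ->
  forall i j, (size ((X *m Y) i j) <= (a + b).+1)%N.
Proof.
move=> hX hY i j; rewrite mxE; apply: (leq_trans (size_sum _ _ _)).
by apply/bigmax_leqP => k _; exact: size_polyM_bound.
Qed.

Lemma size_bounded m n (X : 'M[{poly F}]_(m, n)) :
  exists a, forall i j, (size (X i j) <= a.+1)%N.
Proof.
exists (\max_i \max_j size (X i j))%N => i j; apply: leqW.
by apply: (leq_trans _ (leq_bigmax i)); exact: (leq_bigmax j).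
Qed.

(* Multiplication by z on the K-span of b, written over F[t] with a common
   denominator s, has entries of bounded degree c; hence the elements
   z^i u_j, i < k, lie in a space of dimension about N c k over F, which is
   less than the number of these elements as soon as j takes N c + 1 values. *)
Lemma poly_relation (z : K) : exists M : nat, forall u : 'I_M -> K,
  exists c : 'I_M -> {poly F}, (exists i, c i != 0) /\
    \sum_i (map_poly iota (c i)).[z] * u i = 0.
Proof.
have [[t [ht [N [b hb]]]] _] := hK.
have ev_inj p : p != 0 -> ev t p != 0.
  by move=> p0; apply/eqP => e; apply: ht; exists p; last by apply/eqP.
pose beta : 'cV[K]_N := \col_j b j.
have common k (x : 'cV[K]_k) : exists2 s, s != 0 & exists U : 'M[{poly F}]_(k, N),
    map_mx (ev t) U *m beta = ev t s *: x.
  have /choice[p hp] : forall i, exists ps : ('I_N -> {poly F}) * ('I_N -> {poly F}),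
      (forall j, ps.2 j != 0) /\
      x i 0 = \sum_j ev t (ps.1 j) / ev t (ps.2 j) * b j.
    by move=> i; have [p [s [hs hx]]] := hb (x i 0); exists (p, s).
  pose s (ij : 'I_k * 'I_N) := (p ij.1).2 ij.2.
  exists (\prod_ij s ij).
    by apply/prodf_neq0 => ij _; exact: (hp _).1.
  exists (\matrix_(i, j) ((p i).1 j * \prod_(ij | ij != (i, j)) s ij)).
  apply/matrixP => i o; rewrite !mxE (ord1 o) (hp i).2 mulr_sumr.
  apply: eq_bigr => j _; rewrite !mxE mulrA; congr (_ * _).
  rewrite [in RHS](bigD1 (i, j)) //= !rmorphM /=.
  have h : ev t ((p i).2 j) != 0 by apply: ev_inj; exact: (hp _).1.
  move: h; rewrite /= /s /= => h.
  by field.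
have [s s0 [Z hZ]] := common N (z *: beta).
have [a ha] := size_bounded Z.
pose c := maxn a (size s).
have hZc i j : (size (Z i j) <= c.+1)%N.
  by apply: (leq_trans (ha i j)); rewrite ltnS leq_maxl.
have hsc : (size s <= c.+1)%N by apply: leqW; rewrite leq_maxr.
have hZX k i j : (size ((Z ^+ k) i j) <= (c * k).+1)%N.
  elim: k i j => [|k IHk] i j.
    rewrite expr0 mxE; case: eqP => _; rewrite ?mulr1n ?mulr0n ?size_poly1 ?size_poly0 //.
  rewrite exprSr mulnSr; exact: (size_mulmx_bound IHk hZc).
have hsX k : (size (s ^+ k) <= (c * k).+1)%N.
  apply: (leq_trans (size_poly_exp_leq _ _)); rewrite ltnS.
  by apply: leq_mul => //; case: (size s) hsc.
have Zbeta k : map_mx (ev t) (Z ^+ k) *m beta = (ev t s * z) ^+ k *: beta.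
  elim: k => [|k IHk]; first by rewrite !expr0 map_mx1 mul1mx scale1r.
  rewrite exprSr map_mxM -mulmxA hZ scalerA -scalemxAr IHk scalerA exprS //.
exists (N * c).+1 => u.
have [s' s'0 [U hU]] := common _ (\col_j u j).
have [d hd] := size_bounded U.
(* [B] bounds the number of coefficients of each entry of the [G i] below, so that the vanishing of
   a combination amounts to [B * N] equations over F. As [k] exceeds [N (d + 1)] by one, the
   [k (N c + 1)] unknowns outnumber them. *)
pose k := (N * d.+1).+1; pose B := (c * k.-1 + d).+1.
(* The power of [s] homogenizes: every [G i] represents the vector [z ^ i u] with the same factor
   [s(t) ^ (k-1) s'(t)], which is cancelled at the end. *)
pose G (i : 'I_k) := s ^+ (k.-1 - i) *: (U *m Z ^+ i).
have hG i j l : (size (G i j l) <= B)%N.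
  rewrite mxE.
  apply: leq_trans (size_polyM_bound (hsX _) (size_mulmx_bound hd (hZX i) j l)) _.
  by rewrite /B ltnS addnCA addnC leq_add2r -mulnDr subnK // -ltnS ltn_ord.
have Gbeta i : map_mx (ev t) (G i) *m beta =
    (ev t s ^+ k.-1 * ev t s' * z ^+ i) *: \col_j u j.
  rewrite map_mxZ -scalemxAl map_mxM -mulmxA Zbeta -scalemxAr hU !scalerA.
  congr (_ *: _); rewrite rmorphXn exprMn.
  have -> : ev t s ^+ k.-1 = ev t s ^+ (k.-1 - i) * ev t s ^+ i.
    by rewrite -exprD subnK // -ltnS ltn_ord.
  by rewrite /=; ring.
have card_lt : (#|{: 'I_B * 'I_N}| < #|{: 'I_k * 'I_(N * c).+1}|)%N.
  rewrite !card_prod !card_ord /B /k /=; nia.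
have [w [p0 wp0] wE] := tall_relation (fun p q => (G p.1 p.2 q.2)`_(val q.1)) card_lt.
exists (fun j => \poly_(i < k) (if insub i is Some i' then w (i', j) else 0)); split.
  exists p0.2; apply/eqP => /(congr1 (fun r : {poly F} => r`_(val p0.1))).
  rewrite coef0 coef_poly ltn_ord valK => /eqP.
  by case: p0 wp0 => [i j] /= /negbTE ->.
have G0 l : \sum_p w p *: G p.1 p.2 l = 0.
  apply/polyP => n; rewrite coef0 coef_sum.
  have [nB|Bn] := ltnP n B; last first.
    by rewrite big1 // => p _; rewrite coefZ nth_default ?mulr0 // (leq_trans (hG _ _ _)).
  rewrite -[RHS](wE (Ordinal nB, l)); by apply: eq_bigr => p _; rewrite coefZ.
have S0 : \sum_p iota (w p) * (z ^+ p.1 * u p.2) = 0.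
  apply: (mulfI (_ : ev t s ^+ k.-1 * ev t s' != 0)).
    by rewrite mulf_neq0 ?expf_neq0 ?ev_inj.
  rewrite mulr0 mulr_sumr.
  transitivity (\sum_p iota (w p) * (\sum_l ev t (G p.1 p.2 l) * b l)).
    apply: eq_bigr => p _; rewrite mulrCA; congr (_ * _).
    move/matrixP: (Gbeta p.1) => /(_ p.2 0); rewrite !mxE mulrA => <-.
    by apply: eq_bigr => l _; rewrite !mxE.
  under eq_bigr do rewrite mulr_sumr.
  rewrite exchange_big big1 // => l _.
  under eq_bigr do rewrite mulrA.
  rewrite -mulr_suml -[X in X * _](_ : ev t (\sum_p w p *: G p.1 p.2 l) = _).
    by rewrite G0 rmorph0 mul0r.
  rewrite rmorph_sum /=; apply: eq_bigr => p _.
  by rewrite linearZ /= /horner_eval hornerZ.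
transitivity (\sum_j \sum_(i < k) iota (w (i, j)) * (z ^+ i * u j)).
  apply: eq_bigr => j _.
  rewrite (@horner_coef_wide _ k) ?size_map_poly ?size_poly //.
  rewrite mulr_suml; apply: eq_bigr => i _.
  by rewrite coef_map coef_poly ltn_ord valK mulrA.
rewrite -[RHS]S0 exchange_big pair_big; by apply: eq_bigr => -[i j].
Qed.
End PolyRelation.

Section Relation0.
Variables (F : finFieldType) (K : fieldType) (iota : {rmorphism F -> K}).
Hypothesis hK : is_global_function_field iota.

(** Dividing by the largest power of the variable common to all coefficients leaves a nonzero
    constant term. Constant terms are what survives modulo an ideal containing [z]. *)
Lemma poly_relation0 (z : K) : z != 0 -> exists M : nat, forall u : 'I_M -> K,
  exists c : 'I_M -> {poly F}, (exists i, (c i)`_0 != 0) /\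
    \sum_i (map_poly iota (c i)).[z] * u i = 0.
Proof.
move=> z0; have [M hM] := poly_relation hK z; exists M => u.
have [c [[i ci] cu]] := hM u.
have ex : exists n, [exists i, (c i)`_n != 0].
  exists (size (c i)).-1; apply/existsP; exists i.
  by rewrite -lead_coefE lead_coef_eq0.
case: (ex_minnP ex) => n /existsP[j cj] nmin.
exists (fun i => drop_poly n (c i)); split; first by exists j; rewrite coef_drop_poly.
apply: (mulfI (expf_neq0 n z0)); rewrite mulr0 -[RHS]cu mulr_sumr.
apply: eq_bigr => k _; rewrite mulrA; congr (_ * _).
rewrite -[in RHS](poly_take_drop n (c k)) (_ : take_poly n (c k) = 0); last first.
  apply/polyP => l; rewrite coef_take_poly coef0; case: ltnP => // ln.
  by apply/eqP; apply: contraLR ln => cl; rewrite -leqNgt nmin //; apply/existsP; exists k.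
by rewrite add0r rmorphM /= map_polyXn hornerM hornerXn mulrC.
Qed.

Lemma horner_coef0_tail (z : K) (c : {poly F}) : exists r : {poly F},
  (map_poly iota c).[z] = iota c`_0 + z * (map_poly iota r).[z].
Proof.
exists (drop_poly 1 c); rewrite -[in LHS](poly_take_drop 1 c) rmorphD rmorphM /=.
rewrite map_polyXn hornerD hornerM hornerXn expr1 mulrC; congr (_ + _).
rewrite (_ : take_poly 1 c = (c`_0)%:P) ?map_polyC ?hornerC //.
by apply/polyP => i; rewrite coef_take_poly coefC; case: i.
Qed.
End Relation0.

(** * Valuation rings containing the constants are discrete *)

Section ValuationRing.
Variables (F : finFieldType) (K : fieldType) (iota : {rmorphism F -> K}).
Hypothesis hK : is_global_function_field iota.
Variable W : subringClosed K.
Hypothesis Wval : forall x, x \in W \/ x^-1 \in W.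
Hypothesis WF : forall c, iota c \in W.

(** [m] is the maximal ideal of [W] and [un] its group of units. The clause [x == 0] is there
    because [0^-1 = 0] lies in [W]. *)
Let m x := (x \in W) && ((x == 0) || (x^-1 \notin W)).
Let un x := [&& x != 0, x \in W & x^-1 \in W].

Let mW x : m x -> x \in W. Proof. by case/andP. Qed.

Let un_or_m x : x \in W -> un x || m x.
Proof. by rewrite /un /m => ->; case: eqP; case: (_ \in W). Qed.

Let un_not_m x : un x -> ~~ m x.
Proof. by rewrite /un /m => /and3P[/negbTE-> -> ->]. Qed.

Let mMl x y : m x -> y \in W -> m (x * y).
Proof.
move=> /andP[xW h] yW; rewrite /m rpredM //= mulf_eq0.
case: eqVneq h => //= x0 h; case: eqVneq => //= y0.
apply: contra h => h; have -> : x^-1 = y * (x * y)^-1 by field; apply/andP.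
exact: rpredM.
Qed.

Let mMr x y : x \in W -> m y -> m (x * y).
Proof. by rewrite mulrC => xW my; exact: mMl. Qed.

Let mD x y : m x -> m y -> m (x + y).
Proof.
wlog xy : x y / y / x \in W.
  move=> wl mx my; have [] := Wval (y / x); first by move=> h; exact: wl.
  by rewrite invf_div addrC => h; exact: wl.
move=> mx my; have [x0|x0] := eqVneq x 0; first by rewrite x0 add0r.
have -> : x + y = x * (1 + y / x) by field.
by apply: mMl => //; rewrite rpredD ?rpred1.
Qed.

Let mN x : m (- x) = m x.
Proof. by rewrite /m rpredN oppr_eq0 invrN rpredN. Qed.

Let m0 : m 0. Proof. by rewrite /m rpred0 eqxx. Qed.

Let un1 : un 1. Proof. by rewrite /un oner_neq0 invr1 rpred1. Qed.

Let unM x y : un x -> un y -> un (x * y).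
Proof.
move=> /and3P[x0 xW xV] /and3P[y0 yW yV].
by rewrite /un mulf_neq0 // invfM !rpredM.
Qed.

Let unV x : un x -> un x^-1.
Proof. by move=> /and3P[x0 xW xV]; rewrite /un invr_eq0 x0 invrK xW xV. Qed.

Let un_const c : c != 0 -> un (iota c).
Proof. by move=> c0; rewrite /un fmorph_eq0 c0 -fmorphV !WF. Qed.

Let poly_W (x : K) (p : {poly F}) : x \in W -> (map_poly iota p).[x] \in W.
Proof.
move=> xW; rewrite horner_coef rpred_sum // => i _.
by rewrite coef_map rpredM ?rpredX ?WF.
Qed.

(* In a relation sum_i c_i(t) y_i = 0 with some c_i(0) != 0, the first such
   term would have strictly smaller valuation than all the others. *)
Lemma chain_bound t : m t -> t != 0 -> exists M : nat, forall (k : nat) (y : nat -> K),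
  (forall i, y i != 0) -> (forall i, y i \in W) ->
  (forall i, (i < k)%N -> m (y i.+1 / y i)) -> m (t / y k) -> (k < M)%N.
Proof.
move=> mt t0; have [M hM] := poly_relation0 hK t0; exists M => k y y0 yW hy htk.
rewrite ltnNge; apply/negP => Mk.
have chain i j : (i < j <= k)%N -> m (y j / y i).
  elim: j => [|j IH]; first by rewrite ltn0.
  rewrite ltnS => /andP[ij jk].
  have h : m (y j.+1 / y j) by apply: hy.
  have [ji|ji] := leqP j i; first by have -> : i = j by lia.
  have -> : y j.+1 / y i = (y j.+1 / y j) * (y j / y i) by field; rewrite !y0.
  by apply: mMl => //; apply: mW; apply: IH; lia.
have tchain i : (i <= k)%N -> m (t / y i).
  move=> ik; have [->//|{}ik'] := eqVneq i k.
  have -> : t / y i = (t / y k) * (y k / y i) by field; rewrite !y0.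
  by apply: mMl => //; apply: mW; apply: chain; lia.
have [c [[i ci] cy]] := hM (fun i => y i).
case: (arg_minnP (P := fun i => (c i)`_0 != 0) val ci) => {ci}i /= ci imin.
have ik : (i <= k)%N by apply: leq_trans Mk; apply: ltnW.
have : m (iota (c i)`_0); last first.
  by apply/negP; apply: un_not_m; exact: un_const.
have [r hr] := horner_coef0_tail iota t (c i).
have -> : iota (c i)`_0 = - (t * (map_poly iota r).[t] +
    \sum_(j | j != i) (map_poly iota (c j)).[t] * (y j / y i)).
  apply/eqP; rewrite -addr_eq0 addrA -hr; apply/eqP.
  apply: (mulIf (y0 i)); rewrite mul0r -[RHS]cy [RHS](bigD1 i) //= mulrDl.
  congr (_ + _); rewrite mulr_suml; apply: eq_bigr => j _.
  by rewrite -mulrA divfK.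
rewrite mN; apply: mD; first by apply: mMl => //; apply: poly_W; exact: mW.
elim/big_ind: _ => [|a b|j ji]; [exact: m0 | exact: mD |].
have [ij|ji'] := ltnP i j.
  apply: mMr; first by apply: poly_W; exact: mW.
  by apply: chain; rewrite ij (leq_trans (ltnW (ltn_ord j))).
(* For [j < i] the constant term of [c j] vanishes by minimality of [i]; the factor [t] thus gained
   compensates the denominator [y i], because [t / y i] is in [m]. *)
have [s ->] := horner_coef0_tail iota t (c j).
have -> : (c j)`_0 = 0.
  apply/eqP; apply/negPn/negP => /imin; rewrite leqNgt ltn_neqAle ji' andbT.
  by move/negP; apply; rewrite -val_eqE in ji.
rewrite rmorph0 add0r.
have -> : t * (map_poly iota s).[t] * (y j / y i) =
   (t / y i) * ((map_poly iota s).[t] * y j) by ring.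
apply: mMl; first exact: tchain.
by rewrite rpredM ?poly_W // mW.
Qed.

Hypothesis Wproper : exists x, x \notin W.

(** In a longest chain of strictly increasing values from [1] to [t], the first term after [1] is a
    uniformizer: an [x] in [m] not divisible by it could be inserted before it. Appending [t]
    provides such a term even if the chain is reduced to [1]. *)
Lemma uniformizer : exists2 pi, m pi & pi != 0 /\ forall x, m x -> x / pi \in W.
Proof.
have [t mt t0] : exists2 t, m t & t != 0.
  have [x xW] := Wproper; exists x^-1.
    have [h|h] := Wval x; first by rewrite h in xW.
    by rewrite /m h invrK xW orbT.
  by rewrite invr_eq0; apply: contraNneq xW => ->; rewrite rpred0.
have [M hM] := chain_bound mt t0.
pose Ch k := `[< exists y : nat -> K,
  [/\ forall i, y i != 0, forall i, y i \in W, y 0%N = 1,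
      forall i, (i < k)%N -> m (y i.+1 / y i) & m (t / y k)] >].
have exCh : exists k, Ch k.
  exists 0%N; apply/asboolP; exists (fun _ => 1); split=> //.
  - by move=> _; exact: oner_neq0.
  - by move=> _; exact: rpred1.
  by rewrite divr1.
have bCh k : Ch k -> (k <= M)%N.
  by case/asboolP => y [y0 yW _ hy ht]; apply: ltnW; exact: (hM k y).
case: (ex_maxnP exCh bCh) => k /asboolP[y [y0 yW y01 hy ht]] kmax.
pose y' i := if (i <= k)%N then y i else t.
have y'0 i : y' i != 0 by rewrite /y'; case: ifP.
have y'W i : y' i \in W by rewrite /y'; case: ifP => // _; exact: mW.
have hy' i : (i <= k)%N -> m (y' i.+1 / y' i).
  rewrite /y' => ik; rewrite ik; case: ifP => [/hy//|/negbT].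
  by rewrite -ltnNge ltnS => ki; rewrite (_ : i = k) //; lia.
exists (y' 1%N).
  by have := hy' 0%N isT; rewrite [y' 0%N]/y' /= y01 divr1.
split=> // x mx; have [x0|x0] := eqVneq x 0; first by rewrite x0 mul0r rpred0.
have [//|h] := Wval (x / y' 1%N).
apply: contraT => hn; have {h} h : m (y' 1%N / x).
  by rewrite -invf_div /m h invrK hn orbT.
suff /kmax : Ch k.+1 by rewrite ltnn.
pose z i := if i is i'.+1 then if i' is i''.+1 then y' i'' .+1 else x else 1.
apply/asboolP; exists z; split=> //.
- by move=> [|[|i]] //=; exact: oner_neq0.
- by move=> [|[|i]] //=; rewrite ?rpred1 ?mW.
- by move=> [|[|i]] //=; rewrite ?divr1 // => ik; apply: hy'; apply: ltnW.
- have [k0|] := posnP k; first by move: h; rewrite /z k0 /y' k0.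
  by move=> kp; move: ht; rewrite -(prednK kp) /z /y' prednK // leqnn.
Qed.

(** The value of [x] is the exponent [n] with [x / pi ^ n] a unit. The powers of [pi] dividing [x]
    form a chain, bounded by [chain_bound], and an [x] outside [W] is treated through its
    inverse. *)
Lemma place_of_valuation_ring :
  exists v : place K, forall x, (x \in val_ring v) = (x \in W).
Proof.
have [pi mpi [pi0 piP]] := uniformizer.
have unP x : x \in W -> x / pi \notin W -> un x.
  move=> xW h; have := un_or_m xW; case: (un x) => //= /piP h'.
  by rewrite h' in h.
have decomp_nat x : x \in W -> x != 0 -> exists n : nat, un (x / pi ^+ n).
  move=> xW x0; have [ux|mx] := orP (un_or_m xW).
    by exists 0%N; rewrite expr0 divr1.
  have [M hM] := chain_bound mx x0.
  have ex : exists n, x / pi ^+ n.+1 \notin W.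
    exists M; apply/negP => h.
    suff : (M < M)%N by rewrite ltnn.
    apply: (hM M (fun i => pi ^+ i)) => [i|i|i _|].
    - exact: expf_neq0.
    - by rewrite rpredX ?mW.
    - by rewrite exprS mulfK ?expf_neq0.
    - have -> : x / pi ^+ M = pi * (x / pi ^+ M.+1).
        by rewrite exprS invfM; field; rewrite pi0 expf_neq0.
      exact: mMl.
  case: (ex_minnP ex) => n hn nmin; exists n; apply: unP; last first.
    by rewrite -mulrA -invfM -exprSr.
  case: n {hn} nmin => [|n] nmin; first by rewrite expr0 divr1.
  by apply: contraT => /nmin; rewrite ltnn.
(* Zero gets exponent 0, the conventional value required by [val_of0]. *)
have decomp x : exists n : int, (x = 0 -> n = 0) /\ (x != 0 -> un (x / pi ^ n)).
  have [->|x0] := eqVneq x 0; first by exists 0.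
  have [xW|xW] := Wval x.
    have [n hn] := decomp_nat x xW x0; exists n%:Z; split=> // e.
    by rewrite e eqxx in x0.
  have [|n hn] := decomp_nat _ xW _; first by rewrite invr_eq0.
  exists (- n%:Z); split=> [e|_]; first by rewrite e eqxx in x0.
  by rewrite -[_ / _]invrK unV // invfM -exprnN invrK.
have [w hw] := choice decomp.
have w0 : w 0 = 0 by case: (hw 0) => ->.
have wP x : x != 0 -> un (x / pi ^ w x) by case: (hw x).
have pinW (n : nat) : (0 < n)%N -> ~~ (pi ^- n \in W).
  move=> np; apply/negP => h; suff /un_not_m : un pi by rewrite mpi.
  rewrite /un pi0 mW //= -[pi^-1]mulr1 -(divff (expf_neq0 n.-1 pi0)).
  rewrite mulrCA -invfM -exprS prednK //. 
  by apply: rpredM => //; apply: rpredX; exact: mW.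
have pizW n : pi ^ n \in W -> 0 <= n.
  by case: n => // n; rewrite NegzE -exprnN => h; have := pinW n.+1 isT; rewrite h.
have piun n : un (pi ^ n) -> n = 0.
  move=> /and3P[_ h1 h2]; have := pizW _ h1; have := pizW (- n).
  by rewrite -invr_expz => /(_ h2); lia.
have wuniq x n : x != 0 -> un (x / pi ^ n) -> w x = n.
  move=> x0 h; apply/eqP; rewrite -subr_eq0; apply/eqP; apply: piun.
  have -> : pi ^ (w x - n) = (x / pi ^ n) * (x / pi ^ w x)^-1.
    by rewrite expfzDr // -invr_expz; field; rewrite x0 !expfz_neq0.
  by rewrite unM ?unV ?wP.
have wW x : x != 0 -> (0 <= w x) = (x \in W).
  move=> x0; have := wP x x0 => /and3P[_ h1 h2].
  apply/idP/idP => [w0'|xW].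
    rewrite -[x](divfK (expfz_neq0 (w x) pi0)) rpredM //.
    by case: (w x) w0' => // n _; rewrite -exprnP rpredX ?mW.
  apply: pizW; have -> : pi ^ w x = x * (x / pi ^ w x)^-1.
    by field; rewrite x0 expfz_neq0.
  exact: rpredM.
have wM x y : x != 0 -> y != 0 -> w (x * y) = w x + w y.
  move=> x0 y0; apply: wuniq; first exact: mulf_neq0.
  by rewrite expfzDr // invfM mulrACA unM ?wP.
have wD x y : x != 0 -> y != 0 -> x + y != 0 -> Order.min (w x) (w y) <= w (x + y).
  wlog xy : x y / w x <= w y.
    move=> wl x0 y0 s0; have [h|h] := leP (w x) (w y); first by have := wl _ _ h x0 y0 s0; rewrite min_l.
    by have := wl _ _ (ltW h) y0 x0; rewrite addrC min_l ?(ltW h) //; apply.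
  move=> x0 y0 s0; rewrite min_l //.
  have e : y = x * (y / x) by field.
  have r0 : y / x != 0 by rewrite mulf_neq0 ?invr_eq0.
  have e1 : x + y = x * (1 + y / x) by field.
  have s1 : 1 + y / x != 0 by apply: contraNneq s0 => h; rewrite e1 h mulr0.
  rewrite e1 wM // lerDl wW // rpredD ?rpred1 // -wW //.
  by rewrite e wM // in xy; move: xy; rewrite lerDl.
have wpi : exists2 x, x != 0 & w x = 1.
  by exists pi => //; apply: wuniq; rewrite // expr1z divff.
exists (Place w0 wM wD wpi) => x; rewrite inE /=.
by have [->|x0] := eqVneq x 0; rewrite ?w0 ?rpred0 ?wW.
Qed.
End ValuationRing.

(** * Chevalley's extension theorem *)

Section SpanOver.
Variable K : pzRingType.
Implicit Types (a S : K -> Prop) (x y : K).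

(** Nothing is assumed of [a] and [S]: the same definition serves for the ideal generated by [a] in
    a ring [S] and for products of lattices in a noncommutative algebra. *)
Definition span_over a S x : Prop :=
  exists k (c s : 'I_k -> K), (forall i, a (c i) /\ S (s i)) /\ x = \sum_i c i * s i.

Lemma span_over0 a S : span_over a S 0.
Proof. by exists 0%N, (fun _ => 0), (fun _ => 0); split=> [[]|]; rewrite ?big_ord0. Qed.

Lemma span_overD a S x y : span_over a S x -> span_over a S y -> span_over a S (x + y).
Proof.
move=> [k [c [s [h ->]]]] [l [d [t [h' ->]]]].
exists (k + l)%N, (fun i => match split i with inl j => c j | inr j => d j end),
  (fun i => match split i with inl j => s j | inr j => t j end); split.
  by move=> i; case: split.
rewrite big_split_ord; congr (_ + _); apply: eq_bigr => i _.
  by rewrite (unsplitK (inl i)).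
by rewrite (unsplitK (inr i)).
Qed.

Lemma span_overM a S x y : (forall s t, S s -> S t -> S (s * t)) ->
  span_over a S x -> S y -> span_over a S (x * y).
Proof.
move=> SM [k [c [s [h ->]]]] Sy; exists k, c, (fun i => s i * y); split.
  by move=> i; have [? ?] := h i; split=> //; exact: SM.
by rewrite mulr_suml; apply: eq_bigr => i _; rewrite mulrA.
Qed.

End SpanOver.

Section Chevalley.
Variable K : fieldType.
Implicit Types (a S : K -> Prop) (x y : K).

Definition subring_set S : Prop :=
  [/\ S 1, forall x y, S x -> S y -> S (x - y) & forall x y, S x -> S y -> S (x * y)].

Lemma subring_setD S x y : subring_set S -> S x -> S y -> S (x + y).
Proof.
move=> [S1 SB SM] Sx Sy; rewrite -[y]opprK; apply: (SB) => //.
by rewrite -[- y]add0r; apply: (SB) => //; rewrite -(subrr 1); apply: (SB).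
Qed.

Lemma subring_set0 S : subring_set S -> S 0.
Proof. by move=> [S1 SB _]; rewrite -(subrr 1); apply: SB. Qed.

(** A certificate that [a] generates the unit ideal of [S[x]]. *)
Definition unit_poly a S x (p : {poly K}) : Prop :=
  (forall i, span_over a S p`_i) /\ p.[x] = 1.

(** The degree reduction in Chevalley's theorem: the relation for [x^-1], multiplied by a power of
    [x], rewrites the leading term of the relation for [x] in lower degrees. *)
Lemma unit_poly_reduce a S x (p q : {poly K}) : subring_set S -> x != 0 ->
  (forall y, a y -> S y) -> ~ span_over a S 1 ->
  unit_poly a S x p -> unit_poly a S x^-1 q ->
  (size q <= size p)%N -> exists2 p', unit_poly a S x p' & (size p' < size p)%N.
Proof.
move=> Sring x0 aS n1 [pa px] [qa qx] qp; have [S1 SB SM] := Sring.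
have S0 := subring_set0 Sring.
have spS y : span_over a S y -> S y.
  move=> [k [c [s [h ->]]]]; elim/big_ind: _ => // [u w|i _]; first exact: subring_setD.
  by have [/aS ? ?] := h i; exact: SM.
have [p1|] := leqP (size p) 1.
  case: n1; have := pa 0%N; move: px.
  by rewrite (size1_polyC p1) hornerC coefC => ->.
case sp : (size p) => [|[|n]] // _.
pose b := p`_n.+1.
(* From [q(x^-1) = 1] comes [(1 - q_0) x^(n+1) = sum_(j <= n) q_(n+1-j) x^j]. This is substituted
   for the leading term in [1 = q_0 + (1 - q_0) p(x)]. *)
exists ((q`_0)%:P + (1 - q`_0) *: take_poly n.+1 p + \poly_(j < n.+1) (b * q`_(n.+1 - j))).
  split.
    move=> i; rewrite !coefD coefC coefZ coef_take_poly coef_poly.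
    apply: span_overD; first apply: span_overD.
    - by case: eqP => _ //; exact: span_over0.
    - rewrite mulrC; case: ifP => _; last by rewrite mul0r; exact: span_over0.
      by apply: span_overM => //; apply: SB => //; apply: spS.
    - by case: ifP => _; [apply: span_overM; [exact: SM | exact: pa | exact: spS] | exact: span_over0].
  have ep : p.[x] = (take_poly n.+1 p).[x] + b * x ^+ n.+1.
    rewrite -[in LHS](poly_take_drop n.+1 p) hornerD hornerM hornerXn; congr (_ + _ * _).
    have -> : drop_poly n.+1 p = b%:P; last by rewrite hornerC.
    apply/polyP => i; rewrite coef_drop_poly coefC; case: i => [|i] //=.
    by rewrite nth_default // sp; lia.
  have eq : x ^+ n.+1 = q`_0 * x ^+ n.+1 + \sum_(j < n.+1) q`_(n.+1 - j) * x ^+ j.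
    rewrite -[LHS]mulr1 -qx (@horner_coef_wide _ n.+2) ?(leq_trans qp) ?sp //.
    rewrite big_ord_recl mulrDr expr0 mulr1 mulrC; congr (_ + _).
    rewrite (reindex_inj rev_ord_inj) mulr_sumr; apply: eq_bigr => j _ /=.
    rewrite /bump /= add1n subnSK ?ltn_ord // subSn -1?ltnS ?ltn_ord // mulrCA; congr (_ * _).
    have jn : (j <= n)%N by rewrite -ltnS.
    rewrite exprVn -{1}(subnKC (leqW jn)) exprD.
    rewrite subSn // mulfK ?expf_neq0 //.
  rewrite !hornerD hornerC hornerZ horner_poly.
  under eq_bigr do rewrite -mulrA; rewrite -mulr_sumr.
  have -> : \sum_(j < n.+1) q`_(n.+1 - j) * x ^+ j = (1 - q`_0) * x ^+ n.+1.
    by rewrite mulrBl mul1r {1}eq; ring.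
  have -> : (take_poly n.+1 p).[x] = 1 - b * x ^+ n.+1 by rewrite -px ep addrK.
  by ring.
apply: leq_ltn_trans (size_polyD _ _) _; rewrite gtn_max; apply/andP; split; last first.
  by rewrite ltnS size_poly.
apply: leq_ltn_trans (size_polyD _ _) _; rewrite gtn_max; apply/andP; split.
  by apply: leq_ltn_trans (size_polyC_leq1 _) _.
apply: leq_ltn_trans (size_scale_leq _ _) _; rewrite ltnS; exact: size_take_poly.
Qed.

Lemma unit_poly_absurd a S x (p q : {poly K}) : subring_set S -> x != 0 ->
  (forall y, a y -> S y) -> ~ span_over a S 1 ->
  unit_poly a S x p -> unit_poly a S x^-1 q -> False.
Proof.
move=> Sring x0 aS n1.
have [n] := ubnP (size p + size q); elim: n p q => // n IH p q pqn hp hq.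
have [h|h] := leqP (size q) (size p).
  have [p' hp' lt] := unit_poly_reduce Sring x0 aS n1 hp hq h.
  by apply: (IH p' q) => //; lia.
rewrite -[x]invrK in hp.
have [||q' hq' lt] := unit_poly_reduce Sring _ aS n1 hq hp; rewrite ?invr_eq0 ?(ltnW h) //.
by rewrite invrK in hp; apply: (IH p q') => //; lia.
Qed.

Definition adjoin S x y := exists2 p : {poly K}, (forall i, S p`_i) & y = p.[x].

Lemma adjoin_subring S x : subring_set S -> subring_set (adjoin S x).
Proof.
move=> Sring; have [S1 SB SM] := Sring; have S0 := subring_set0 Sring; split.
- by exists 1 => [i|]; rewrite ?hornerC // coefC; case: ifP.
- move=> _ _ [p hp ->] [q hq ->]; exists (p - q) => [i|]; last by rewrite hornerD hornerN.
  by rewrite coefB; exact: SB.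
- move=> _ _ [p hp ->] [q hq ->]; exists (p * q) => [i|]; last by rewrite hornerM.
  rewrite coefM; elim/big_ind: _ => // [u w|j _]; [exact: subring_setD|exact: SM].
Qed.

Lemma span_adjoin a S x y : subring_set S -> span_over a (adjoin S x) y ->
  exists2 p : {poly K}, (forall i, span_over a S p`_i) & y = p.[x].
Proof.
move=> Sring [k [c [s [h ->]]]].
have /choice[p hp] : forall i, exists p : {poly K}, (forall j, S p`_j) /\ s i = p.[x].
  by move=> i; have [_ [p hp e]] := h i; exists p.
exists (\sum_i c i *: p i) => [j|].
  rewrite coef_sum; elim/big_ind: _ => [|u w|i _]; first exact: span_over0.
    exact: span_overD.
  rewrite coefZ; exists 1%N, (fun _ => c i), (fun _ => (p i)`_j).
  by rewrite big_ord1; split=> // _; split; [exact: (h i).1 | exact: (hp i).1].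
rewrite horner_sum; apply: eq_bigr => i _.
by rewrite hornerZ (hp i).2.
Qed.

(** Zorn's lemma for the rings containing [B] in which [a] does not generate the unit ideal. If a
    maximal one missed both [x] and [x^-1], adjoining either would produce a [unit_poly], contrary
    to [unit_poly_absurd]. *)
Lemma exists_valuation_ring (B : subringClosed K) a : (forall y, a y -> y \in B) ->
  ~ span_over a (fun y => y \in B) 1 ->
  exists W : subringClosed K, [/\ {subset B <= W}, forall x, x \in W \/ x^-1 \in W
    & ~ span_over a (fun y => y \in W) 1].
Proof.
move=> aB n1.
pose good (S : K -> Prop) := [/\ subring_set S, forall y, y \in B -> S y & ~ span_over a S 1].
have goodB : good (fun y => y \in B).
  split=> //; split; [exact: rpred1 | by move=> *; exact: rpredB | by move=> *; exact: rpredM].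
(* [good] is asked of nonempty sets only, because the union of the empty chain is empty and has to
   qualify as well. *)
have [F FP Ftot|S [Sgood Smax]] := @Zorn_bigcup K (fun S => (exists y, S y) -> good S).
  case=> y0 [S0 FS0 S0y0].
  have memF u w : (exists2 S, F S & S u) -> (exists2 S, F S & S w) ->
      exists2 S, F S & S u /\ S w.
    move=> [S FS Su] [T FT Tw]; have [h|h] := Ftot S T FS FT.
      by exists T => //; split=> //; exact: h.
    by exists S => //; split=> //; exact: h.
  have gF S u : F S -> S u -> good S by move=> FS Su; apply: (FP S FS); exists u.
  split.
  - split.
    + by have [[S1 _ _] _ _] := gF _ _ FS0 S0y0; exists S0.
    + move=> u w hu hw; have [S FS [Su Sw]] := memF u w hu hw.
      by have [[_ SB _] _ _] := gF _ _ FS Su; exists S => //; exact: SB.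
    + move=> u w hu hw; have [S FS [Su Sw]] := memF u w hu hw.
      by have [[_ _ SM] _ _] := gF _ _ FS Su; exists S => //; exact: SM.
  - by move=> y yB; have [_ h _] := gF _ _ FS0 S0y0; exists S0 => //; exact: h.
  - move=> [k [c [s [h e]]]].
    have [S FS hS] : exists2 S, F S & forall i, S (s i).
      elim: k c s h {e} => [|k IH] c s h; first by exists S0 => // -[].
      have [|S FS hS] := IH (fun i => c (lift ord0 i)) (fun i => s (lift ord0 i)).
        by move=> i; exact: h.
      have [T FT Ts0] := (h ord0).2; have [ST|TS] := Ftot S T FS FT.
        by exists T => // i; case: (unliftP ord0 i) => [j|] -> //; apply: ST.
      by exists S => // i; case: (unliftP ord0 i) => [j|] -> //; apply: TS.
    have [S1S | ne] := pselect (exists y, S y).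
      have [_ _] := FP S FS S1S; apply; exists k, c, s; split=> // i.
      by split; [exact: (h i).1 | exact: hS].
    case: k c s h e hS => [|k] c s h e hS.
      by move/eqP: e; rewrite big_ord0 oner_eq0.
    by apply: ne; exists (s ord0).
have [ne|ne] := pselect (exists y, S y); last first.
  exfalso; apply: (Smax (fun y => y \in B)); last by move=> _.
  by split=> [y Sy|h]; [case: ne; exists y | apply: ne; exists 1; apply: h; exact: rpred1].
have [Sring BS Sn1] := Sgood ne; have [S1 SB SM] := Sring.
have aS y : a y -> S y by move=> /aB/BS.
pose W0 : {pred K} := [pred x | `[< S x >]].
have W0P x : (x \in W0) = `[< S x >] by [].
have W0s : subring_closed W0.
  split=> [|x y|x y]; rewrite !W0P; first exact/asboolP.
    by move=> /asboolP Sx /asboolP Sy; apply/asboolP; exact: SB.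
  by move=> /asboolP Sx /asboolP Sy; apply/asboolP; exact: SM.
pose W : subringClosed K := HB.pack W0 (GRing.isSubringClosed.Build K W0 W0s).
exists W; split.
- by move=> x xB; rewrite [_ \in _]W0P; apply/asboolP; exact: BS.
- move=> x; rewrite ![_ \in _]W0P.
  have [Sx|Sx] := asboolP (S x); first by left.
  have [Sx'|Sx'] := asboolP (S x^-1); first by right.
  have x0 : x != 0 by apply: contra_notN Sx => /eqP->; exact: subring_set0.
  have grow y : ~ S y -> exists p, unit_poly a S y p.
    move=> Sy; apply: contrapT => np; apply: (Smax (adjoin S y)).
      split; last first.
        by move=> h; apply: Sy; apply: h; exists 'X; rewrite ?hornerX // => i; rewrite coefX; case: eqP => _ //; exact: subring_set0.
      move=> z Sz; exists z%:P; rewrite ?hornerC // => i; rewrite coefC.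
      by case: ifP => // _; exact: subring_set0.
    move=> _; split; first exact: adjoin_subring.
      move=> z /BS Sz; exists z%:P; rewrite ?hornerC // => i; rewrite coefC.
      by case: ifP => // _; exact: subring_set0.
    by move/(span_adjoin Sring) => [p hp e]; apply: np; exists p; split.
  have [p hp] := grow _ Sx; have [q hq] := grow _ Sx'.
  by case: (unit_poly_absurd Sring x0 aS Sn1 hp hq).
- move=> [k [c [s [h e]]]]; apply: Sn1; exists k, c, s; split=> // i.
  by have [? ] := h i; rewrite [_ \in _]W0P => /asboolP.
Qed.
End Chevalley.

(** * The ring of functions regular outside infinity *)

Section Regular.
Variables (F : finFieldType) (K : fieldType) (iota : {rmorphism F -> K}).
Hypothesis hK : is_global_function_field iota.
Variable oo : place K.
Local Notation A := (regular_outside oo).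
Variable z : K.
Hypothesis zA : z \in A.
Hypothesis ztr : ~ algebraicOver iota z.

(* A valuation ring with 1/z in its maximal ideal. *)
Lemma exists_pole : exists w : place K, z \notin val_ring w.
Proof.
have z0 : z != 0.
  by apply: contra_notN ztr => /eqP ->; exists 'X; rewrite ?polyX_eq0 // map_polyX rootX.
pose B0 : {pred K} := [pred x | `[< adjoin (fun y => exists c, y = iota c) z^-1 x >]].
have B0P x : (x \in B0) = `[< adjoin (fun y => exists c, y = iota c) z^-1 x >] by [].
have cring : subring_set (fun y => exists c, y = iota c).
  split; first by exists 1; rewrite rmorph1.
    by move=> _ _ [c ->] [d ->]; exists (c - d); rewrite rmorphB.
  by move=> _ _ [c ->] [d ->]; exists (c * d); rewrite rmorphM.
have [R1 RB RM] := adjoin_subring z^-1 cring.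
have B0s : subring_closed B0.
  split=> [|x y|x y]; rewrite !B0P; first exact/asboolP.
    by move=> /asboolP Sx /asboolP Sy; apply/asboolP; exact: RB.
  by move=> /asboolP Sx /asboolP Sy; apply/asboolP; exact: RM.
pose B : subringClosed K := HB.pack B0 (GRing.isSubringClosed.Build K B0 B0s).
have BE x : (x \in B) = `[< adjoin (fun y => exists c, y = iota c) z^-1 x >] by [].
have zB : z^-1 \in B.
  rewrite BE; apply/asboolP; exists 'X; rewrite ?hornerX // => i.
  by rewrite coefX; exists (i == 1%N)%:R; rewrite rmorph_nat.
have [|[k [c [s [h e]]]]|W [BW Wval W1]] := @exists_valuation_ring _ B (fun y => y = z^-1).
- by move=> _ ->.
(* If [z^-1] generated the unit ideal of [F[z^-1]], some polynomial [X q - 1] would vanish at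
   [z^-1], and [z] would be algebraic. *)
- apply: ztr.
  have {}e : 1 = z^-1 * \sum_i s i.
    by rewrite e mulr_sumr; apply: eq_bigr => i _; rewrite (h i).1.
  have : \sum_i s i \in B by apply: rpred_sum => i _; exact: (h i).2.
  rewrite BE => /asboolP[p hp ep].
  have /choice[q hq] : forall i, exists c, p`_i = iota c := hp.
  suff : algebraicOver iota z^-1 by move/algebraic_inv; rewrite invrK.
  exists ('X * \poly_(i < size p) q i - 1).
    apply/eqP => /(congr1 (fun r : {poly F} => r`_0)).
    by rewrite coef0 coefB coefXM coef1 sub0r => /eqP; rewrite oppr_eq0 oner_eq0.
  rewrite rootE rmorphB rmorphM /= map_polyX rmorph1 hornerD hornerN hornerM hornerX hornerC.
  rewrite [X in _ * X](_ : _ = p.[z^-1]); first by rewrite -ep -e subrr.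
  congr (_.[_]); apply/polyP => i; rewrite coef_map coef_poly.
  case: ltnP => [_|h']; first by rewrite hq. by rewrite nth_default ?raddf0.
have zW : z \notin W.
  apply/negP => zW; apply: W1; exists 1%N, (fun _ => z^-1), (fun _ => z).
  by split=> [_|]; rewrite ?big_ord1 ?mulVf.
have WF c : iota c \in W.
  apply: BW; rewrite BE; apply/asboolP; exists (iota c)%:P; rewrite ?hornerC // => i.
  by rewrite coefC; case: eqP => _; [exists c | exists 0; rewrite rmorph0].
have [w hw] := place_of_valuation_ring hK Wval WF (ex_intro _ z zW).
by exists w; rewrite hw.
Qed.

(** The place of the valuation ring obtained may be [oo], where nothing is known of [a]. In that
    case [A] lies in the valuation ring of [oo] as well, so that the transcendental [z] would have
    no pole at all. The nonzero member of [a] ensures that the valuation ring is proper. *)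
Lemma regular_ideal1 (a : K -> Prop) : (forall y, a y -> y \in A) ->
  (exists2 y, a y & y != 0) ->
  (forall v : place K, v <> oo -> exists2 y, a y & y != 0 /\ v y <= 0) ->
  span_over a (fun y => y \in A) 1.
Proof.
move=> aA [y0 ay0 y00] hv; apply: contrapT => n1.
have [//|W [AW Wval W1]] := exists_valuation_ring (B := A) _ n1.
have inv_notin y : a y -> y != 0 -> y^-1 \notin W.
  move=> ay yn0; apply/negP => yW; apply: W1; exists 1%N, (fun _ => y), (fun _ => y^-1).
  by split=> [_|]; rewrite ?big_ord1 ?divff.
have WF c : iota c \in W by apply: AW; exact: const_regular.
have [w hw] := place_of_valuation_ring hK Wval WF (ex_intro _ y0^-1 (inv_notin _ ay0 y00)).
have [woo|woo] := pselect (w = oo); last first.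
  have [y ay [yn0 wy]] := hv w woo.
  by have := inv_notin y ay yn0; rewrite -hw inE placeV; lia.
have [w' hw'] := exists_pole; move/negP: hw'; apply.
have [->|w'oo] := pselect (w' = oo).
  by rewrite -woo hw AW.
by rewrite in_val_ring; apply: (regularP _ _ zA).
Qed.

(* At a place where x is integral, b and b x are visibly integral; at a pole
   of x one uses the complementary part of the relation, in powers of 1/x. *)
Lemma tail_regular M (a : nat -> K) x k : (forall i, a i \in A) ->
  \sum_(i < M) a i * x ^+ i = 0 ->
  let b := \sum_(i < M | (k <= i)%N) a i * x ^+ (i - k) in b \in A /\ b * x \in A.
Proof.
move=> aA hx b; have [x0|x0] := eqVneq x 0.
  rewrite x0 mulr0 rpred0 /b x0; split=> //.
  by apply: rpred_sum => i _; rewrite rpredM ?rpredX ?rpred0.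
have b2 : b = - \sum_(i < M | ~~ (k <= i)%N) a i * x^-1 ^+ (k - i).
  apply: (mulIf (expf_neq0 k x0)); apply/eqP; rewrite mulNr -addr_eq0; apply/eqP.
  rewrite -[RHS]hx [RHS](bigID (fun i : 'I_M => k <= i)%N) /= !mulr_suml.
  congr (_ + _); apply: eq_bigr => i ik; rewrite -mulrA; congr (_ * _).
    by rewrite -exprD subnK.
  have ik' : (i <= k)%N by lia.
  by rewrite -{2}(subnK ik') exprD exprVn mulKf ?expf_neq0.
have bx2 : b * x = - \sum_(i < M | ~~ (k <= i)%N) a i * x^-1 ^+ (k - i).-1.
  rewrite b2 mulNr mulr_suml; congr (- _); apply: eq_bigr => i ik; rewrite -mulrA.
  by rewrite -[in LHS](@prednK (k - i)) ?exprSr ?mulfVK //; lia.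
split; apply/regularP => w woo; have aw i : vge w 0 (a i) by apply: (regularP _ _ (aA i)).
  have [xw|xw] := boolP (vge w 0 x).
    by apply: vge_sum => i _; rewrite vge0M ?vgeX.
  have xV : vge w 0 x^-1 by move: xw; rewrite /vge invr_eq0 placeV (negbTE x0) /=; lia.
  by rewrite b2 vgeN; apply: vge_sum => i _; rewrite vge0M ?vgeX.
have [xw|xw] := boolP (vge w 0 x).
  by rewrite mulrC vge0M //; apply: vge_sum => i _; rewrite vge0M ?vgeX.
have xV : vge w 0 x^-1 by move: xw; rewrite /vge invr_eq0 placeV (negbTE x0) /=; lia.
by rewrite bx2 vgeN; apply: vge_sum => i _; rewrite vge0M ?vgeX.
Qed.

Let ev (p : {poly F}) := (map_poly iota p).[z].

Let evA p : ev p \in A.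
Proof.
rewrite /ev horner_coef rpred_sum // => i _.
by rewrite coef_map rpredM ?rpredX // const_regular.
Qed.

Let ev_neq0 p : p != 0 -> ev p != 0.
Proof. by move=> p0; apply/eqP => e; apply: ztr; exists p; rewrite // rootE; apply/eqP. Qed.

Lemma algebraic_relation x : exists M (c : nat -> {poly F}),
  (exists2 i, (i < M)%N & c i != 0) /\ \sum_(i < M) ev (c i) * x ^+ i = 0.
Proof.
have [M hM] := poly_relation hK z.
have [c [[i ci] cx]] := hM (fun i => x ^+ i).
exists M, (fun i => if insub i is Some j then c j else 0); split.
  by exists i => //; rewrite valK.
by rewrite -[RHS]cx; apply: eq_bigr => j _; rewrite valK.
Qed.

(** At the index of the last nonzero coefficient of an algebraic relation for [x], the tail of
    [tail_regular] is this coefficient alone. *)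
Lemma regular_denominator x : exists2 b, b \in A & b != 0 /\ b * x \in A.
Proof.
have [M [c [[i iM ci] hx]]] := algebraic_relation x.
have ex : exists i, (i < M)%N && (c i != 0) by exists i; rewrite iM.
have bd j : (j < M)%N && (c j != 0) -> (j <= M)%N by case/andP => /ltnW.
case: (ex_maxnP ex bd) => k /andP[kM ck] kmax.
have [bA bxA] := tail_regular k (fun i => evA (c i)) hx.
move: bA bxA; rewrite (bigD1 (Ordinal kM)) //= subnn expr0 mulr1.
rewrite big1 => [|j /andP[kj jk]].
  by rewrite addr0 => bA bxA; exists (ev (c k)); rewrite ?ev_neq0.
suff -> : c j = 0 by rewrite /ev rmorph0 horner0 mul0r.
apply/eqP; apply: contraT => cj; have := kmax j; rewrite ltn_ord cj => /(_ isT) jk'.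
by move: jk; rewrite -val_eqE /= eqn_leq kj jk'.
Qed.

(** If all the coefficients vanish at [v], they are divisible by the generator of the prime ideal of
    those [p] in [F[X]] for which [p(z)] vanishes at [v], and the division lowers their total size.
    The generator is not constant, since nonzero constants have value 0 at [v]. *)
Lemma primitive_relation (v : place K) x : v <> oo -> exists M (c : nat -> {poly F}),
  (exists2 i, (i < M)%N & v (ev (c i)) = 0 /\ c i != 0) /\
  \sum_(i < M) ev (c i) * x ^+ i = 0.
Proof.
move=> voo; have [M [c0 [hc0 hx0]]] := algebraic_relation x; exists M.
have evv p : vge v 0 (ev p) by apply: (regularP _ _ (evA p)).
have evvD p q : ev (p + q) = ev p + ev q by rewrite /ev rmorphD hornerD.
have evvM p q : ev (p * q) = ev p * ev q by rewrite /ev rmorphM hornerM.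
have [n] := ubnP (\sum_(i < M) size (c0 i)); elim: n c0 hc0 hx0 => // n IH c hc hx hn.
have [[i [iM ci vi]]|no] := pselect (exists i, [/\ (i < M)%N, c i != 0 & v (ev (c i)) = 0]).
  by exists c; split=> //; exists i.
have pos i : (i < M)%N -> vge v 1 (ev (c i)).
  move=> iM; have [->|ci] := eqVneq (c i) 0; first by rewrite /ev rmorph0 horner0 vge0.
  have := evv (c i); rewrite /vge (negbTE (ev_neq0 ci)) /= => h.
  have : v (ev (c i)) <> 0 by move=> e; apply: no; exists i.
  by lia.
have [i0 i0M ci0] := hc.
have ex : exists s, `[< exists p, [/\ p != 0, vge v 1 (ev p) & size p = s] >].
  by exists (size (c i0)); apply/asboolP; exists (c i0); split=> //; exact: pos.
case: (ex_minnP ex) => s /asboolP[p [p0 hp sp]] pmin.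
have dv i : (i < M)%N -> c i = (c i %/ p) * p.
  move=> iM; apply/eqP; rewrite -dvdp_eq; apply: contraT => nd.
  have r0 : c i %% p != 0 by [].
  have := pmin (size (c i %% p)); rewrite leqNgt -sp ltn_modp p0 => h.
  have /h // : `[< exists p', [/\ p' != 0, vge v 1 (ev p') & size p' = size (c i %% p)] >].
  apply/asboolP; exists (c i %% p); split=> //.
  have -> : c i %% p = c i + (- (c i %/ p)) * p.
    by rewrite {2}(divp_eq (c i) p) mulNr addrAC subrr add0r.
  by rewrite evvD evvM vgeD ?pos ?vge0M.
have sp1 : (1 < size p)%N.
  rewrite ltnNge; apply/negP => /size1_polyC e.
  move: hp p0; rewrite /ev e map_polyC hornerC polyC_eq0 => hp p0.
  by move: hp; rewrite /vge fmorph_eq0 (negbTE p0) place_const.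
apply: (IH (fun i => c i %/ p)).
- exists i0 => //; apply: contraNneq ci0 => e; by rewrite (dv _ i0M) e mul0r.
- apply: (mulIf (ev_neq0 p0)); rewrite mul0r -[RHS]hx mulr_suml.
  by apply: eq_bigr => i _; rewrite mulrAC -evvM -dv.
- rewrite ltnS in hn; apply: leq_trans hn.
  rewrite (bigD1 (Ordinal i0M)) //= [X in (_ < X)%N](bigD1 (Ordinal i0M)) //=.
  rewrite -addSn leq_add //; last by apply: leq_sum => i _; rewrite size_divp // leq_subr.
  have : (0 < size (c i0))%N by rewrite size_poly_gt0.
  by rewrite size_divp //; move: sp1; move: (size p) (size (c i0)) => m1 m2; lia.
Qed.

(* If b_k are the tails of a relation sum_i a_i x^i = 0 with v(a_k) = 0, then
   a_k = b_k - x b_(k+1), so b_k or b_(k+1) has valuation 0. *)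
Lemma local_denominator (v : place K) x : v <> oo -> vge v 0 x ->
  exists2 b, b \in A & [/\ b != 0, v b = 0 & b * x \in A].
Proof.
move=> voo vx; have [M [c [[k kM [vk ck]] hx]]] := primitive_relation x voo.
pose b j := \sum_(i < M | (j <= i)%N) ev (c i) * x ^+ (i - j).
have bA j : b j \in A by have [] := tail_regular j (fun i => evA (c i)) hx.
have bxA j : b j * x \in A by have [] := tail_regular j (fun i => evA (c i)) hx.
have bk : b k = ev (c k) + x * b k.+1.
  rewrite /b (bigD1 (Ordinal kM)) //= subnn expr0 mulr1; congr (_ + _).
  rewrite mulr_sumr; apply: eq_big => [i|i /andP[ki ik]].
    by rewrite -val_eqE /=; lia.
  rewrite mulrCA -exprS; congr (_ * _ ^+ _).
  by move: ik; rewrite -val_eqE /=; lia.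
have vA y : y \in A -> vge v 0 y by move/regularP; apply.
have [h1|h1] := boolP (vge v 1 (b k)); last first.
  exists (b k) => //; have := vA _ (bA k); move: h1; rewrite /vge.
  by case: eqVneq => //= b0 h1 h2; split=> //; lia.
have [h2|h2] := boolP (vge v 1 (b k.+1)); last first.
  exists (b k.+1) => //; have := vA _ (bA k.+1); move: h2; rewrite /vge.
  by case: eqVneq => //= b0 h2 h3; split=> //; lia.
have : vge v 1 (ev (c k)).
  have -> : ev (c k) = b k - x * b k.+1 by rewrite bk addrK.
  by rewrite vgeB // vge0M.
by rewrite /vge (negbTE (ev_neq0 ck)) vk.
Qed.
End Regular.

(** * Orders in a division algebra over a completion *)

Section MinimalGenerators.
Variables (K : fieldType) (V : lmodType K) (A : subringClosed K) (Q : {pred K}).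
Hypothesis QA : forall n (a : 'I_n -> K), (forall i, a i \in Q) ->
  (exists i, a i != 0) -> exists2 j, a j != 0 & forall i, a i / a j \in A.

(** In a nontrivial relation with coefficients in [Q], the generator whose coefficient divides all
    the others would be redundant in a shortest family. [Q] makes room for two uses: arbitrary
    coefficients over a valuation ring, and coefficients in [A] when [A] is a field of constants. *)
Lemma minimal_generators (P : V -> Prop) n (b : 'I_n -> V) : (forall i, P (b i)) ->
  exists k (e : 'I_k -> V), [/\ forall i, P (e i),
    forall i, exists2 a : 'I_k -> K, (forall j, a j \in A) & b i = \sum_j a j *: e j
    & forall a : 'I_k -> K, (forall i, a i \in Q) -> \sum_i a i *: e i = 0 ->
        forall i, a i = 0].
Proof.
move=> Pb.
pose gen k := `[< exists2 e : 'I_k -> V, forall i, P (e i)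
  & forall i, exists2 a : 'I_k -> K, (forall j, a j \in A) & b i = \sum_j a j *: e j >].
have ex : exists k, gen k.
  exists n; apply/asboolP; exists b => // i.
  exists (fun j => (j == i)%:R) => [j|]; first by case: eqP; rewrite ?rpred1 ?rpred0.
  rewrite (bigD1 i) //= eqxx scale1r big1 ?addr0 // => j /negbTE ->; exact: scale0r.
case: (ex_minnP ex) => k /asboolP[e Pe be] kmin; exists k, e; split=> // a aQ ae.
have [//|nz] := pselect (forall i, a i = 0).
have /(QA aQ)[j aj hj] : exists i, a i != 0.
  apply: contrapT => no; apply: nz => i; apply/eqP; apply: contrapT => h.
  by apply: no; exists i; apply/negP.
case: k e Pe be kmin a aQ ae nz j aj hj => [|k] e Pe be kmin a aQ ae nz j aj hj.
  by case: j {aj hj}.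
have ej : e j = \sum_i - (a (lift j i) / a j) *: e (lift j i).
  move: ae; rewrite (bigD1_ord j) //= => /eqP; rewrite addr_eq0 => /eqP ae.
  apply: (scalerI aj); rewrite ae scaler_sumr -sumrN; apply: eq_bigr => i _.
  by rewrite scalerA mulrN mulrCA divff // mulr1 scaleNr.
have /kmin : gen k; last by rewrite ltnn.
apply/asboolP; exists (fun i => e (lift j i)) => // i.
have [c cA ->] := be i.
exists (fun l => c (lift j l) - c j * (a (lift j l) / a j)).
  by move=> l; apply: rpredB; [exact: cA | apply: rpredM; [exact: cA | exact: hj]].
rewrite (bigD1_ord j) //= {1}ej scaler_sumr -big_split /=; apply: eq_bigr => l _.
by rewrite scalerA -scalerDl mulrN addrC.
Qed.
End MinimalGenerators.

Lemma val_ring_divides (K : fieldType) (v : place K) n (a : 'I_n -> K) :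
  (forall i, a i \in [pred x : K | true]) ->
  (exists i, a i != 0) -> exists2 j, a j != 0 & forall i, a i / a j \in val_ring v.
Proof.
move=> _ [i ai]; case: (Order.TotalTheory.arg_minP (P := fun i => a i != 0) (fun i => v (a i)) ai) => j aj jmin.
exists j => // l; rewrite in_val_ring /vge mulf_eq0.
have [//|al] := eqVneq (a l) 0.
by rewrite val_ofM ?invr_eq0 // placeV subr_ge0 jmin // orbT.
Qed.

(** Freeness of finitely generated torsion-free modules over a valuation ring, in a form that
    records where the basis lies: applied to generators of a lattice over [A], it gives a basis
    inside that lattice which is good at one place. *)
Lemma lattice_basis (L : fieldType) (w : place L) (V : vectType L) (P : V -> Prop)
    n (b : 'I_n -> V) : (forall i, P (b i)) ->
  (forall x, exists a : 'I_n -> L, x = \sum_i a i *: b i) ->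
  exists k (e : k.-tuple V), [/\ basis_of fullv e, forall i : 'I_k, P e`_i
    & forall j i, vge w 0 (coord e i (b j))].
Proof.
move=> Pb spanb.
have [k [e [Pe be indep]]] := minimal_generators (@val_ring_divides L w) Pb.
pose e' := [tuple e i | i < k].
have e'E (i : 'I_k) : e'`_i = e i by rewrite -tnth_nth tnth_mktuple.
have fr : free e'.
  apply/freeP => a; under eq_bigr do rewrite e'E.
  by move=> h i; apply: indep.
exists k, e'; split.
- rewrite /basis_of fr andbT eqEsubv subvf /=; apply/subvP => x _.
  have [a ->] := spanb x; apply: rpred_sum => i _; apply: rpredZ.
  have [c _ ->] := be i; apply: rpred_sum => j _; apply: rpredZ.
  by rewrite -e'E memv_span // mem_nth // size_tuple.
- by move=> i; rewrite e'E.
- move=> j i; have [c cA ->] := be j.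
  under eq_bigr do rewrite -e'E.
  by rewrite coord_sum_free // -in_val_ring.
Qed.

(** * Finiteness of residue fields *)

Section Residue.
Variables (F : finFieldType) (K : fieldType) (iota : {rmorphism F -> K}).
Hypothesis hK : is_global_function_field iota.
Variable v : place K.

(** Modulo the maximal ideal, [poly_relation0] for a uniformizer [t] reduces to the constant terms.
    So families independent over [F] in the residue field have bounded length, and a longest one
    generates. *)
Lemma residue_generators : exists k (u : 'I_k -> K), (forall i, vge v 0 (u i)) /\
  forall x, vge v 0 x -> exists al : 'I_k -> F, vge v 1 (x - \sum_i iota (al i) * u i).
Proof.
have [t t0 vt] := val_of_normalized v.
have [M hM] := poly_relation0 hK t0.
pose ind k := `[< exists2 u : 'I_k -> K, forall i, vge v 0 (u i) &
  forall al : 'I_k -> F, vge v 1 (\sum_i iota (al i) * u i) -> forall i, al i = 0 >].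
have ex : exists k, ~~ ind k.
  exists M; apply/asboolPn => -[u u0 indu].
  have [c [[i ci] cu]] := hM u; move/eqP: ci; apply.
  apply: (indu (fun i => (c i)`_0)).
  have /choice[r hr] : forall i, exists r : {poly F},
      (map_poly iota (c i)).[t] = iota (c i)`_0 + t * (map_poly iota r).[t].
    by move=> j; have [r ?] := horner_coef0_tail iota t (c j); exists r.
  have -> : \sum_i iota (c i)`_0 * u i = - \sum_i t * ((map_poly iota (r i)).[t] * u i).
    apply/eqP; rewrite -addr_eq0 -big_split /= -[X in _ == X]cu; apply/eqP.
    by apply: eq_bigr => j _; rewrite hr mulrDl mulrA.
  have vt0 : vge v 1 t by rewrite /vge vt lexx orbT.
  rewrite vgeN; apply: vge_sum => j _; rewrite -[1]addr0 vgeM //.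
  by rewrite vge0M // vge_poly // (vge_weak _ vt0).
case: (ex_minnP ex) => -[|k] nk kmin.
  by case/asboolP: nk; exists (fun _ => 0) => [|al _] [].
have [u u0 indu] : exists2 u : 'I_k -> K, forall i, vge v 0 (u i) &
    forall al : 'I_k -> F, vge v 1 (\sum_i iota (al i) * u i) -> forall i, al i = 0.
  by apply/asboolP; apply: contraT => /kmin; rewrite ltnn.
exists k, u; split=> // x x0; apply: contrapT => nx; case/asboolP: nk.
exists (fun i => if unlift ord0 i is Some j then u j else x).
  by move=> i; case: unlift.
move=> al; rewrite big_ord_recl unlift_none.
under eq_bigr do rewrite liftK.
move=> h; have a0 : al ord0 = 0.
  apply: contrapT => /eqP a0; apply: nx.
  exists (fun i => - (al (lift ord0 i) / al ord0)).
  have -> : x - \sum_i iota (- (al (lift ord0 i) / al ord0)) * u i =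
      iota (al ord0)^-1 * (iota (al ord0) * x + \sum_i iota (al (lift ord0 i)) * u i).
    rewrite mulrDr mulrA -rmorphM mulVf // rmorph1 mul1r; congr (_ + _).
    rewrite mulr_sumr -sumrN; apply: eq_bigr => i _.
    by rewrite rmorphN mulNr opprK mulrA -rmorphM [al _ / _]mulrC.
  by rewrite vge0M // vge_const.
have {}h : vge v 1 (\sum_i iota (al (lift ord0 i)) * u i).
  by move: h; rewrite a0 rmorph0 mul0r add0r.
by move=> i; case: (unliftP ord0 i) => [j|] -> //; exact: indu h j.
Qed.

(** The residue field is recorded only as a finite set of labels, which is all that pigeonhole asks
    for. The label of an integral element is made of the coordinates over [F] of the residue of a
    nearby element of [K]. *)
Lemma completion_residue (Kv : completion v) : exists (Q : finType) (res : Kv -> Q),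
  forall x y, vge (cplace Kv) 0 x -> vge (cplace Kv) 0 y -> res x = res y ->
    vge (cplace Kv) 1 (x - y).
Proof.
have [k [u [u0 hu]]] := residue_generators.
have vgeE N x : vge (cplace Kv) N (cincl Kv x) = vge v N x.
  by rewrite /vge fmorph_eq0 cplace_incl.
have /choice[res hres] : forall x : Kv, exists al : {ffun 'I_k -> F},
    vge (cplace Kv) 0 x -> vge (cplace Kv) 1 (x - cincl Kv (\sum_i iota (al i) * u i)).
  move=> x; have [x0|] := boolP (vge (cplace Kv) 0 x); last by exists [ffun=> 0].
  have [y /vge_closeE yx] := @cplace_dense _ _ Kv x 1.
  have y0 : vge v 0 y.
    rewrite -vgeE -[cincl Kv y](subrK x) vgeD //; exact: vge_weak yx.
  have [al hal] := hu y y0; exists [ffun i => al i] => _.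
  apply: (vge_trans (y := cincl Kv y)); first by rewrite vge_distC.
  rewrite -rmorphB vgeE; by under eq_bigr do rewrite ffunE.
exists {ffun 'I_k -> F}, res => x y x0 y0 e.
apply: vge_trans (hres x x0) _; rewrite e vge_distC; exact: hres.
Qed.
End Residue.

(** * The nonunits of an order over a complete valuation ring *)

Section LocalDivision.
Variables (L : fieldType) (w : place L) (Delta : falgType L).
Hypothesis Ddiv : is_division Delta.
Variables (O : subringClosed Delta) (pi : L).
Hypothesis Oord : is_order (val_ring w) O.
Hypothesis wpi : w pi = 1.
Hypothesis complete : forall u : nat -> L, v_cauchy w u -> exists l, v_converges w u l.
Variables (Q : finType) (res : L -> Q).
Hypothesis resP : forall x y, vge w 0 x -> vge w 0 y -> res x = res y -> vge w 1 (x - y).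
Let pi0 : pi != 0.
Proof. by apply/eqP => e; move: wpi; rewrite e val_of0. Qed.

Lemma order_basis : exists k (e : k.-tuple Delta), basis_of fullv e /\
  forall x, (x \in O) = [forall i, vge w 0 (coord e i x)].
Proof.
have [n [b [Ob spanb]]] := Oord.
have bO i : b i \in O.
  apply/Ob; exists (fun j => (j == i)%:R) => [j|]; first by case: eqP; rewrite ?rpred1 ?rpred0.
  by rewrite (bigD1 i) //= eqxx scale1r big1 ?addr0 // => j /negbTE ->; exact: scale0r.
have [k [e [be eO cb]]] := @lattice_basis _ w _ (fun x => x \in O) _ _ bO spanb.
exists k, e; split=> // x; apply/idP/forallP => [/Ob[a aA ->] i|h].
  rewrite linear_sum; apply: vge_sum => j _.
  by rewrite linearZ /=; apply: vge0M; [rewrite -in_val_ring; exact: aA | exact: cb].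
rewrite (coord_basis be (memvf x)); apply: rpred_sum => i _.
have /Ob[a aA ->] := eO i; apply/Ob; exists (fun j => coord e i x * a j).
  by move=> j; rewrite rpredM // in_val_ring.
by rewrite scaler_sumr; apply: eq_bigr => j _; rewrite scalerA.
Qed.

Definition og (n : nat) (x : Delta) := pi ^- n *: x \in O.

Lemma ogP n x : reflect (exists2 y, y \in O & x = pi ^+ n *: y) (og n x).
Proof.
apply: (iffP idP) => [h|[y yO ->]].
  by exists (pi ^- n *: x); rewrite // scalerA divff ?scale1r // expf_neq0.
by rewrite /og scalerA mulVf ?scale1r // expf_neq0.
Qed.

Lemma og0 x : og 0 x = (x \in O).
Proof. by rewrite /og expr0 invr1 scale1r. Qed.

Lemma og_0 n : og n 0. Proof. by rewrite /og scaler0 rpred0. Qed.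

Lemma ogD n x y : og n x -> og n y -> og n (x + y).
Proof. by rewrite /og scalerDr; exact: rpredD. Qed.

Lemma ogN n x : og n (- x) = og n x.
Proof. by rewrite /og scalerN rpredN. Qed.

Lemma ogB n x y : og n x -> og n y -> og n (x - y).
Proof. by rewrite -(ogN _ y); exact: ogD. Qed.

Lemma ogM a b x y : og a x -> og b y -> og (a + b) (x * y).
Proof.
rewrite /og exprD invfM -scalerA scalerAr scalerAl; exact: rpredM.
Qed.

Lemma ogMl n x y : x \in O -> og n y -> og n (x * y).
Proof. by rewrite -og0; exact: ogM. Qed.

Lemma ogMr n x y : og n x -> y \in O -> og n (x * y).
Proof. by rewrite -og0 -{2}(addn0 n); exact: ogM. Qed.

Lemma ogX n m x : og n x -> og (n * m) (x ^+ m).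
Proof.
move=> h; elim: m => [|m IH]; first by rewrite muln0 og0 expr0 rpred1.
by rewrite mulnS exprS; exact: ogM.
Qed.

Lemma order_scalar a : vge w 0 a -> a%:A \in O.
Proof.
move=> wa; have [n [b [Ob _]]] := Oord.
have /Ob[c cA ->] : 1 \in O by exact: rpred1.
apply/Ob; exists (fun i => a * c i); first by move=> i; rewrite rpredM // in_val_ring.
by rewrite scaler_sumr; apply: eq_bigr => i _; rewrite scalerA.
Qed.

Lemma order_scale a x : vge w 0 a -> x \in O -> a *: x \in O.
Proof. by move=> wa xO; rewrite -[x]mul1r scalerAl rpredM ?order_scalar. Qed.

Lemma pi_vge n : vge w 0 (pi ^+ n).
Proof. by apply: vgeX; rewrite /vge wpi orbT. Qed.

Lemma og_weak n m x : (m <= n)%N -> og n x -> og m x.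
Proof.
move=> mn h; rewrite /og; have -> : pi ^- m = pi ^+ (n - m) * pi ^- n.
  rewrite -[X in _ = _ / X](_ : pi ^+ (n - m) * pi ^+ m = _); last by rewrite -exprD subnK.
  by rewrite invfM mulVKf ?expf_neq0.
by rewrite -scalerA order_scale ?pi_vge.
Qed.

Section Basis.
Variables (k : nat) (e : k.-tuple Delta).
Hypothesis Oe : forall x, (x \in O) = [forall i, vge w 0 (coord e i x)].

Lemma ogE n x : og n x <-> forall i, vge w n%:Z (coord e i x).
Proof.
rewrite /og Oe; split=> [/forallP h i|h].
  by have := h i; rewrite linearZ vge_divX // add0r.
by apply/forallP => i; rewrite linearZ vge_divX // add0r; exact: h.
Qed.
End Basis.

Lemma og_inf x : (forall n, og n x) -> x = 0.
Proof.
have [k [e [be Oe]]] := order_basis => h.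
rewrite (coord_basis be (memvf x)) big1 // => i _.
rewrite (vge_all_eq0 (v := w) (x := coord e i x)) ?scale0r // => n.
by have /(ogE Oe) := h n.
Qed.

Lemma order_bounded x : exists n, pi ^+ n *: x \in O.
Proof.
have [k [e [be Oe]]] := order_basis.
exists (\max_(i < k) `|w (coord e i x)|)%N; rewrite Oe; apply/forallP => i.
rewrite linearZ /= /vge mulf_eq0; have [->|c0] := eqVneq (coord e i x) 0; first by rewrite orbT.
rewrite val_ofM ?expf_neq0 // placeX wpi mul1r.
have := leq_bigmax (F := fun i : 'I_k => `|w (coord e i x)|%N) i.
move: (\max_(i < k) _)%N => m /=; move: (w (coord e i x)) => z h.
by apply/orP; right; lia.
Qed.

Let D0 x y : x * y = 0 -> x = 0 \/ y = 0 :> Delta.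
Proof.
move=> h; have [->|x0] := eqVneq x 0; first by left.
by right; rewrite -[y](mulKr (Ddiv x0)) h mulr0.
Qed.

Lemma og1_neq1 : ~~ og 1 1.
Proof.
apply/negP => h; have : (1 : Delta) = 0; last by apply/eqP; exact: oner_neq0.
by apply: og_inf => n; have := ogX n h; rewrite mul1n expr1n.
Qed.

(** The inverse exists in [Delta] and some [pi ^ n] makes it integral; the geometric series cut at
    order [n] then leaves the remainder [(1 - x)^-1 x ^ n], which is in [O]. No limit is taken. *)
Lemma one_sub_unit x : og 1 x -> 1 - x != 0 /\ (1 - x)^-1 \in O.
Proof.
move=> hx; have xO : x \in O by rewrite -og0; exact: og_weak hx.
have n0 : 1 - x != 0.
  by rewrite subr_eq0; apply: contraNneq og1_neq1 => ->.
split=> //; have [n hn] := order_bounded (1 - x)^-1.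
have -> : (1 - x)^-1 = \sum_(i < n) x ^+ i + (1 - x)^-1 * x ^+ n.
  apply: (mulrI (Ddiv n0)); rewrite divrr ?Ddiv // mulrDr mulVKr ?Ddiv //.
  by rewrite -[1 - x]opprB mulNr -subrX1 opprB subrK.
rewrite rpredD ?rpred_sum // => [i _|]; first exact: rpredX.
have := ogX n hx; rewrite mul1n => /ogP[y yO ->].
by rewrite -scalerAr scalerAl rpredM.
Qed.

(** The powers of [x] take finitely many values modulo [pi], hence are eventually periodic. *)
Lemma order_idem_power x : x \in O -> exists2 m, (0 < m)%N & og 1 (x ^+ m ^+ 2 - x ^+ m).
Proof.
move=> xO; have [k [e [be Oe]]] := order_basis.
pose c n : {ffun 'I_k -> Q} := [ffun i => res (coord e i (x ^+ n))].
have [i [j [ij cij]]] : exists i j : nat, (i < j)%N /\ c i = c j.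
  pose f (i : 'I_(#|{ffun 'I_k -> Q}|.+1)) := c i.
  have /injectivePn[i [j ij e']] : ~~ injectiveb f.
    apply/negP => /injectiveP /leq_card; by rewrite card_ord ltnn.
  move: ij; rewrite -val_eqE neq_ltn => /orP[h|h]; first by exists i, j.
  by exists j, i.
have cong : og 1 (x ^+ j - x ^+ i).
  apply/(ogE Oe) => l; rewrite linearB /=.
  have h n : vge w 0 (coord e l (x ^+ n)).
    by have := rpredX n xO; rewrite Oe => /forallP.
  by apply: resP => //; move/ffunP: cij => /(_ l); rewrite !ffunE.
pose d := (j - i)%N.
have step m n : (i <= m)%N -> og 1 (x ^+ (m + n * d) - x ^+ m).
  move=> im; elim: n => [|n IH]; first by rewrite addn0 subrr og_0.
  have -> : x ^+ (m + n.+1 * d) - x ^+ m =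
      x ^+ (m - i + n * d) * (x ^+ j - x ^+ i) + (x ^+ (m + n * d) - x ^+ m).
    rewrite mulrBr -!exprD addrA; congr (_ - _).
    rewrite -[in LHS](addr0 (x ^+ _)).
    rewrite -[in RHS]addrA (_ : (m - i + n * d + i = m + n * d)%N) ?addNr; last by lia.
    by congr (x ^+ _ + _); rewrite mulSn /d; lia.
  by apply: ogD => //; apply: ogMl => //; exact: rpredX.
(* A multiple of the period [d], so that doubling the exponent changes nothing modulo [pi], and at
   least [i], where the periodicity starts. *)
exists (i.+1 * d)%N; first by rewrite muln_gt0 /= /d subn_gt0.
rewrite -exprM muln2 -addnn; apply: step.
by rewrite (leq_trans (leqnSn i)) // leq_pmulr // /d subn_gt0.
Qed.

Variable p : nat.
Hypothesis charp : p \in [pchar L].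

Let charD : p \in [pchar Delta].
Proof. by rewrite pchar_lalg. Qed.

Lemma exprB_pchar (x y : Delta) k : x * y = y * x ->
  (x - y) ^+ (p ^ k) = x ^+ (p ^ k) - y ^+ (p ^ k).
Proof.
move=> xy; elim: k => [|k IH]; first by rewrite expn0 !expr1.
rewrite expnSr !exprM IH; apply: (pFrobenius_autB_comm charD).
by apply: commrX; apply: commr_sym; apply: commrX; apply: commr_sym.
Qed.

(* Lifting of idempotents: in characteristic p the powers e0^(p^k) of an
   element which is idempotent modulo pi converge to an idempotent. *)
Lemma idem_dichotomy e0 : e0 \in O -> og 1 (e0 ^+ 2 - e0) -> og 1 e0 \/ og 1 (1 - e0).
Proof.
move=> e0O he; have [k [e [be Oe]]] := order_basis.
have p1 : (1 < p)%N by have := pcharf_prime charp; exact: prime_gt1.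
pose u n := e0 ^+ (p ^ n).
have uO n : u n \in O by exact: rpredX.
have ltpn n : (n <= p ^ n)%N by exact: ltnW (ltn_expl n p1).
have cong m : og 1 (e0 ^+ m.+1 - e0).
  elim: m => [|m IH]; first by rewrite expr1 subrr og_0.
  have -> : e0 ^+ m.+2 - e0 = e0 * (e0 ^+ m.+1 - e0) + (e0 ^+ 2 - e0).
    by rewrite mulrBr -exprS -expr2 addrA subrK.
  by apply: ogD => //; exact: ogMl.
(* By Frobenius, applied to commuting powers of [e0], this difference is the [p ^ n]-th power of
   [e0 ^+ 2 - e0]. Likewise [u n.+1 - u n] is that of [e0 ^+ p - e0]. *)
have uidem n : og n (u n ^+ 2 - u n).
  rewrite /u -exprM mulnC exprM -exprB_pchar; last first.
    by rewrite -exprSr -exprS.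
  by apply: (og_weak (ltpn n)); rewrite -[X in og X](mul1n (p ^ n)%N) ogX.
have ustep n : og n (u n.+1 - u n).
  rewrite /u expnS exprM -exprB_pchar; last by rewrite -exprSr -exprS.
  apply: (og_weak (ltpn n)); rewrite -[X in og X](mul1n (p ^ n)%N) ogX //.
  by rewrite -(prednK (ltnW p1)).
have udist n m : og n (u (n + m)%N - u n).
  elim: m => [|m IH]; first by rewrite addn0 subrr og_0.
  rewrite -[u _](subrK (u (n + m)%N)) -addrA ogD // addnS.
  by apply: og_weak (ustep _); rewrite leq_addr.
have /choice[l hl] : forall i : 'I_k, exists li, v_converges w (fun n => coord e i (u n)) li.
  move=> i; apply: complete => N; exists `|N|%N => a b aN bN.
  have h c : (`|N| <= c)%N -> vge w N (coord e i (u c) - coord e i (u `|N|%N)).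
    move=> hc; rewrite -linearB; apply: (@vge_weak _ _ `|N|%N); first by lia.
    by move: i; apply/(ogE Oe); rewrite -(subnKC hc).
  apply/vge_closeE; apply: (vge_trans (h a aN)); rewrite vge_distC; exact: h.
pose ep := \sum_i l i *: e`_i.
have epu N : exists2 n, (N <= n)%N & og N (ep - u n).
  have /choice[m hm] : forall i, exists m, forall n, (m <= n)%N -> vge w N (coord e i (u n) - l i).
    by move=> i; have [m hm] := hl i N; exists m => n mn; apply/vge_closeE; exact: hm.
  exists (maxn N (\max_i m i))%N; first by rewrite leq_maxl.
  apply/(ogE Oe) => i; rewrite linearB /= coord_sum_free; last by case/andP: be.
  rewrite vge_distC; apply: hm; rewrite leq_max; apply/orP; right.
  exact: (leq_bigmax (F := m)).
have epidem : ep * ep - ep = 0.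
  apply: og_inf => N; have [n Nn hN] := epu N.
  have [d -> hd] : exists2 d, ep = u n + d & og N d.
    by exists (ep - u n); rewrite // addrC subrK.
  have -> : (u n + d) * (u n + d) - (u n + d) =
     (u n ^+ 2 - u n) + (u n * d + (d * u n + d * d) - d).
    by rewrite mulrDl !mulrDr opprD -(addrA (u n * u n)) addrACA -expr2.
  apply: ogD; first exact: og_weak (uidem n).
  apply: ogB => //; apply: ogD; first exact: ogMl.
  apply: ogD; first exact: ogMr.
  by apply: og_weak (ogM hd hd); rewrite leq_addr.
have ep0 : og 1 (ep - e0).
  have [n _ hn] := epu 1%N; rewrite -[ep](subrK (u n)) -addrA ogD //.
  by rewrite /u -(prednK (_ : 0 < p ^ n)%N) // expn_gt0 (ltnW p1).
have : ep * (ep - 1) = 0 by rewrite mulrBr mulr1.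
case/D0 => [e'|/eqP]; first by left; rewrite -ogN; rewrite e' sub0r in ep0.
by rewrite subr_eq0 => /eqP e'; right; rewrite e' in ep0.
Qed.

(** Some power of [x] is idempotent modulo [pi], hence congruent to 0 or to 1; in the second case it
    is a unit of [O], and so is [x]. *)
Lemma order_unit_or_nilpotent x : x \in O ->
  (exists2 m, (0 < m)%N & og 1 (x ^+ m)) \/ (x != 0 /\ x^-1 \in O).
Proof.
move=> xO; have [m m0 hm] := order_idem_power xO.
have [h|h] := idem_dichotomy (rpredX m xO) hm; first by left; exists m.
right; have := one_sub_unit h; rewrite subKr => -[xm0 xmV].
have x0 : x != 0 by apply: contraNneq xm0 => ->; rewrite expr0n eqn0Ngt m0.
split=> //; have -> : x^-1 = x ^+ m.-1 * (x ^+ m)^-1.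
  apply: (mulrI (Ddiv x0)); rewrite mulrA -exprS prednK //.
  by rewrite !divrr // Ddiv.
by rewrite rpredM ?rpredX.
Qed.

Variable P : {pred Delta}.
Hypothesis Pmax : maximal_ideal O P.

Let nu x := (x \in O) && ((x == 0) || (x^-1 \notin O)).

Lemma nonunit_of_dvd x y : x \in O -> y \in O -> nu x -> nu (x * y) /\ nu (y * x).
Proof.
move=> xO yO /andP[_ h]; rewrite /nu !rpredM //=.
case: eqVneq h => [->|x0] /= h; first by rewrite mul0r mulr0 eqxx.
have [->|y0] := eqVneq y 0; first by rewrite mul0r mulr0 eqxx.
split; apply/orP; right; apply: contra h => h.
  have -> : x^-1 = y * (x * y)^-1 by rewrite invrM ?Ddiv // mulVKr ?Ddiv //.
  exact: rpredM.
have -> : x^-1 = (y * x)^-1 * y by rewrite invrM ?Ddiv // divrK ?Ddiv //.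
exact: rpredM.
Qed.

(** If [x + y] were a unit, [x / (x + y)] and [y / (x + y)] would be nonunits with sum 1. The first
    is nilpotent modulo [pi], so that 1 minus it is invertible in [O] by a finite geometric sum; but
    this is the second. *)
Lemma nonunitD x y : nu x -> nu y -> nu (x + y).
Proof.
move=> hx hy; have /andP[xO _] := hx; have /andP[yO _] := hy.
rewrite /nu rpredD //=; apply: contraT; rewrite negb_or negbK => /andP[s0 sV].
have [n hn] : exists n, og 1 ((x * (x + y)^-1) ^+ n.+1).
  have [/andP[zO hz] _] := nonunit_of_dvd xO sV hx.
  have [[m m0 hm]|[z0 zV]] := order_unit_or_nilpotent zO.
    by exists m.-1; rewrite prednK.
  by move: hz; rewrite (negbTE z0) zV.
have [/andP[zO hz] _] := nonunit_of_dvd yO sV hy.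
have e : y * (x + y)^-1 = 1 - x * (x + y)^-1.
  by rewrite -(divrr (Ddiv s0)) -mulrBl addrAC subrr add0r.
have [n0 hV] := one_sub_unit hn; move: n0 hV.
set z := x * (x + y)^-1 in hn e *; move=> n0 hV.
have zO' : z \in O by rewrite rpredM.
have fac : 1 - z ^+ n.+1 = (1 - z) * \sum_(i < n.+1) z ^+ i.
  by rewrite -[1 - z]opprB mulNr -subrX1 opprB.
have z0 : 1 - z != 0 by apply: contraNneq n0 => h; rewrite fac h mul0r.
suff : (1 - z)^-1 \in O by move: hz; rewrite e (negbTE z0) /= => /negP.
have -> : (1 - z)^-1 = \sum_(i < n.+1) z ^+ i * (1 - z ^+ n.+1)^-1.
  rewrite -mulr_suml; apply: (mulrI (Ddiv z0)); rewrite mulrA -fac !divrr // Ddiv //.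
by apply: rpred_sum => i _; rewrite rpredM ?rpredX.
Qed.

(** By [nonunitD] the nonunits form a proper two-sided ideal. It contains every proper one, hence is
    the maximal one. *)
Lemma nonunit_mem x : (x \in P) = nu x.
Proof.
have [[[PO [P0 PB] PMl] PMr] OP Pm] := Pmax.
have Pnu y : y \in P -> nu y.
  move=> yP; rewrite /nu PO //=; case: eqVneq => //= y0; apply/negP => yV.
  apply: OP => z zO; rewrite -[z]mulr1 -(mulVr (Ddiv y0)) mulrA.
  by apply: PMl => //; rewrite rpredM.
apply/idP/idP; first exact: Pnu.
apply: (Pm [pred y | nu y]) => [||].
- split; last first.
    by move=> y a; rewrite !inE => hy aO; have /andP[yO _] := hy; case: (nonunit_of_dvd yO aO hy).
  split=> [y /andP[]//||a y aO]; last first.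
    by rewrite !inE => hy; have /andP[yO _] := hy; case: (nonunit_of_dvd yO aO hy).
  split=> [|y z]; rewrite !inE; first by rewrite /nu rpred0 eqxx.
  move=> hy hz; apply: nonunitD => //.
  by move: hz; rewrite /nu rpredN oppr_eq0 invrN rpredN.
- by move=> y yP; rewrite inE; exact: Pnu.
- by move=> /(_ 1 (rpred1 _)); rewrite inE /nu rpred1 oner_eq0 invr1 rpred1.
Qed.

Lemma residue_division x : x \in O -> x \notin P -> x != 0 /\ x^-1 \in O.
Proof.
move=> xO; rewrite nonunit_mem /nu xO /= negb_or negbK => /andP[]; by [].
Qed.

Lemma maximal_ideal_unif x : og 1 x -> x \in P.
Proof.
move=> hx; have xO : x \in O by rewrite -og0; exact: og_weak hx.
rewrite nonunit_mem /nu xO /=; case: eqVneq => //= x0; apply/negP => xV.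
by have := ogMr hx xV; rewrite divrr ?Ddiv // (negbTE og1_neq1).
Qed.

End LocalDivision.

(** * Block orders and their row modules *)

Section ReshapeIndex.
Local Open Scope nat_scope.

Lemma scanl_subnE i (sh : seq nat) n : n <= i ->
  find (pred1 0) (scanl subn (i.+1 - n) sh) = find (pred1 0) (scanl subn (i - n).+1 sh).
Proof. by move=> ni; rewrite subSn. Qed.

Lemma reshape_index_cons n sh i :
  reshape_index (n :: sh) i = if i < n then 0 else (reshape_index sh (i - n)).+1.
Proof.
rewrite /reshape_index /= subn_eq0; case: ltnP => //= ni.
by rewrite scanl_subnE.
Qed.

Lemma reshape_index_mono sh i j : i <= j -> reshape_index sh i <= reshape_index sh j.
Proof.
elim: sh i j => [|n sh IH] i j ij //; rewrite !reshape_index_cons.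
case: (ltnP j n) => jn; first by rewrite (leq_ltn_trans ij jn).
by case: ltnP => // ni; rewrite ltnS IH // leq_sub2r.
Qed.

(** Dropping empty blocks renumbers the others in the same order, and a block order depends only on
    comparisons of block numbers. So [g] can keep its zero entries until the final passage to the
    filtered sequence. *)
Lemma reshape_index_filter sh i j :
  (reshape_index sh i <= reshape_index sh j) =
  (reshape_index [seq k <- sh | 0 < k] i <= reshape_index [seq k <- sh | 0 < k] j).
Proof.
elim: sh i j => [|n sh IH] i j //.
case: n => [|n] /=; rewrite !reshape_index_cons ?ltn0 ?ltnS ?subn0 ?IH //.
by case: (i <= n); case: (j <= n); rewrite // ltnS IH.
Qed.

Lemma sumn_filter_pos sh : sumn [seq k <- sh | 0 < k] = sumn sh.
Proof. by elim: sh => [|[|n] sh IH] //=; rewrite IH. Qed.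

Lemma reshape_index_surj sh m c : all (fun k => 0 < k) sh -> sumn sh = m -> c < size sh ->
  exists p : 'I_m, reshape_index sh p = c.
Proof.
move=> /allP pos <- cs; have h : 0 < nth 0 sh c by apply: pos; exact: mem_nth.
by exists (Ordinal (flatten_indexP h)); exact: flatten_indexKl.
Qed.
End ReshapeIndex.

(** * The Jacobson radical of a block order *)

Section BlockMatrices.
Variables (Delta : unitRingType) (O : subringClosed Delta) (P : {pred Delta}).
Hypothesis Ddiv : is_division Delta.
Hypothesis Pid : two_sided_ideal O P.
Hypothesis P1 : 1 \notin P.
Hypothesis Punit : forall x, x \in O -> x \notin P -> x != 0 /\ x^-1 \in O.
Variable m : nat.
Implicit Types (X Y Z : 'M[Delta]_m) (b : 'I_m -> nat).

Let PO x : x \in P -> x \in O. Proof. by case: Pid => -[h _ _] _; exact: h. Qed.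
Let P0 : 0 \in P. Proof. by case: Pid => -[_ [h _] _] _. Qed.
Let PB x y : x \in P -> y \in P -> x - y \in P. Proof. by case: Pid => -[_ [_ h] _] _; exact: h. Qed.
Let PN x : x \in P -> - x \in P. Proof. by move=> xP; rewrite -sub0r; exact: PB. Qed.
Let PD x y : x \in P -> y \in P -> x + y \in P.
Proof. by move=> xP yP; rewrite -[y]opprK; apply: PB => //; exact: PN. Qed.
Let PMl a x : a \in O -> x \in P -> a * x \in P. Proof. by case: Pid => -[_ _ h] _; exact: h. Qed.
Let PMr x a : x \in P -> a \in O -> x * a \in P. Proof. by case: Pid => _ h; exact: h. Qed.
Let Psum (I : Type) (r : seq I) (Q : pred I) (F : I -> Delta) :
  (forall i, Q i -> F i \in P) -> \sum_(i <- r | Q i) F i \in P.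
Proof. by move=> h; elim/big_ind: _. Qed.

(** With [b = val] all blocks have size one. This smallest order is contained in those of all
    monotone numberings, so that elimination can be carried out in it. *)
Definition block_of b : {pred 'M[Delta]_m} :=
  [pred X : 'M[Delta]_m | [forall i, forall j, if (b i <= b j)%N then X i j \in O else X i j \in P]].

Lemma block_ofP b X : reflect (forall i j, if (b i <= b j)%N then X i j \in O else X i j \in P)
  (X \in block_of b).
Proof. by apply: (iffP forallP) => h i; [apply/forallP | apply/forallP; exact: h]. Qed.

Lemma block_of_entry b X i j : X \in block_of b -> X i j \in O.
Proof. by move/block_ofP => /(_ i j); case: ifP => // _; exact: PO. Qed.

Lemma block_of_mul b X Y : X \in block_of b -> Y \in block_of b -> X *m Y \in block_of b.
Proof.
move=> hX hY; apply/block_ofP => i j; rewrite mxE; case: ifP => bij.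
  by apply: rpred_sum => k _; rewrite rpredM // (block_of_entry _ _ hX, block_of_entry _ _ hY).
apply: Psum => k _; have [bik|bik] := leqP (b i) (b k).
  apply: PMl; first exact: block_of_entry hX.
  by move/block_ofP: hY => /(_ k j); rewrite leqNgt (leq_trans _ bik) // ltnNge bij.
apply: PMr; last exact: block_of_entry hY.
by move/block_ofP: hX => /(_ i k); rewrite leqNgt bik.
Qed.

Lemma block_of_subring b : subring_closed (block_of b).
Proof.
split.
- apply/block_ofP => i j; rewrite mxE; case: eqP => [->|_]; first by rewrite leqnn rpred1.
  by case: ifP; rewrite ?rpred0.
- move=> X Y /block_ofP hX /block_ofP hY; apply/block_ofP => i j; rewrite !mxE.
  by have := hX i j; have := hY i j; case: ifP => _ h1 h2; [exact: rpredB | exact: PB].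
- move=> X Y; exact: block_of_mul.
Qed.

Lemma block_of_fine b X : (forall i j : 'I_m, (i <= j)%N -> (b i <= b j)%N) ->
  X \in block_of val -> X \in block_of b.
Proof.
move=> mono hX; apply/block_ofP => i j; case: ifP => bij; first exact: block_of_entry hX.
move/block_ofP: hX => /(_ i j); case: ifP => //= ij; by rewrite mono in bij.
Qed.

Lemma unipotent_unit x : 1 - x \in P -> x != 0 /\ x^-1 \in O.
Proof.
move=> h; apply: Punit.
  by rewrite -[x](subKr 1) rpredB ?rpred1 // PO.
by apply: contra P1 => xP; rewrite -[1](subrK x); exact: PD.
Qed.

(* Elimination column by column: the pivots are units, being congruent to 1. *)
Lemma unipotent_inverse Z : (forall i j : 'I_m, (i < j)%N -> Z i j \in O) ->
  (forall i j : 'I_m, (j < i)%N -> Z i j \in P) -> (forall i, 1 - Z i i \in P) ->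
  exists2 W, W \in block_of val & W *m Z = 1%:M.
Proof.
move=> hU hL hD.
have /(_ m (leqnn m))[W hW e] : forall k, (k <= m)%N -> exists2 W, W \in block_of val & [/\
    forall i j : 'I_m, (i < j)%N -> (W *m Z) i j \in O,
    forall i j : 'I_m, (j < i)%N -> (W *m Z) i j \in P,
    forall i, 1 - (W *m Z) i i \in P &
    forall i j : 'I_m, (j < k)%N -> (W *m Z) i j = (i == j)%:R].
  elim=> [|k IH] km.
    exists 1%:M; first by case: (block_of_subring val).
    by rewrite mul1mx; split=> // i j; rewrite ltn0.
  have [W hW] := IH (ltnW km); have [Y eY] : exists Y, Y = W *m Z by exists (W *m Z).
  rewrite -eY => -[yU yL yD yC].
  pose q := Ordinal km; pose a := Y q q.
  have [a0 aV] : a != 0 /\ a^-1 \in O by apply: unipotent_unit; exact: yD.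
  have YO i j : Y i j \in O.
    have [/yU//|/yL/PO//|/val_inj ->] := ltngtP i j.
    by rewrite -[Y j j](subKr 1) rpredB ?rpred1 // PO.
  (* Left multiplication by [G] clears column [q] and makes its pivot 1. Below the diagonal the
     entries of [G] are in [P] because those of [Y] are. *)
  pose G : 'M[Delta]_m := \matrix_(i, j) if j == q then (if i == q then a^-1 else - (Y i q * a^-1)) else (i == j)%:R.
  have hG : G \in block_of val.
    apply/block_ofP => i j; rewrite mxE; case: (eqVneq j q) => [->|jq].
      case: (eqVneq i q) => [->|iq]; first by rewrite leqnn.
      case: ifP => iq'; first by rewrite rpredN rpredM.
      by apply: PN; apply: PMr => //; apply: yL; rewrite ltnNge iq'.
    case: (eqVneq i j) => [->|ij]; first by rewrite leqnn rpred1.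
    by case: ifP; rewrite ?rpred0.
  have GY i j : (G *m Y) i j = if i == q then a^-1 * Y q j else Y i j - Y i q * a^-1 * Y q j.
    rewrite mxE (bigD1 q) //= mxE eqxx; case: (eqVneq i q) => [->|iq].
      rewrite big1 ?addr0 // => l lq; by rewrite mxE (negbTE lq) eq_sym (negbTE lq) mul0r.
    rewrite (bigD1 i) //= mxE (negbTE iq) eqxx mul1r big1 ?addr0 => [|l /andP[lq li]].
      by rewrite mulNr addrC.
    by rewrite mxE (negbTE lq) eq_sym (negbTE li) mul0r.
  have Yq (j : 'I_m) : (j < k)%N -> Y q j = 0.
    by move=> jk; rewrite yC //; case: eqP => // e; move: jk; rewrite -e ltnn.
  exists (G *m W); first exact: block_of_mul.
  rewrite -mulmxA -eY; split=> [i j ij|i j ij|i|i j jk]; rewrite GY.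
  - by case: ifP => _; [apply: rpredM | apply: rpredB => //; apply: rpredM => //; apply: rpredM].
  - case: (eqVneq i q) => [iq|iq]; first by rewrite Yq ?mulr0 // -[k]/(val q) -iq.
    apply: PB; first exact: yL.
    have [jk|kj] := ltnP j k; first by rewrite Yq // mulr0.
    apply: PMr => //; apply: PMr => //; apply: yL.
    exact: leq_ltn_trans kj ij.
  - case: (eqVneq i q) => [->|iq]; first by rewrite mulVr ?Ddiv // subrr.
    rewrite opprB addrCA addrC; apply: PD => //.
    have [jk|kj] := ltnP i k; first by rewrite Yq // mulr0.
    apply: PMr => //; apply: PMr => //; apply: yL.
    by rewrite ltn_neqAle kj andbT; apply: contra iq => /eqP e; apply/eqP/val_inj.
  - move: jk; rewrite ltnS leq_eqVlt => /orP[/eqP jk|jk].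
      have -> : j = q by apply: val_inj.
      case: (eqVneq i q) => [_|iq]; first by rewrite mulVr ?Ddiv.
      by rewrite divrK ?Ddiv // subrr.
    rewrite Yq // !mulr0 subr0 yC //; case: eqP => // ->; case: eqP => // e.
    by move: jk; rewrite -e ltnn.
exists W => //; apply/matrixP => i j; case: e => _ _ _ -> //; by rewrite mxE.
Qed.

Section Radical.
Variable b : 'I_m -> nat.
Hypothesis bmono : forall i j : 'I_m, (i <= j)%N -> (b i <= b j)%N.

Definition strict_block : {pred 'M[Delta]_m} :=
  [pred X : 'M[Delta]_m | [forall i, forall j, if (b i < b j)%N then X i j \in O else X i j \in P]].

Lemma strict_blockP X : reflect (forall i j, if (b i < b j)%N then X i j \in O else X i j \in P)
  (X \in strict_block).
Proof. by apply: (iffP forallP) => h i; [apply/forallP | apply/forallP; exact: h]. Qed.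

Lemma strict_block_sub X : X \in strict_block -> X \in block_of b.
Proof.
move/strict_blockP => h; apply/block_ofP => i j; have := h i j.
by case: ltngtP => // _; exact: PO.
Qed.

Lemma strict_block_mull X Y : X \in block_of b -> Y \in strict_block -> X *m Y \in strict_block.
Proof.
move=> hX hY; apply/strict_blockP => i j; rewrite mxE; case: ifP => bij.
  by apply: rpred_sum => k _; rewrite rpredM ?(block_of_entry _ _ hX) // (block_of_entry _ _ (strict_block_sub hY)).
apply: Psum => k _; have [bik|bik] := leqP (b i) (b k).
  apply: PMl; first exact: block_of_entry hX.
  by move/strict_blockP: hY => /(_ k j); rewrite ltnNge (leq_trans _ bik) // leqNgt bij.
apply: PMr; last exact: block_of_entry (strict_block_sub hY).
by move/block_ofP: hX => /(_ i k); rewrite leqNgt bik.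
Qed.

Lemma delta_block i j (x : Delta) : x \in O -> b i = b j -> x *: delta_mx i j \in block_of b.
Proof.
move=> xO bij; apply/block_ofP => k l; rewrite !mxE; case: eqP => [->|_] /=; last by rewrite mulr0; case: ifP; rewrite ?rpred0.
by case: eqP => [->|_] /=; rewrite ?mulr1 ?mulr0 ?bij ?leqnn //; case: ifP; rewrite ?rpred0.
Qed.

(** Modulo [strict_block] the order is a product of matrix rings over a division ring. Each column
    [j] gives a maximal left ideal, by asking that the entries of this column in the rows of its
    block lie in [P]. Conversely, a maximal left ideal missing a strict [X] would contain some
    [1 - C X], which is invertible by [unipotent_inverse]. *)
Lemma jacobson_block X : (X \in jacobson_radical (block_of b)) = (X \in strict_block).
Proof.
have [S1 SB SM] := block_of_subring b.
apply/idP/idP => [/asboolP[XS hX]|hX].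
  apply/strict_blockP => i j.
  move/block_ofP: (XS) => /(_ i j); case: ltngtP => // bij XO.
  pose J : {pred 'M[Delta]_m} := [pred Y : 'M[Delta]_m | (Y \in block_of b) &&
    [forall k, (b k == b j) ==> (Y k j \in P)]].
  have JP Y : reflect (Y \in block_of b /\ forall k, b k = b j -> Y k j \in P) (Y \in J).
    apply: (iffP andP) => -[YS h]; split=> //.
      by move=> k /eqP bk; move/forallP: h => /(_ k)/implyP; apply.
    by apply/forallP => k; apply/implyP => /eqP; exact: h.
  suff : X \in J by case/JP => _; apply.
  apply: hX; split.
  - split=> [Y /JP[]//||Y Z YS /JP[ZS hZ]].
      split=> [|Y Z /JP[YS hY] /JP[ZS hZ]]; apply/JP.
        split=> [|k _]; last by rewrite mxE.
        by rewrite -(subrr 1); exact: SB.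
      by split=> [|k bk]; [exact: SB | rewrite !mxE; apply: PB; auto].
    apply/JP; split=> [|k bk]; first exact: SM.
    rewrite mxE; apply: Psum => l _; have [blj|blj|blj] := ltngtP (b l) (b j).
    + apply: PMr; last exact: block_of_entry ZS.
      by move/block_ofP: YS => /(_ k l); rewrite leqNgt bk blj.
    + apply: PMl; first exact: block_of_entry YS.
      by move/block_ofP: ZS => /(_ l j); rewrite leqNgt blj.
    + by apply: PMl; [exact: block_of_entry YS | exact: hZ].
  - by move/(_ _ S1)/JP => [_ /(_ j erefl)]; rewrite mxE eqxx; apply/negP.
  - move=> J' [J'S [J'0 J'B] J'M] JJ' nS Y YJ'; apply/JP.
    split=> [|k bk]; first exact: J'S.
    apply: contraT => Yk; case: nS => Z ZS.
    have [u0 uV] := Punit (block_of_entry k j (J'S _ YJ')) Yk.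
    have J'D U V : U \in J' -> V \in J' -> U + V \in J'.
      by move=> hU hV; rewrite -[V]opprK; apply: (J'B) => //; rewrite -sub0r; apply: (J'B).
    (* As [Y k j] is a unit, row [k] of [Y] can be copied with coefficients for which [C *m Y] and
       [Z] agree in column [j] on the rows of its block. *)
    pose C := \sum_(l | b l == b j) (Z l j * (Y k j)^-1) *: delta_mx l k : 'M[Delta]_m.
    have CS : C \in block_of b.
      rewrite /C; elim/big_ind: _ => [||l /eqP bl].
      - by rewrite -(subrr 1); exact: SB.
      - by move=> U V hU hV; rewrite -[V]opprK; apply: (SB) => //; rewrite -sub0r; apply: (SB) => //; rewrite -(subrr 1); apply: (SB).
      - by apply: delta_block; [rewrite rpredM // (block_of_entry _ _ ZS) | rewrite bl bk].
    rewrite -[Z](subrK (C *m Y)); apply: J'D; last exact: J'M.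
    apply: JJ'; apply/JP; split=> [|l bl]; first by apply: SB => //; exact: SM (J'S _ YJ').
    rewrite !mxE (bigD1 k) //= big1 => [|l' lk]; last first.
      rewrite /C summxE big1 ?mul0r // => l'' _.
      by rewrite !mxE (negbTE lk) andbF mulr0.
    rewrite /C summxE (bigD1 l) /=; last exact/eqP.
    rewrite !mxE !eqxx mulr1 big1 => [|l'' /andP[_ ll]].
      by rewrite !addr0 divrK ?Ddiv // subrr.
    by rewrite !mxE eq_sym (negbTE ll) mulr0.
apply/asboolP; split=> [|J [[JS [J0 JB] JM] nS Jmax]]; first exact: strict_block_sub.
apply: contrapT => XJ.
pose J' : {pred 'M[Delta]_m} := [pred Y : 'M[Delta]_m |
  `[< exists Z C, [/\ Z \in J, C \in block_of b & Y = Z + C *m X] >]].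
have S0 : 0 \in block_of b by rewrite -(subrr 1); exact: SB.
have XS := strict_block_sub hX.
have JD U V : U \in J -> V \in J -> U + V \in J.
  by move=> hU hV; rewrite -[V]opprK; apply: (JB) => //; rewrite -sub0r; apply: (JB).
have SD U V : U \in block_of b -> V \in block_of b -> U + V \in block_of b.
  by move=> hU hV; rewrite -[V]opprK; apply: (SB) => //; rewrite -sub0r; apply: (SB).
apply: XJ; apply: (Jmax J').
- split.
  + move=> _ /asboolP[Z [C [ZJ CS ->]]]; apply: SD; [exact: JS | exact: SM].
  + split=> [|Y Y' /asboolP[Z [C [ZJ CS ->]]] /asboolP[Z' [C' [ZJ' CS' ->]]]].
      by apply/asboolP; exists 0, 0; rewrite mul0mx addr0.
    apply/asboolP; exists (Z - Z'), (C - C'); rewrite JB ?SB //; split=> //.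
    by rewrite mulmxBl opprD addrACA.
  + move=> B Y BS /asboolP[Z [C [ZJ CS ->]]]; apply/asboolP; exists (B *m Z), (B *m C).
    by rewrite mulrDr -[in RHS]mulmxA; split; [exact: JM | exact: SM |].
- by move=> Z ZJ; apply/asboolP; exists Z, 0; rewrite mul0mx addr0.
- move=> /(_ _ S1)/asboolP[Z [C [ZJ CS e]]]; apply: nS => Y YS.
  have /strict_blockP CX := strict_block_mull CS hX.
  have Ze : Z = 1%:M - C *m X by rewrite [1%:M]e addrK.
  have [|||W WI WZ] := @unipotent_inverse Z.
  + move=> i j ij; exact: block_of_entry (JS _ ZJ).
  + move=> i j ij; rewrite Ze !mxE (_ : (i == j) = false) ?sub0r; last by apply/eqP => e'; rewrite e' ltnn in ij.
    by have := CX i j; rewrite ltnNge bmono ?(ltnW ij) //= mxE => h; apply: PN.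
  + by move=> i; rewrite Ze !mxE eqxx subKr; have := CX i i; rewrite ltnn mxE.
  rewrite -[Y]mulmx1 -WZ mulmxA; apply: JM => //; apply: SM => //; exact: block_of_fine.
- by apply/asboolP; exists 0, 1%:M; rewrite mul1mx add0r.
Qed.
End Radical.
End BlockMatrices.

(** * The row modules and the left multipliers of their sums *)

Section LocalStructureFacts.
Variables (F : finFieldType) (K : fieldType) (iota : {rmorphism F -> K}).
Hypothesis hK : is_global_function_field iota.
Variables (D : falgType K) (v : place K) (Kv : completion v) (ls : local_structure D Kv).
Local Notation Delta := (ls_div ls).
Local Notation m := (ls_m ls).
Local Notation O := (ls_O ls).
Local Notation P := (ls_P ls).

Lemma pchar_completion : exists p, p \in [pchar Kv].
Proof.
have [p _ hp] := finPcharP F; exists p.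
by rewrite (fmorph_pchar (cincl Kv)) (fmorph_pchar iota).
Qed.

Lemma ls_residue x : x \in O -> x \notin P -> x != 0 /\ x^-1 \in O.
Proof.
have [Q [res hres]] := completion_residue hK Kv.
have [p hp] := pchar_completion.
have [pi _ hpi] := val_of_normalized (cplace Kv).
exact: (residue_division (ls_divP (l := ls)) (ls_OP ls).1 hpi (@cplace_complete _ _ Kv) hres hp (ls_PP ls)).
Qed.

Lemma ls_unif_mem pi x : cplace Kv pi = 1 -> x \in O -> pi *: x \in P.
Proof.
move=> hpi xO.
have [Q [res hres]] := completion_residue hK Kv.
have [p hp] := pchar_completion.
apply: (maximal_ideal_unif (ls_divP (l := ls)) (ls_OP ls).1 hpi (@cplace_complete _ _ Kv) hres hp (ls_PP ls)).
by apply/(ogP O hpi); exists x; rewrite // expr1.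
Qed.

Lemma ls_bounded pi x : cplace Kv pi = 1 -> exists n, pi ^+ n *: x \in O.
Proof. move=> hpi; exact: (order_bounded (ls_OP ls).1 hpi). Qed.

Lemma ls_ideal : two_sided_ideal O P. Proof. by case: (ls_PP ls). Qed.

Lemma ls_1P : 1 \notin P.
Proof.
apply/negP => h1; have [[[_ _ PM] _] h _] := ls_PP ls; apply: h => x xO.
by rewrite -[x]mulr1; exact: PM.
Qed.

Variable f : seq nat.
Hypothesis hf : is_composition ls f.

Let bf (i : 'I_m) := reshape_index f i.

Lemma comp_surj c : (c < size f)%N -> exists p : 'I_m, bf p = c.
Proof. by case: hf => h1 h2 h; exact: reshape_index_surj. Qed.

(** Each multiplication by the radical pushes one more block of entries into [P]. *)
Lemma row_moduleP i (x : 'rV[Delta]_m) : (i < size f)%N ->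
  reflect (forall j, if (bf j < i)%N then x ord0 j \in P else x ord0 j \in O)
    (x \in row_module (ls := ls) f i).
Proof.
have [[[PO [P0 PB] PMl] PMr] _ _] := ls_PP ls.
elim: i x => [|i IH] x hi; first exact: forallP.
have radE Z : (Z \in jacobson_radical (Mat_order (ls := ls) f)) = (Z \in strict_block O P bf).
  apply: (@jacobson_block _ O P (ls_divP (l := ls)) ls_ideal ls_1P ls_residue m bf) => a b.
  exact: reshape_index_mono.
have toO (c : bool) (y : Delta) : (if c then y \in P else y \in O) -> y \in O.
  by case: c => //; exact: PO.
apply: (iffP (asboolP _)) => [[k [y [z [h ->]]]] j|h].
  have ht l : if (bf j < i.+1)%N then (y l *m z l) ord0 j \in P else (y l *m z l) ord0 j \in O.
    have [/(IH _ (ltnW hi)) hy] := h l; rewrite radE => /strict_blockP hz; rewrite mxE.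
    have zO a : z l a j \in O by have := hz a j; case: ifP => // _; exact: PO.
    case: ifP => hj.
      elim/big_ind: _ => //; first by move=> a b ha hb; rewrite -[b]opprK; apply: (PB) => //; rewrite -sub0r; apply: (PB).
      move=> a _; have [ha|ha] := leqP (bf j) (bf a).
        apply: PMl; first exact: toO (hy a).
        by have := hz a j; rewrite ltnNge ha.
      apply: PMr => //; have := hy a; rewrite (leq_trans ha) //.
    by apply: rpred_sum => a _; rewrite rpredM //; exact: toO (hy a).
  rewrite summxE; case: ifP ht => _ ht; last by apply: rpred_sum => l _; exact: ht.
  elim/big_ind: _ => //; first by move=> a b ha hb; rewrite -[b]opprK; apply: (PB) => //; rewrite -sub0r; apply: (PB).
have [p hp] := comp_surj (ltnW hi).
(* A single product suffices: the unit row at a position [p] of block [i], times the matrix whose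
   row [p] is [x] and whose other rows vanish. *)
exists 1%N, (fun _ => delta_mx ord0 p), (fun _ => \matrix_(a, b) if a == p then x ord0 b else 0).
split=> [_|].
  split.
    apply/(IH _ (ltnW hi)) => j; rewrite mxE eqxx /=; case: (eqVneq j p) => [->|_].
      by rewrite hp ltnn rpred1.
    by case: ifP; rewrite ?rpred0.
  rewrite radE; apply/strict_blockP => a b; rewrite mxE; case: (eqVneq a p) => [->|_].
    by have := h b; rewrite hp ltnS; case: (leqP (bf b) i).
  by case: ifP; rewrite ?rpred0.
rewrite big_ord1; apply/matrixP => a j; rewrite (ord1 a) mxE (bigD1 p) //= !mxE !eqxx mul1r.
rewrite big1 ?addr0 // => l lp; by rewrite !mxE (negbTE lp) andbF mul0r.
Qed.

Variable g : seq nat.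
Hypotheses (hgsize : size g = size f) (hgsum : sumn g = m).

Let bg (i : 'I_m) := reshape_index g i.

Let bg_lt i : (bg i < size f)%N.
Proof. by rewrite -hgsize reshape_indexP // hgsum. Qed.

Lemma row_module_sumP (X : 'M[Delta]_m) : reflect
  (forall k j, if (bf j < bg k)%N then X k j \in P else X k j \in O)
  (X \in row_module_sum (ls := ls) f g).
Proof.
apply: (iffP forallP) => h k; last first.
  apply/row_moduleP; first exact: bg_lt.
  by move=> j; rewrite mxE; exact: h.
by have /row_moduleP := h k => /(_ (bg_lt k)) h' j; have := h' j; rewrite mxE.
Qed.

(** For [j] in the block of [f] numbered [bg l], the elementary matrix at [(l, j)] is in the module.
    [Y] carries it to the entries [Y k l] in column [j], which must lie in [P] exactly when
    [bg l < bg k]. Such a [j] exists as no block of [f] is empty. *)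
Lemma left_multiplier_row_module_sum (Y : 'M[Delta]_m) :
  (forall X, X \in row_module_sum (ls := ls) f g -> Y *m X \in row_module_sum (ls := ls) f g) <->
  Y \in Mat_order (ls := ls) [seq k <- g | (0 < k)%N].
Proof.
have [[[PO [P0 PB] PMl] PMr] _ _] := ls_PP ls.
have Psum (T : Type) (r : seq T) (Q : pred T) (G : T -> Delta) :
    (forall i, Q i -> G i \in P) -> \sum_(i <- r | Q i) G i \in P.
  move=> h; elim/big_ind: _ => // a b ha hb.
  by rewrite -[b]opprK; apply: (PB) => //; rewrite -sub0r; apply: (PB).
have -> : (Y \in Mat_order (ls := ls) [seq k <- g | (0 < k)%N]) = (Y \in block_of O P bg).
  by apply: eq_forallb => i; apply: eq_forallb => j; rewrite -reshape_index_filter.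
split=> [h|/block_ofP hY X /row_module_sumP hX].
  apply/block_ofP => k l; have [j hj] := comp_surj (bg_lt l).
  have /h/row_module_sumP/(_ k j) : delta_mx l j \in row_module_sum (ls := ls) f g.
    apply/row_module_sumP => a b; rewrite mxE; case: (eqVneq b j) => [->|_]; last first.
      by rewrite andbF; case: ifP; rewrite ?rpred0.
    case: (eqVneq a l) => [->|_] /=; last by case: ifP; rewrite ?rpred0.
    by rewrite hj ltnn rpred1.
  rewrite mxE (bigD1 l) //= !mxE !eqxx mulr1 big1 ?addr0 => [|a al]; last first.
    by rewrite mxE (negbTE al) mulr0.
  by rewrite hj ltnNge; case: (leqP (bg k) (bg l)).
apply/row_module_sumP => k j; rewrite mxE.
have YO a b : Y a b \in O by have := hY a b; case: ifP => // _; exact: PO.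
have XO a b : X a b \in O by have := hX a b; case: ifP => // _; exact: PO.
case: ifP => hj; last by apply: rpred_sum => a _; exact: rpredM.
apply: Psum => a _; have [ka|ka] := leqP (bg k) (bg a).
  by apply: PMl => //; have := hX a j; rewrite (leq_trans hj).
by apply: PMr => //; have := hY k a; rewrite leqNgt ka.
Qed.

(* Row k of the module lies in M_(bg k), the set of rows of index p of
   Mat(f, O) for any p in the block bg k of f. *)
Lemma row_module_sum_dual_basis : exists c e : 'I_m -> 'M[Delta]_m,
  [/\ forall k, c k \in row_module_sum (ls := ls) f g,
      forall k X, X \in row_module_sum (ls := ls) f g -> e k *m X \in Mat_order (ls := ls) f
    & \sum_k c k *m e k = 1%:M].
Proof.
have [[[PO [P0 PB] PMl] PMr] _ _] := ls_PP ls.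
have /choice[p hp] : forall k, exists p : 'I_m, bf p = bg k by move=> k; exact: comp_surj (bg_lt k).
exists (fun k => delta_mx k (p k)), (fun k => delta_mx (p k) k); split.
- move=> k; apply/row_module_sumP => a b; rewrite mxE; case: (eqVneq b (p k)) => [->|_]; last first.
    by rewrite andbF; case: ifP; rewrite ?rpred0.
  case: (eqVneq a k) => [->|_] /=; last by case: ifP; rewrite ?rpred0.
  by rewrite hp ltnn rpred1.
- move=> k X /row_module_sumP hX; apply/(@block_ofP _ O P _ bf) => a b.
  rewrite mxE (bigD1 k) //= big1 ?addr0 => [|l lk]; last by rewrite mxE (negbTE lk) andbF mul0r.
  rewrite mxE eqxx andbT; case: (eqVneq a (p k)) => [->|_]; last first.
    by rewrite mul0r; case: ifP; rewrite ?rpred0.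
  by rewrite mul1r hp leqNgt; have := hX k b; case: (bf b < bg k)%N.
- under eq_bigr do rewrite mul_delta_mx.
  by rewrite mx1_sum_delta.
Qed.

Lemma Mat_order_zmod h : zmod_closed (Mat_order (ls := ls) h).
Proof.
have [h1 h2 _] := @block_of_subring _ O P ls_ideal m (fun i => reshape_index h i).
by split=> //; rewrite -(subrr 1); exact: h2.
Qed.

Lemma matrix_bounded pi (Z : 'M[Delta]_m) : cplace Kv pi = 1 ->
  exists n, forall i j, (pi ^+ n)%:A * Z i j \in P /\ (pi ^+ n)%:A * Z i j \in O.
Proof.
have [[[PO [P0 PB] PMl] PMr] _ _] := ls_PP ls.
move=> hpi; have /choice[n hn] : forall ij : 'I_m * 'I_m, exists n, pi ^+ n *: Z ij.1 ij.2 \in O.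
  by move=> ij; exact: ls_bounded.
(* One power of [pi] more than integrality requires, in order to land in [P]. *)
exists (\max_ij n ij).+1 => i j.
suff h : (pi ^+ (\max_ij n ij).+1)%:A * Z i j \in P by split=> //; exact: PO.
rewrite -scalerAl mul1r exprS -scalerA; apply: ls_unif_mem => //.
have le : (n (i, j) <= \max_ij n ij)%N by exact: (leq_bigmax (F := n)).
rewrite -(subnK le) exprD -scalerA.
apply: order_scale; [exact: (ls_OP ls).1 | exact: pi_vge | exact: (hn (i, j))].
Qed.
End LocalStructureFacts.

(** * Tensor products *)

Section AdditiveOn.
Variables (T W : zmodType) (T0 : {pred T}) (h : T -> W).
Hypotheses (T0c : zmod_closed T0) (hadd : additive_on T0 h).

Lemma zmod_closed_add x y : x \in T0 -> y \in T0 -> x + y \in T0.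
Proof.
have [h0 hB] := T0c => hx hy; rewrite -[y]opprK; apply: (hB) => //.
by rewrite -sub0r; apply: (hB).
Qed.

Lemma zmod_closed_sum (I : Type) (r : seq I) (P : pred I) (G : I -> T) :
  (forall i, P i -> G i \in T0) -> \sum_(i <- r | P i) G i \in T0.
Proof.
move=> hG; elim/big_ind: _ => //; first by case: T0c.
exact: zmod_closed_add.
Qed.

Lemma additive_on0 : h 0 = 0.
Proof.
have [h0 _] := T0c; apply: (addrI (h 0)); rewrite addr0 -hadd // addr0 //.
Qed.

Lemma additive_on_sum (I : Type) (r : seq I) (G : I -> T) :
  (forall i, G i \in T0) -> h (\sum_(i <- r) G i) = \sum_(i <- r) h (G i).
Proof.
move=> hG; elim: r => [|i r IH]; first by rewrite !big_nil additive_on0.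
by rewrite !big_cons hadd ?IH //; apply: zmod_closed_sum => ? _.
Qed.

Lemma additive_onN x : x \in T0 -> h (- x) = - h x.
Proof.
have [h0 hB] := T0c => hx; apply/eqP; rewrite -addr_eq0 -hadd ?addNr ?additive_on0 //.
by rewrite -sub0r; apply: (hB).
Qed.
End AdditiveOn.

Section TensorTheory.
Import generic_quotient ring_quotient.
Local Open Scope quotient_scope.
Variables (K L : fieldType) (iota : {rmorphism K -> L}) (A : {pred K}).
Variables (V : lmodType K) (M : {pred V}) (N : {pred L}).
Hypotheses (Mc : zmod_closed M) (Nc : zmod_closed N).

Section Balanced.
Variables (W : zmodType) (b : V -> L -> W).
Hypothesis hb : balanced iota A M N b.

Lemma balanced_addl a : a \in N -> additive_on M (b^~ a).
Proof. by case: hb => h _ _ aN x y xM yM; exact: h. Qed.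

Lemma balanced_addr x : x \in M -> additive_on N (b x).
Proof. by case: hb => _ h _ xM a c aN cN; exact: h. Qed.

Lemma balanced_suml (I : Type) (r : seq I) (x : I -> V) a : a \in N ->
  (forall i, x i \in M) -> b (\sum_(i <- r) x i) a = \sum_(i <- r) b (x i) a.
Proof. by move=> aN xM; rewrite (additive_on_sum Mc (balanced_addl aN)). Qed.

Lemma balanced_sumr (I : Type) (r : seq I) x (a : I -> L) : x \in M ->
  (forall i, a i \in N) -> b x (\sum_(i <- r) a i) = \sum_(i <- r) b x (a i).
Proof. by move=> xM aN; rewrite (additive_on_sum Nc (balanced_addr xM)). Qed.
End Balanced.

Variables (T : zmodType) (T0 : {pred T}) (tau : V -> L -> T).
Hypothesis htau : is_tensor iota A M N T0 tau.

Lemma tensor_in x a : x \in M -> a \in N -> tau x a \in T0.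
Proof. by case: htau => _ h _ _; exact: h. Qed.

(* The quotient map by the subgroup spanned by the pure tensors and the zero
   map agree on pure tensors, hence on T0. *)
Lemma tensor_span t : t \in T0 -> exists k (x : 'I_k -> V) (a : 'I_k -> L),
  (forall i, x i \in M /\ a i \in N) /\ t = \sum_i tau (x i) (a i).
Proof.
have [T0c _ tb uni] := htau; move=> tT0.
pose G : {pred T} := [pred u | `[< exists k (x : 'I_k -> V) (a : 'I_k -> L),
  (forall i, x i \in M /\ a i \in N) /\ u = \sum_i tau (x i) (a i) >]].
have GP u : (u \in G) = `[< exists k (x : 'I_k -> V) (a : 'I_k -> L),
  (forall i, x i \in M /\ a i \in N) /\ u = \sum_i tau (x i) (a i) >] by [].
have [_ MB] := Mc.
have Gc : zmod_closed G.
  split=> [|u w]; rewrite !GP.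
    by apply/asboolP; exists 0%N, (fun _ => 0), (fun _ => 0); rewrite big_ord0; split=> [[]|].
  move=> /asboolP[k [x [a [h ->]]]] /asboolP[l [y [c [h' ->]]]]; apply/asboolP.
  exists (k + l)%N, (fun i => match split i with inl j => x j | inr j => - y j end),
    (fun i => match split i with inl j => a j | inr j => c j end); split.
    move=> i; case: split => j; first exact: h.
    by have [h1 h2] := h' j; split=> //; rewrite -sub0r; apply: MB => //; case: Mc.
  rewrite big_split_ord -sumrN; congr (_ + _); apply: eq_bigr => i _.
    by rewrite (unsplitK (inl i)).
  rewrite (unsplitK (inr i)); have [h1 h2] := h' i.
  by rewrite (additive_onN Mc (balanced_addl tb h2)).
pose H : zmodClosed T := HB.pack G (GRing.isZmodClosed.Build T G Gc).
have [_ /(_ (fun u => \pi_(Quotient.quot H) u) (fun _ => 0))] :=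
  uni _ (fun _ _ => 0 : Quotient.quot H)
   (And3 (fun _ _ _ _ _ _ => esym (addr0 _)) (fun _ _ _ _ _ _ => esym (addr0 _)) (fun _ _ _ _ _ _ => erefl)).
move=> /(_ _ _ _ t tT0) hh; apply/asboolP; rewrite -GP.
have -> : (t \in G) = (t - 0 \in H) by rewrite subr0.
rewrite Quotient.idealrBE; apply/eqP; rewrite hh.
- by rewrite -[RHS]/(\pi_(Quotient.quot H) 0) raddf0.
- by move=> u w _ _; rewrite raddfD.
- by move=> u w _ _; rewrite addr0.
move=> x a xM aN; apply/eqP; rewrite -[X in _ == X](raddf0 \pi_(Quotient.quot H)).
rewrite -Quotient.idealrBE subr0 -[_ \in H]/(_ \in G) GP; apply/asboolP.
by exists 1%N, (fun _ => x), (fun _ => a); rewrite big_ord1; split.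
Qed.

Lemma tensor_eq_on (W : zmodType) (h1 h2 : T -> W) :
  additive_on T0 h1 -> additive_on T0 h2 ->
  (forall x a, x \in M -> a \in N -> h1 (tau x a) = h2 (tau x a)) ->
  {in T0, h1 =1 h2}.
Proof.
have [T0c _ _ _] := htau; move=> a1 a2 h t /tensor_span[k [x [a [hx ->]]]].
have ht i : tau (x i) (a i) \in T0 by have [? ?] := hx i; exact: tensor_in.
rewrite (additive_on_sum T0c a1) // (additive_on_sum T0c a2) //.
by apply: eq_bigr => i _; have [? ?] := hx i; exact: h.
Qed.

Lemma tensor_lift (W : zmodType) (b : V -> L -> W) : balanced iota A M N b ->
  exists2 h : T -> W, additive_on T0 h
    & forall x a, x \in M -> a \in N -> h (tau x a) = b x a.
Proof. by case: htau => _ _ _ uni hb; have [] := uni W b hb. Qed.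

Lemma tensor_span_gens n (y : 'I_n -> V) t :
  (forall a c, a \in N -> c \in A -> iota c * a \in N) ->
  (forall i, y i \in M) -> (forall i c, c \in A -> c *: y i \in M) ->
  (forall x, x \in M -> exists2 c : 'I_n -> K, (forall i, c i \in A) & x = \sum_i c i *: y i) ->
  t \in T0 -> exists2 a : 'I_n -> L, (forall i, a i \in N) & t = \sum_i tau (y i) (a i).
Proof.
move=> NA yM yMA My /tensor_span[k [x [a [hx ->]]]]; have [_ _ tb _] := htau.
have /choice[c hc] : forall i, exists c : 'I_n -> K, (forall j, c j \in A) /\ x i = \sum_j c j *: y j.
  by move=> i; have [c ? ?] := My _ (hx i).1; exists c.
exists (fun j => \sum_i iota (c i j) * a i) => [j|].
  apply: (zmod_closed_sum Nc) => i _; apply: NA; [exact: (hx i).2 | exact: (hc i).1].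
under [RHS]eq_bigr => j _.
  rewrite (balanced_sumr tb) //; last by move=> i; apply: NA; [exact: (hx i).2 | exact: (hc i).1].
  over.
rewrite exchange_big; apply: eq_bigr => i _ /=.
rewrite {1}(hc i).2 (balanced_suml tb) //; [|exact: (hx i).2|by move=> j; apply: yMA; exact: (hc i).1].
by apply: eq_bigr => j _; case: tb => _ _ h; rewrite h //; [exact: (hc i).1 | exact: (hx i).2].
Qed.
End TensorTheory.

(** * The left order after tensoring with the local ring *)

Section ModuleTensor.
Variables (K L : fieldType) (iota : {rmorphism K -> L}) (A : {pred K}) (Ov : subringClosed L).
Variables (D : falgType K) (R : subringClosed D) (I : zmodClosed D).
Variables (T : pzRingType) (s : {rmorphism L -> T}).
Hypothesis s_central : forall a X, s a * X = X * s a.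
Variables (S N : {pred T}) (rho sigma : D -> L -> T) (pi : L).
Hypothesis AO : forall c, c \in A -> iota c \in Ov.
Hypothesis AI : forall c x, c \in A -> x \in I -> c *: x \in I.
Hypothesis IR : forall x y, x \in I -> y \in R -> x * y \in I.
Hypothesis hrho : is_alg_tensor iota A R Ov s S rho.
Hypothesis hsigma : is_tensor iota A I Ov N sigma.
Hypothesis hmod : forall x y a b, x \in I -> y \in R -> a \in Ov -> b \in Ov ->
  sigma (x * y) (a * b) = sigma x a * rho y b.
Hypotheses (pi0 : pi != 0) (piO : pi \in Ov).
Hypothesis boundedS : forall Z, exists n, s (pi ^+ n) * Z \in S.
Hypothesis boundedN : forall Z, exists n, s (pi ^+ n) * Z \in N.

Let Rc : zmod_closed R. Proof. by split; [exact: rpred0 | move=> x y; exact: rpredB]. Qed.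
Let Ic : zmod_closed I. Proof. by split; [exact: rpred0 | move=> x y; exact: rpredB]. Qed.
Let Oc : zmod_closed Ov. Proof. by split; [exact: rpred0 | move=> x y; exact: rpredB]. Qed.
Let rhoT : is_tensor iota A R Ov S rho. Proof. by case: hrho. Qed.
Let Sc : zmod_closed S. Proof. by case: rhoT. Qed.
Let Nc : zmod_closed N. Proof. by case: hsigma. Qed.
Let sb : balanced iota A I Ov sigma. Proof. by case: hsigma. Qed.
Let rb : balanced iota A R Ov rho. Proof. by case: rhoT. Qed.
Let rho1 a : a \in Ov -> rho 1 a = s a. Proof. by case: hrho => _ _; apply. Qed.

Lemma s_unit a X Y : a != 0 -> s a * X = s a * Y -> X = Y.
Proof.
move=> a0 /(congr1 (fun Z => s a^-1 * Z)).
by rewrite !mulrA -rmorphM mulVf // rmorph1 !mul1r.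
Qed.

Lemma s_in a : a \in Ov -> s a \in S.
Proof. by move=> aO; rewrite -rho1 //; apply: (tensor_in rhoT) => //; exact: rpred1. Qed.

Lemma sigma_scal x a b : x \in I -> a \in Ov -> b \in Ov -> sigma x (a * b) = sigma x a * s b.
Proof. by move=> xI aO bO; rewrite -[x in LHS]mulr1 hmod ?rho1 ?rpred1. Qed.

Lemma rho_scal x a b : x \in R -> a \in Ov -> b \in Ov -> rho x (a * b) = rho x a * s b.
Proof.
move=> xR aO bO; rewrite -rho1 //; case: hrho => _ h _.
by rewrite h ?rpred1 // mulr1.
Qed.

Lemma sigma_scale c x a : c \in A -> x \in I -> a \in Ov ->
  sigma (c *: x) a = s (iota c) * sigma x a.
Proof.
move=> cA xI aO; case: sb => _ _ h; rewrite h // mulrC sigma_scal ?AO //.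
Qed.

Lemma rho_scale c x a : c \in A -> x \in R -> a \in Ov ->
  rho (c *: x) a = s (iota c) * rho x a.
Proof.
move=> cA xR aO; case: rb => _ _ h; rewrite h // mulrC rho_scal ?AO //.
Qed.

Lemma N_mulr n t : n \in N -> t \in S -> n * t \in N.
Proof.
move=> /(tensor_span Ic hsigma)[k [x [a [hx ->]]]] /(tensor_span Rc rhoT)[l [y [b [hy ->]]]].
rewrite mulr_suml; apply: (zmod_closed_sum Nc) => i _; have [? ?] := hx i.
rewrite mulr_sumr; apply: (zmod_closed_sum Nc) => j _; have [? ?] := hy j.
rewrite -hmod //; apply: (tensor_in hsigma); first exact: IR.
exact: rpredM.
Qed.

Lemma S_mul t u : t \in S -> u \in S -> t * u \in S.
Proof.
move=> /(tensor_span Rc rhoT)[k [x [a [hx ->]]]] /(tensor_span Rc rhoT)[l [y [b [hy ->]]]].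
rewrite mulr_suml; apply: (zmod_closed_sum Sc) => i _; have [? ?] := hx i.
rewrite mulr_sumr; apply: (zmod_closed_sum Sc) => j _; have [? ?] := hy j.
case: hrho => _ -> // _; apply: (tensor_in rhoT); exact: rpredM.
Qed.

Lemma left_cancel Y Y' :
  (forall x a, x \in I -> a \in Ov -> Y * sigma x a = Y' * sigma x a) -> Y = Y'.
Proof.
move=> h; have [n hn] := boundedN 1; rewrite mulr1 in hn.
have e : Y * s (pi ^+ n) = Y' * s (pi ^+ n).
  apply: (tensor_eq_on Ic hsigma (h1 := *%R Y) (h2 := *%R Y') _ _ h hn) => ? ? _ _; exact: mulrDr.
by apply: (@s_unit (pi ^+ n)); rewrite ?expf_neq0 // !s_central.
Qed.

(* T is the localization of N at pi, so that S-linear maps extend to T. *)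
Lemma left_mul_of_linear (h : T -> T) : additive_on N h ->
  (forall x a y b, x \in I -> a \in Ov -> y \in R -> b \in Ov ->
     h (sigma x a * rho y b) = h (sigma x a) * rho y b) ->
  exists Y, forall n, n \in N -> h n = Y * n.
Proof.
move=> hadd hlin.
have hNS n t : n \in N -> t \in S -> h (n * t) = h n * t.
  move=> nN tS; move: n nN.
  apply: (tensor_eq_on Ic hsigma (h1 := fun n => h (n * t)) (h2 := fun n => h n * t)).
  - by move=> u w uN wN; rewrite mulrDl hadd // N_mulr.
  - by move=> u w uN wN; rewrite hadd // mulrDl.
  move=> x a xI aO; move: t tS; have sN : sigma x a \in N by exact: (tensor_in hsigma).
  apply: (tensor_eq_on Rc rhoT (h1 := fun t => h (sigma x a * t)) (h2 := fun t => h (sigma x a) * t)).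
  - by move=> u w uS wS; rewrite mulrDr hadd // N_mulr.
  - by move=> u w _ _; rewrite mulrDr.
  by move=> y b yR bO; exact: hlin.
have [k hk] := boundedN 1; rewrite mulr1 in hk.
(* The value at 1 of the extension of [h] to all of [T]. As [h] is linear over [S], the element [n]
   is first multiplied by a power of [pi] that brings it into [S]. *)
exists (h (s (pi ^+ k)) * s (pi ^- k)) => n nN.
have [j hj] := boundedS n.
have e : h n * s (pi ^+ (k + j)) = h (s (pi ^+ k)) * (s (pi ^+ j) * n).
  rewrite -hNS ?s_in ?rpredX // -hNS //; congr h.
  by rewrite -s_central mulrA -rmorphM -exprD.
apply: (@s_unit (pi ^+ (k + j))); first by rewrite expf_neq0.
rewrite s_central e [RHS]mulrA [X in _ = X * _]s_central -!mulrA; congr (_ * _).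
by rewrite mulrA -rmorphM exprD mulKf ?expf_neq0.
Qed.

Section LeftOrder.
Variables (n : nat) (x phi : 'I_n -> D).
Hypotheses (xI : forall i, x i \in I) (phiR : forall i y, y \in I -> phi i * y \in R).
Hypothesis dual1 : \sum_i x i * phi i = 1.
Variable T1 : {pred T}.
Hypothesis T1c : zmod_closed T1.
Hypothesis T1E : forall Y, (forall n, n \in N -> Y * n \in N) <-> Y \in T1.

Lemma left_order_matrix y : y \in left_order I -> exists Y, forall z a,
  z \in I -> a \in Ov -> sigma (y * z) a = Y * sigma z a.
Proof.
move=> /asboolP yI.
have hb : balanced iota A I Ov (fun z a => sigma (y * z) a).
  have [h1 h2 h3] := sb; split=> [u w a uI wI aO|u a a' uI aO aO'|c u a cA uI aO].
  - by rewrite mulrDr h1 ?yI.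
  - by rewrite h2 ?yI.
  - by rewrite -scalerAr h3 ?yI.
have [h hadd hE] := tensor_lift hsigma hb.
have [Y hY] : exists Y, forall n, n \in N -> h n = Y * n.
  apply: left_mul_of_linear => // u a w b uI aO wR bO.
  by rewrite -hmod // !hE ?IR ?rpredM // mulrA hmod ?yI.
exists Y => z a zI aO; rewrite -hY ?hE //; exact: (tensor_in hsigma).
Qed.

(** As an [R]-linear map from [I] to [R], [phi i] induces an [S]-linear map from [N] to [S], hence a
    left multiplication. *)
Lemma dual_matrix i : exists Y, forall z a,
  z \in I -> a \in Ov -> rho (phi i * z) a = Y * sigma z a.
Proof.
have hb : balanced iota A I Ov (fun z a => rho (phi i * z) a).
  have [h1 h2 h3] := rb; split=> [u w a uI wI aO|u a a' uI aO aO'|c u a cA uI aO].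
  - by rewrite mulrDr h1 ?phiR.
  - by rewrite h2 ?phiR.
  - by rewrite -scalerAr h3 ?phiR.
have [h hadd hE] := tensor_lift hsigma hb.
have [Y hY] : exists Y, forall n, n \in N -> h n = Y * n.
  apply: left_mul_of_linear => // u a w b uI aO wR bO.
  rewrite -hmod // !hE ?IR ?rpredM // mulrA.
  by case: hrho => _ -> //; exact: phiR.
exists Y => z a zI aO; rewrite -hY ?hE //; exact: (tensor_in hsigma).
Qed.

(* T1 is the image of the span of the x_i phi_i: an element X of T1 equals
   sum_i (X x_i) phi_i with X x_i in N, which is I (x) Ov. *)
Lemma left_order_tensor : exists rho', is_alg_tensor iota A (left_order I) Ov s T1 rho'.
Proof.
have loP y : reflect (forall z, z \in I -> y * z \in I) (y \in left_order I) by exact: asboolP.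
have /choice[lam hlam] : forall y, exists Y, y \in left_order I ->
    forall z a, z \in I -> a \in Ov -> sigma (y * z) a = Y * sigma z a.
  move=> y; have [/left_order_matrix[Y hY]|] := boolP (y \in left_order I); first by exists Y.
  by exists 0.
have /choice[Phi hPhi] := dual_matrix.
have sN z a : z \in I -> a \in Ov -> sigma z a \in N by exact: (tensor_in hsigma).
have [sb1 sb2 _] := sb.
have lamD y z : y \in left_order I -> z \in left_order I -> lam (y + z) = lam y + lam z.
  move=> yL zL; apply: left_cancel => u a uI aO.
  rewrite -hlam ?rpredD // mulrDl sb1 ?(loP _ yL) ?(loP _ zL) //.
  by rewrite mulrDl !hlam.
have lamM y z : y \in left_order I -> z \in left_order I -> lam (y * z) = lam y * lam z.
  move=> yL zL; apply: left_cancel => u a uI aO.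
  rewrite -hlam ?rpredM // -mulrA -[RHS]mulrA -!hlam //; exact: (loP _ zL).
have lam1 : lam 1 = 1.
  by apply: left_cancel => u a uI aO; rewrite -hlam ?rpred1 // !mul1r.
have lamZ c y : c \in A -> y \in left_order I -> lam (c *: y) = s (iota c) * lam y.
  move=> cA yL; have yZ : c *: y \in left_order I.
    by apply/loP => z zI; rewrite -scalerAl AI //; exact: (loP _ yL).
  apply: left_cancel => u a uI aO.
  rewrite -hlam // -scalerAl sigma_scale //; last exact: (loP _ yL).
  by rewrite -mulrA hlam.
have xphiL i z : z \in I -> z * phi i \in left_order I.
  by move=> zI; apply/loP => u uI; rewrite -mulrA IR ?phiR.
(* The bridge between the two tensor products: the elements [z * phi i] of the left order correspond
   to products of elements of [N] with [Phi i]. *)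
have lam_xphi i z a : z \in I -> a \in Ov -> lam (z * phi i) * s a = sigma z a * Phi i.
  move=> zI aO; apply: left_cancel => u b uI bO.
  rewrite -mulrA s_central -sigma_scal // -hlam ?xphiL ?rpredM // -mulrA -mulrA.
  by rewrite -hPhi // -[b * a]mulrC hmod ?phiR.
have lamN y n0 : y \in left_order I -> n0 \in N -> lam y * n0 \in N.
  move=> yL /(tensor_span Ic hsigma)[k [z [a [hz ->]]]]; rewrite mulr_sumr.
  apply: (zmod_closed_sum Nc) => i _; have [zI aO] := hz i.
  by rewrite -hlam // sN //; exact: (loP _ yL).
have saN a n0 : a \in Ov -> n0 \in N -> s a * n0 \in N.
  by move=> aO nN; rewrite s_central N_mulr // s_in.
pose rho' y a := lam y * s a.
have rhoT1 y a : y \in left_order I -> a \in Ov -> rho' y a \in T1.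
  by move=> yL aO; apply/T1E => n0 nN; rewrite -mulrA lamN // saN.
have rb' : balanced iota A (left_order I) Ov rho'.
  split=> [y z a yL zL aO|y a a' yL aO aO'|c y a cA yL aO].
  - by rewrite /rho' lamD // mulrDl.
  - by rewrite /rho' rmorphD mulrDr.
  - by rewrite /rho' lamZ // rmorphM !mulrA [s (iota c) * _]s_central.
exists rho'; split; first split=> //.
- move=> W b hb; have [b1 b2 b3] := hb.
  have Lc : zmod_closed (left_order I) by split; [exact: rpred0 | move=> ? ?; exact: rpredB].
  split.
    (* Since [y = sum_i (y x_i) phi_i], a balanced map on the left order is recovered from its
       values at the [z * phi i], that is, from maps on the tensor product of [I]. *)
    have /choice[h hh] : forall i, exists h : T -> W, additive_on N h /\
        forall z a, z \in I -> a \in Ov -> h (sigma z a) = b (z * phi i) a.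
      move=> i; have hbi : balanced iota A I Ov (fun z a => b (z * phi i) a).
        split=> [u w a uI wI aO|u a a' uI aO aO'|c u a cA uI aO].
        - by rewrite mulrDl b1 ?xphiL.
        - by rewrite b2 ?xphiL.
        - by rewrite -scalerAl b3 ?xphiL.
      by have [h hadd hE] := tensor_lift hsigma hbi; exists h.
    have hN X i : X \in T1 -> X * sigma (x i) 1 \in N.
      by move/T1E; apply; apply: sN => //; exact: rpred1.
    exists (fun X => \sum_i h i (X * sigma (x i) 1)).
      move=> X Y XT YT; rewrite -big_split; apply: eq_bigr => i _ /=.
      by rewrite mulrDl (hh i).1 ?hN.
    move=> y a yL aO; rewrite -[in RHS](mulr1 y) -dual1 mulr_sumr (balanced_suml Lc hb) //; last first.
      by move=> i; rewrite rpredM ?xphiL.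
    apply: eq_bigr => i _; rewrite /rho' -mulrA s_central -sigma_scal ?rpred1 // mul1r -hlam //.
    by rewrite (hh i).2 ?mulrA //; exact: (loP _ yL).
  move=> h1 h2 a1 a2 h12 X XT.
  have XE : X = \sum_i X * sigma (x i) 1 * Phi i.
    rewrite -[LHS]mulr1 -lam1 -dual1.
    have lam_sum : lam (\sum_i x i * phi i) = \sum_i lam (x i * phi i).
      by apply: (additive_on_sum Lc) => // i; exact: xphiL.
    rewrite lam_sum mulr_sumr; apply: eq_bigr => i _.
    by rewrite -mulrA -lam_xphi ?rpred1 // rmorph1 mulr1.
  have hX i : X * sigma (x i) 1 \in N by apply: (T1E X).2 => //; apply: sN => //; exact: rpred1.
  have Phi_in i n0 : n0 \in N -> n0 * Phi i \in T1.
    move=> /(tensor_span Ic hsigma)[k [z [a [hz ->]]]]; rewrite mulr_suml.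
    by apply: (zmod_closed_sum T1c) => j _; have [zI aO] := hz j; rewrite -lam_xphi // rhoT1 ?xphiL.
  rewrite XE (additive_on_sum T1c a1) ?(additive_on_sum T1c a2) => [|i|i]; try exact: Phi_in.
  apply: eq_bigr => i _; move: (X * _) (hX i) => {X XT XE hX}.
  apply: (tensor_eq_on Ic hsigma (h1 := fun n => h1 (n * Phi i)) (h2 := fun n => h2 (n * Phi i))).
  - by move=> u w uN wN; rewrite mulrDl a1 // Phi_in.
  - by move=> u w uN wN; rewrite mulrDl a2 // Phi_in.
  by move=> z a zI aO; rewrite -lam_xphi // h12 ?xphiL.
- move=> y z a c yL zL aO cO; rewrite /rho' lamM // rmorphM !mulrA; congr (_ * _).
  by rewrite -!mulrA [s a * _]s_central.
- by move=> a aO; rewrite /rho' lam1 mul1r.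
Qed.
End LeftOrder.
End ModuleTensor.

(** * The trace ideal *)

(* b lies in I I^*, where I^* consists of the phi with phi I included in R. *)
Definition trace_elt (D : pzRingType) (R I : {pred D}) (b : D) : Prop :=
  span_over (fun x => x \in I) (fun phi => forall y, y \in I -> phi * y \in R) b.

Lemma gens_closed (K : fieldType) (A : subringClosed K) (V : lmodType K)
    (M : {pred V}) n (g : 'I_n -> V) : (forall x, x \in M <->
    exists2 a : 'I_n -> K, (forall i, a i \in A) & x = \sum_i a i *: g i) ->
  (forall i, g i \in M) /\ (forall c x, c \in A -> x \in M -> c *: x \in M).
Proof.
move=> Mg; split=> [i|c x cA /Mg[a aA ->]]; apply/Mg.
  exists (fun j => (j == i)%:R) => [j|]; first by case: eqP; rewrite ?rpred1 ?rpred0.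
  by rewrite (bigD1 i) //= eqxx scale1r big1 ?addr0 // => j /negbTE ->; exact: scale0r.
exists (fun i => c * a i) => [i|]; first exact: rpredM.
by rewrite scaler_sumr; apply: eq_bigr => i _; rewrite scalerA.
Qed.

(** * Elements of the trace ideal of value 0 at a given place *)

Section LocalTrace.
Variables (K : fieldType) (v : place K) (Kv : completion v) (A : subringClosed K).
Local Notation iota := (cincl Kv).
Local Notation Ov := (val_ring (cplace Kv)).
Hypothesis AOv : forall c, c \in A -> vge v 0 c.
Hypothesis Aden : forall x, vge v 0 x -> exists2 b, b \in A & [/\ b != 0, v b = 0 & b * x \in A].
Hypothesis Afrac : forall x, exists2 b, b \in A & b != 0 /\ b * x \in A.
Variables (D : falgType K) (R : subringClosed D) (I : zmodClosed D).
Hypothesis Ddiv : is_division D.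
Variables (nR nI : nat) (rg : 'I_nR -> D) (xg : 'I_nI -> D).
Hypothesis Rg : forall x, x \in R <->
  exists2 a : 'I_nR -> K, (forall i, a i \in A) & x = \sum_i a i *: rg i.
Hypothesis Rspan : forall x, exists a : 'I_nR -> K, x = \sum_i a i *: rg i.
Hypothesis Ig : forall x, x \in I <->
  exists2 a : 'I_nI -> K, (forall i, a i \in A) & x = \sum_i a i *: xg i.
Hypothesis Ispan : forall x, exists a : 'I_nI -> K, x = \sum_i a i *: xg i.
Hypothesis IR : forall x y, x \in I -> y \in R -> x * y \in I.

Let rgR i : rg i \in R. Proof. by have [] := gens_closed Rg. Qed.
Let RA c x : c \in A -> x \in R -> c *: x \in R.
Proof. have [_ h] := gens_closed Rg; exact: h. Qed.
Let xgI i : xg i \in I. Proof. by have [] := gens_closed Ig. Qed.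
Let IA c x : c \in A -> x \in I -> c *: x \in I.
Proof. have [_ h] := gens_closed Ig; exact: h. Qed.

(** The product of the individual denominators. [Q] stands for a multiplicative requirement, such as
    having value 0 at [v], and [P j] for one that survives multiplication by [A]. *)
Lemma common_denominator (Q : K -> Prop) (J : finType) (P : J -> K -> Prop) :
  Q 1 -> (forall a b, Q a -> Q b -> Q (a * b)) ->
  (forall j a b, a \in A -> P j b -> P j (a * b)) ->
  (forall j, exists2 b, b \in A & Q b /\ P j b) ->
  exists2 b, b \in A & Q b /\ forall j, P j b.
Proof.
move=> Q1 QM PA /(fun h => choice (fun j => let: ex_intro2 b h1 h2 := h j in
  ex_intro (fun b => b \in A /\ Q b /\ P j b) b (conj h1 h2)))[b hb].
have bA j : b j \in A by case: (hb j).
have prodA (r : seq J) (S : pred J) : \prod_(j <- r | S j) b j \in A by apply: rpred_prod.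
exists (\prod_j b j) => //; split.
  by elim/big_ind: _ => // j _; case: (hb j) => _ [].
move=> j; rewrite (bigD1 j) //= mulrC; apply: PA => //; by case: (hb j) => _ [].
Qed.

Lemma order_denominator (y : D) : exists2 c, c \in A & c != 0 /\ c *: y \in R.
Proof.
have [a ->] := Rspan y.
have [] := @common_denominator (fun c => c != 0) _ (fun i c => c * a i \in A).
- exact: oner_neq0.
- by move=> *; exact: mulf_neq0.
- by move=> i c d cA dA; rewrite -mulrA rpredM.
- by move=> i; have [b bA [b0 h]] := Afrac (a i); exists b.
move=> c cA [c0 hc]; exists c => //; split=> //; rewrite scaler_sumr.
by apply: rpred_sum => i _; rewrite scalerA RA.
Qed.

Lemma nonzero_gen : exists i, xg i != 0.
Proof.
apply: contrapT => h; have [a /eqP] := Ispan 1.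
rewrite big1 ?oner_eq0 // => i _; have [->|x0] := eqVneq (xg i) 0; first exact: scaler0.
by case: h; exists i.
Qed.

(** With [c] a common denominator of the [x0^-1 x_i], the product of [x0] and [c x0^-1] will do. It
    is the nonzero member that [regular_ideal1] asks for. *)
Lemma trace_elt_nonzero : exists2 b, b \in A & b != 0 /\ trace_elt R I b%:A.
Proof.
have [i0 xi0] := nonzero_gen.
have [] := @common_denominator (fun c => c != 0) _ (fun i c => c *: ((xg i0)^-1 * xg i) \in R).
- exact: oner_neq0.
- by move=> *; exact: mulf_neq0.
- by move=> i c d cA dA; rewrite -scalerA RA.
- by move=> i; have [c cA [c0 h]] := order_denominator ((xg i0)^-1 * xg i); exists c.
move=> c cA [c0 hc]; exists c => //; split=> //.
exists 1%N, (fun _ => xg i0), (fun _ => c *: (xg i0)^-1); split.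
  move=> _; split=> // y /Ig[a aA ->]; rewrite mulr_sumr; apply: rpred_sum => i _.
  by rewrite -scalerAr RA // -scalerAl.
by rewrite big_ord1 -scalerAr divrr // Ddiv.
Qed.

Variables (T : pzRingType) (s : {rmorphism Kv -> T}).
Hypothesis s_central : forall a X, s a * X = X * s a.
Variables (S N : {pred T}) (rho sigma : D -> Kv -> T) (pi : Kv).
Hypothesis hrho : is_alg_tensor iota A R Ov s S rho.
Hypothesis hsigma : is_tensor iota A I Ov N sigma.
Hypothesis hmod : forall x y a b, x \in I -> y \in R -> a \in Ov -> b \in Ov ->
  sigma (x * y) (a * b) = sigma x a * rho y b.
Hypothesis vpi : cplace Kv pi = 1.
Hypothesis boundedS : forall Z, exists n, s (pi ^+ n) * Z \in S.
Hypothesis boundedN : forall Z, exists n, s (pi ^+ n) * Z \in N.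
Variables (d : nat) (c e : 'I_d -> T).
Hypotheses (cN : forall k, c k \in N) (eNS : forall k X, X \in N -> e k * X \in S).
Hypothesis ce1 : \sum_k c k * e k = 1.

Let AO a : a \in A -> iota a \in Ov.
Proof. by move=> /AOv h; rewrite in_val_ring /vge fmorph_eq0 cplace_incl. Qed.
Let pi0 : pi != 0.
Proof. by apply/eqP => e'; move: vpi; rewrite e' val_of0. Qed.
Let piO : pi \in Ov. Proof. by rewrite inE vpi. Qed.
Let Rc : zmod_closed R. Proof. by split; [exact: rpred0 | move=> x y; exact: rpredB]. Qed.
Let Ic : zmod_closed I. Proof. by split; [exact: rpred0 | move=> x y; exact: rpredB]. Qed.
Let Oc : zmod_closed Ov. Proof. by split; [exact: rpred0 | move=> x y; exact: rpredB]. Qed.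
Let rhoT : is_tensor iota A R Ov S rho. Proof. by case: hrho. Qed.
Let Sc : zmod_closed S. Proof. by case: rhoT. Qed.
Let rho1 a : a \in Ov -> rho 1 a = s a. Proof. by case: hrho => _ _; apply. Qed.
Let iota_neq0 a : a != 0 -> iota a != 0. Proof. by rewrite fmorph_eq0. Qed.

Let s_cancel a X Y : a != 0 -> s a * X = s a * Y -> X = Y.
Proof. exact: s_unit. Qed.

Let rhoE y a : y \in R -> a \in Ov -> rho y a = rho y 1 * s a.
Proof. by move=> yR aO; rewrite -(rho_scal hrho) ?rpred1 // mul1r. Qed.

(** Every element of [D] has a multiple in [R] by a nonzero element of [A], which is invertible in
    [T]; dividing by it extends [rho _ 1] to [D]. Approximation in [T] goes through this map. *)
Lemma rho_extension : exists Rho : D -> T, [/\ forall y a, y \in R -> a \in Ov -> rho y a = Rho y * s a,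
  forall y z, Rho (y * z) = Rho y * Rho z, forall y z, Rho (y + z) = Rho y + Rho z,
  forall a y, Rho (a *: y) = s (iota a) * Rho y & Rho 1 = 1].
Proof.
have /choice[dn hdn] : forall y : D, exists b, [/\ b \in A, b != 0 & b *: y \in R].
  by move=> y; have [b bA [b0 h]] := order_denominator y; exists b.
have [Rho RhoE] : exists Rho : D -> T, forall y, Rho y = s (iota (dn y))^-1 * rho (dn y *: y) 1.
  by exists (fun y => s (iota (dn y))^-1 * rho (dn y *: y) 1).
have RhoP y b : b \in A -> b != 0 -> b *: y \in R -> rho (b *: y) 1 = s (iota b) * Rho y.
  move=> bA b0 byR; have [dA d0 dyR] := hdn y.
  apply: (s_cancel (iota_neq0 d0)).
  rewrite -(rho_scale s_central AO hrho) ?rpred1 // scalerA mulrC -scalerA.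
  rewrite (rho_scale s_central AO hrho) ?rpred1 //.
  rewrite [RHS]mulrA -rmorphM mulrC rmorphM -mulrA; congr (_ * _); rewrite RhoE mulrA -rmorphM divff ?rmorph1 ?mul1r //.
  exact: iota_neq0.
have rhoR y : y \in R -> rho y 1 = Rho y.
  by move=> yR; have := RhoP y 1; rewrite rpred1 oner_neq0 scale1r !rmorph1 mul1r; apply.
have RhoZ a y : Rho (a *: y) = s (iota a) * Rho y.
  have [b bA [b0 baA]] := Afrac a; have [dA d0 dyR] := hdn y.
  apply: (s_cancel (iota_neq0 (mulf_neq0 b0 d0))).
  have e1 : b * dn y * a = b * a * dn y by rewrite mulrAC.
  rewrite -RhoP ?rpredM ?mulf_neq0 //; last by rewrite scalerA e1 -scalerA RA.
  rewrite scalerA e1 -scalerA (rho_scale s_central AO hrho) ?rpred1 // RhoP //.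
  by rewrite !mulrA -!rmorphM e1.
exists Rho; split=> //.
- by move=> y a yR aO; rewrite rhoE // rhoR.
- move=> y z; have [dA d0 dyR] := hdn y; have [dA' d0' dzR] := hdn z.
  apply: (s_cancel (iota_neq0 (mulf_neq0 d0 d0'))).
  have e1 : (dn y * dn z) *: (y * z) = (dn y *: y) * (dn z *: z).
    by rewrite -scalerAl -scalerAr scalerA.
  rewrite -RhoZ e1 -rhoR ?rpredM //; case: hrho => _ h _.
  rewrite -[X in rho _ X](mulr1 1) -h ?rpred1 // !rhoR // !RhoZ !rmorphM.
  by rewrite -!mulrA; congr (_ * _); rewrite mulrA -s_central -!mulrA.
- move=> y z; have [dA d0 dyR] := hdn y; have [dA' d0' dzR] := hdn z.
  apply: (s_cancel (iota_neq0 (mulf_neq0 d0 d0'))).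
  have h1 : (dn y * dn z) *: y \in R by rewrite mulrC -scalerA RA.
  have h2 : (dn y * dn z) *: z \in R by rewrite -scalerA RA.
  rewrite mulrDr -!RhoZ scalerDr -!rhoR ?rpredD //.
  by case: rhoT => _ _ [h _ _] _; rewrite h ?rpred1.
- by rewrite -rhoR ?rpred1 // rho1 ?rpred1 // rmorph1.
Qed.

Section WithRho.
Variable Rho : D -> T.
Hypothesis rhoRho : forall y a, y \in R -> a \in Ov -> rho y a = Rho y * s a.
Hypothesis RhoM : forall y z, Rho (y * z) = Rho y * Rho z.
Hypothesis RhoD : forall y z, Rho (y + z) = Rho y + Rho z.
Hypothesis RhoZ : forall a y, Rho (a *: y) = s (iota a) * Rho y.
Hypothesis Rho1 : Rho 1 = 1.

Let Rho0 : Rho 0 = 0.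
Proof. by apply: (addrI (Rho 0)); rewrite -RhoD !addr0. Qed.

Let Rho_sum n (y : 'I_n -> D) (P : pred 'I_n) : Rho (\sum_(i | P i) y i) = \sum_(i | P i) Rho (y i).
Proof. by apply: (big_morph Rho RhoD Rho0). Qed.

Let RhoN y : Rho (- y) = - Rho y.
Proof. by apply/eqP; rewrite -addr_eq0 -RhoD addNr Rho0. Qed.

(** Coordinates in a basis of [R] at [v] extend to the tensor product with values in [Ov], so [y]
    has coordinates integral at [v]. [Aden] then clears their denominators by elements of value
    0. *)
Lemma Rho_integral y : Rho y \in S -> exists2 b, b \in A & [/\ b != 0, v b = 0 & b *: y \in R].
Proof.
move=> yS; have [k [bs [bas bR cg]]] := @lattice_basis _ v _ (fun y => y \in R) _ _ rgR Rspan.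
have cR r i : r \in R -> vge v 0 (coord bs i r).
  move=> /Rg[a aA ->]; rewrite linear_sum; apply: vge_sum => j _.
  by rewrite linearZ /= vge0M // AOv.
have cy i : vge v 0 (coord bs i y).
  have hb : balanced iota A R Ov (fun r a => iota (coord bs i r) * a).
    split=> [r r' a _ _ _|r a a' _ _ _|a r a' _ _ _].
    - by rewrite linearD rmorphD mulrDl.
    - by rewrite mulrDr.
    - by rewrite linearZ /= rmorphM [RHS]mulrCA mulrA.
  have [h hadd hE] := tensor_lift rhoT hb.
  have [_ SB] := Sc.
  have hO t : t \in S -> h t \in Ov.
    move=> /(tensor_span Rc rhoT)[l [r [a [hr ->]]]].
    rewrite (additive_on_sum Sc hadd) => [|j]; last by have [? ?] := hr j; exact: (tensor_in rhoT).
    apply: rpred_sum => j _; have [rR aO] := hr j; rewrite hE // rpredM //.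
    by rewrite in_val_ring /vge fmorph_eq0 cplace_incl; have := cR _ i rR.
  have hs a t : a \in Ov -> t \in S -> h (s a * t) = a * h t.
    move=> aO; have sS u : u \in S -> s a * u \in S.
      by move=> uS; rewrite (S_mul hrho) ?(s_in hrho).
    apply: (tensor_eq_on Rc rhoT (h1 := fun t => h (s a * t)) (h2 := fun t => a * h t)).
    - by move=> u w uS wS; rewrite mulrDr hadd ?sS.
    - by move=> u w uS wS; rewrite hadd // mulrDr.
    move=> r a' rR aO'; rewrite s_central -(rho_scal hrho) // !hE ?rpredM //.
    by rewrite [RHS]mulrCA [a * a']mulrC.
  have [b bA [b0 byR]] := order_denominator y.
  have e1 : iota (coord bs i y) = h (Rho y).
    apply: (mulfI (iota_neq0 b0)); rewrite -hs ?AO // -RhoZ.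
    have -> : Rho (b *: y) = rho (b *: y) 1 by rewrite rhoRho ?rpred1 // rmorph1 mulr1.
    by rewrite hE ?rpred1 // linearZ /= rmorphM mulr1.
  have : iota (coord bs i y) \in Ov by rewrite e1 hO.
  by rewrite in_val_ring /vge fmorph_eq0 cplace_incl.
have [] := @common_denominator (fun b => b != 0 /\ v b = 0) _ (fun i b => b * coord bs i y \in A).
- by rewrite oner_neq0 place1.
- by move=> a b [a0 va] [b0 vb]; rewrite mulf_neq0 // val_ofM // va vb.
- by move=> i a b aA bA; rewrite -mulrA rpredM.
- by move=> i; have [b bA [b0 vb h]] := Aden (cy i); exists b.
move=> b bA [[b0 vb] hb]; exists b => //; split=> //.
rewrite (coord_basis bas (memvf y)) scaler_sumr; apply: rpred_sum => i _.
by rewrite scalerA RA.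
Qed.

Lemma Rho_dense Y M : exists phi, exists2 t, t \in S & Rho phi - Y = s (pi ^+ M) * t.
Proof.
have [k hk] := boundedS Y; have [l [r [a [hr e1]]]] := tensor_span Rc rhoT hk.
have YE : Y = \sum_i Rho (r i) * s (a i / pi ^+ k).
  apply: (@s_cancel (pi ^+ k)); first by rewrite expf_neq0.
  rewrite e1 mulr_sumr; apply: eq_bigr => i _; have [rR aO] := hr i.
  by rewrite rhoRho // s_central -mulrA -rmorphM divfK ?expf_neq0.
have /choice[al hal] : forall i, exists al : K, exists2 b, b \in Ov &
    iota al - a i / pi ^+ k = pi ^+ M * b.
  move=> i; have [al /vge_closeE h] := @cplace_dense _ _ Kv (a i / pi ^+ k) M%:Z.
  exists al, (pi ^- M * (iota al - a i / pi ^+ k)).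
    by rewrite in_val_ring vge_divX.
  by rewrite mulVKf ?expf_neq0.
have /choice[b hb] : forall i, exists b, b \in Ov /\ iota (al i) - a i / pi ^+ k = pi ^+ M * b.
  by move=> i; have [b ? ?] := hal i; exists b.
exists (\sum_i al i *: r i), (\sum_i rho (r i) (b i)).
  by apply: (zmod_closed_sum Sc) => i _; apply: (tensor_in rhoT); [exact: (hr i).1 | exact: (hb i).1].
rewrite Rho_sum YE -sumrB mulr_sumr; apply: eq_bigr => i _.
have [rR aO] := hr i; have [bO eb] := hb i.
by rewrite RhoZ s_central -mulrBr -rmorphB eb rhoRho // rmorphM [LHS]mulrA -(s_central (pi ^+ M)) -mulrA.
Qed.

Lemma bounded_family (J : finType) (Z : J -> T) : exists n, forall j, s (pi ^+ n) * Z j \in S.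
Proof.
have /choice[n hn] : forall j, exists n, s (pi ^+ n) * Z j \in S by move=> j; exact: boundedS.
exists (\max_j n j)%N => j; have le : (n j <= \max_j n j)%N by exact: (leq_bigmax (F := n)).
rewrite -(subnK le) exprD rmorphM -mulrA (S_mul hrho) //.
by apply: (s_in hrho); exact: rpredX.
Qed.

(* With u = sigma(x0) Rho(x0)^-1, one has sigma(x, a) = u Rho(x) a; hence the
   dual basis of N gives one of the Ov-span of Rho(I) inside T. *)
Lemma completed_dual_basis : exists Y : 'I_nI -> T,
  \sum_j Rho (xg j) * Y j = 1 /\ forall j x, x \in I -> Y j * Rho x \in S.
Proof.
have [i0 x00] := nonzero_gen; set x0 := xg i0 in x00.
have hb : balanced iota A I Ov (fun x a => Rho x * s a).
  split=> [x y a _ _ _|x a a' _ _ _|b x a _ _ _].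
  - by rewrite RhoD mulrDl.
  - by rewrite rmorphD mulrDr.
  - by rewrite RhoZ rmorphM mulrA [X in X * _ = _]s_central.
have [h hadd hE] := tensor_lift hsigma hb.
have [Z hZ] : exists Z, forall n, n \in N -> h n = Z * n.
  apply: (left_mul_of_linear s_central IR hrho hsigma hmod pi0 piO boundedS boundedN hadd).
  move=> x a y b xI aO yR bO; rewrite -hmod // !hE ?IR ?rpredM //.
  by rewrite RhoM rmorphM rhoRho // -!mulrA; congr (_ * _); rewrite mulrA -(s_central a) -mulrA.
have ZE x a : x \in I -> a \in Ov -> Z * sigma x a = Rho x * s a.
  by move=> xI aO; rewrite -hZ ?hE //; exact: (tensor_in hsigma).
have [u udef] : exists u, u = sigma x0 1 * Rho x0^-1 by exists (sigma x0 1 * Rho x0^-1).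
have x0V : Rho x0 * Rho x0^-1 = 1 by rewrite -RhoM divrr ?Ddiv.
have Zu : Z * u = 1.
  by rewrite udef mulrA ZE ?rpred1 //; [rewrite rmorph1 mulr1 | exact: xgI].
have uE x : x \in I -> sigma x 1 = u * Rho x.
  move=> xI; have [b bA [b0 byR]] := order_denominator (x0^-1 * x).
  apply: (s_cancel (iota_neq0 b0)).
  rewrite -(sigma_scale s_central AO hrho hsigma hmod) ?rpred1 //.
  have -> : b *: x = x0 * (b *: (x0^-1 * x)) by rewrite -scalerAr mulVKr // Ddiv.
  rewrite -[X in sigma _ X](mulr1 1) hmod ?rpred1 //; last exact: xgI.
  rewrite rhoRho ?rpred1 // rmorph1 mulr1 RhoZ RhoM mulrA -(s_central (iota b)) -mulrA; congr (_ * _).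
  by rewrite udef mulrA.
have /choice[a ha] : forall k, exists a : 'I_nI -> Kv, (forall j, a j \in Ov) /\
    c k = \sum_j sigma (xg j) (a j).
  move=> k; have [|||a aO e1] := tensor_span_gens Ic Oc hsigma _ xgI _ _ (cN k).
  - by move=> a b aO bA; rewrite rpredM ?AO.
  - by move=> i b bA; exact: IA.
  - by move=> x /Ig.
  by exists a.
exists (fun j => \sum_k s (a k j) * (e k * u)); split.
  transitivity (Z * (\sum_k c k * e k) * u); last by rewrite ce1 mulr1.
  rewrite mulr_sumr mulr_suml; under eq_bigr do rewrite mulr_sumr.
  rewrite exchange_big; apply: eq_bigr => k _; have [aO ek] := ha k.
  rewrite ek mulrA mulr_sumr !mulr_suml; apply: eq_bigr => j _.
  by rewrite ZE // !mulrA.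
move=> j x xI; rewrite mulr_suml; apply: (zmod_closed_sum Sc) => k _.
rewrite -!mulrA -uE // (S_mul hrho) ?(s_in hrho) //; first by case: (ha k).
by apply: eNS; apply: (tensor_in hsigma) => //; exact: rpred1.
Qed.

(* Density gives phi_j in D close to Y_j for j <> i0, and phi_i0 is then
   determined by sum_j x_j phi_j = 1 and still close to Y_i0. *)
Lemma rational_dual_basis : exists phi : 'I_nI -> D,
  \sum_j xg j * phi j = 1 /\ forall j i, Rho (phi j * xg i) \in S.
Proof.
have [i0 x00] := nonzero_gen; set x0 := xg i0 in x00.
have [Y [Y1 YS]] := completed_dual_basis.
have [n1 hn1] := bounded_family (fun i => Rho (xg i)).
have [n2 hn2] := bounded_family (fun i => Rho (x0^-1 * xg i)).
(* The precision has two parts: [phi i0] involves the errors multiplied by [x0^-1 x_j], which costs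
   [n2], and the final multiplication by some [x_i] costs [n1]. *)
have /choice[ps hps] : forall j, exists phi, exists t, t \in S /\ Rho phi - Y j = s (pi ^+ (n1 + n2)) * t.
  by move=> j; have [phi [t tS e1]] := Rho_dense (Y j) (n1 + n2); exists phi, t.
pose phi j := if j == i0 then x0^-1 * (1 - \sum_(j | j != i0) xg j * ps j) else ps j.
have phi_sum : \sum_(j | j != i0) xg j * phi j = \sum_(j | j != i0) xg j * ps j.
  by apply: eq_bigr => j; rewrite /phi => /negbTE ->.
have hdiff j : exists2 t, t \in S & Rho (phi j) - Y j = s (pi ^+ n1) * t.
  rewrite /phi; case: eqVneq => [->|_]; last first.
    have [t [tS ->]] := hps j; exists (s (pi ^+ n2) * t).
      by rewrite (S_mul hrho) // (s_in hrho) // rpredX.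
    by rewrite exprD rmorphM mulrA.
  have /choice[t ht] : forall j, exists t, t \in S /\ Rho (ps j) - Y j = s (pi ^+ (n1 + n2)) * t by exact: hps.
  exists (- \sum_(j | j != i0) (s (pi ^+ n2) * Rho (x0^-1 * xg j)) * t j).
    have [S0 SB] := Sc; rewrite -sub0r; apply: SB => //.
    by apply: (zmod_closed_sum Sc) => j' _; rewrite (S_mul hrho) ?hn2 //; case: (ht j').
  have x0Y : Y i0 = Rho x0^-1 * (1 - \sum_(j | j != i0) Rho (xg j) * Y j).
    rewrite -Y1 [X in X - _](bigD1 i0) //= addrK mulrA -RhoM mulVr ?Ddiv // Rho1 mul1r //.
  rewrite x0Y RhoM -mulrBr RhoD Rho1 RhoN Rho_sum [X in _ * X](_ : _ =
      - \sum_(j | j != i0) Rho (xg j) * (Rho (ps j) - Y j)).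
    rewrite !mulrN; congr (- _); rewrite !mulr_sumr; apply: eq_bigr => j' _.
    have [_ ->] := ht j'; rewrite mulrA -RhoM [LHS]mulrA.
    by rewrite -(s_central (pi ^+ (n1 + n2))) exprD rmorphM !mulrA.
  rewrite opprB addrC addrA subrK -[RHS]sumrN -sumrB.
  by apply: eq_bigr => j' _; rewrite mulrBr opprB RhoM.
exists phi; split.
  rewrite (bigD1 i0) //= phi_sum /phi eqxx mulVKr ?Ddiv // subrK //.
move=> j i; rewrite RhoM; have [t tS e1] := hdiff j.
have -> : Rho (phi j) * Rho (xg i) = Y j * Rho (xg i) + t * (s (pi ^+ n1) * Rho (xg i)).
  rewrite mulrA -s_central -e1 -mulrDl; congr (_ * _); by rewrite addrC subrK.
by apply: (zmod_closed_add Sc); [exact: YS | rewrite (S_mul hrho)].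
Qed.

Lemma trace_elt_of_Rho : exists2 b, b \in A & [/\ b != 0, v b = 0 & trace_elt R I b%:A].
Proof.
have [phi [phi1 phiS]] := rational_dual_basis.
have [] := @common_denominator (fun b => b != 0 /\ v b = 0) _
  (fun (ji : 'I_nI * 'I_nI) b => b *: (phi ji.1 * xg ji.2) \in R).
- by rewrite oner_neq0 place1.
- by move=> a b [a0 va] [b0 vb]; rewrite mulf_neq0 // val_ofM // va vb.
- by move=> i a b aA bA; rewrite -scalerA RA.
- by move=> ji; have [b bA [b0 vb h]] := Rho_integral (phiS ji.1 ji.2); exists b.
move=> b bA [[b0 vb] hb]; exists b => //; split=> //.
exists nI, xg, (fun j => b *: phi j); split.
  move=> j; split=> // y /Ig[a aA ->]; rewrite mulr_sumr; apply: rpred_sum => i _.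
  by rewrite -scalerAr RA // -scalerAl; exact: (hb (j, i)).
rewrite -phi1 scaler_sumr; by apply: eq_bigr => j _; rewrite scalerAr.
Qed.
End WithRho.

Lemma local_trace_elt : exists2 b, b \in A & [/\ b != 0, v b = 0 & trace_elt R I b%:A].
Proof. by have [Rho [h1 h2 h3 h4 h5]] := rho_extension; exact: trace_elt_of_Rho h1 h2 h3 h4 h5. Qed.
End LocalTrace.

(* The case where A consists of constants, which does not occur but is easier
   to treat than to exclude (this would take Riemann's inequality): R and I are
   then finite-dimensional over F, of the same dimension, so that I = x R. *)
Section Constants.
Variables (F : finFieldType) (K : fieldType) (iota : {rmorphism F -> K}).
Variable A : subringClosed K.
Hypothesis AF : forall a, a \in A <-> exists c, a = iota c.
Variable V : lmodType K.

Definition const_indep k (e : 'I_k -> V) : Prop :=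
  forall al : 'I_k -> F, \sum_i iota (al i) *: e i = 0 -> forall i, al i = 0.

Lemma const_basis (M : {pred V}) n (g : 'I_n -> V) : (forall x, x \in M <->
    exists2 a : 'I_n -> K, (forall i, a i \in A) & x = \sum_i a i *: g i) ->
  exists k (e : 'I_k -> V), [/\ forall i, e i \in M, const_indep e
    & forall x, x \in M <-> exists al : 'I_k -> F, x = \sum_i iota (al i) *: e i].
Proof.
move=> Mg; have [gM Ms] := gens_closed Mg.
have Madd x y : x \in M -> y \in M -> x + y \in M.
  move=> /Mg[a aA ->] /Mg[b bA ->]; apply/Mg; exists (fun i => a i + b i).
    by move=> i; exact: rpredD.
  by rewrite -big_split; apply: eq_bigr => i _; rewrite scalerDl.
have M0 : 0 \in M.
  apply/Mg; exists (fun _ => 0) => [i|]; first exact: rpred0.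
  by rewrite big1 // => i _; rewrite scale0r.
have QA m (a : 'I_m -> K) : (forall i, a i \in [pred x | x \in A]) ->
    (exists i, a i != 0) -> exists2 j, a j != 0 & forall i, a i / a j \in A.
  move=> aA [j aj]; exists j => // i; apply/AF.
  have /AF[c ->] := aA i; have /AF[d ->] := aA j.
  by exists (c / d); rewrite rmorphM fmorphV.
have [k [e [eM ge ind]]] := minimal_generators (P := fun x => x \in M) QA gM.
exists k, e; split=> //.
  move=> al h i; apply/eqP; rewrite -(fmorph_eq0 iota); apply/eqP.
  apply: (ind (fun i => iota (al i))) => // j; rewrite inE; apply/AF; by exists (al j).
move=> x; split=> [/Mg[a aA ->]|[al ->]]; last first.
  elim/big_ind: _ => // i _; apply: Ms => //; apply/AF; by exists (al i).
have /choice[b hb] : forall i, exists b : 'I_k -> F, g i = \sum_j iota (b j) *: e j.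
  move=> i; have [b bA ->] := ge i; have /choice[c hc] : forall j, exists c, b j = iota c.
    by move=> j; apply/AF.
  by exists c; apply: eq_bigr => j _; rewrite hc.
have /choice[c hc] : forall j, exists c, a j = iota c by move=> j; apply/AF.
exists (fun j => \sum_i c i * b i j).
under eq_bigr do rewrite hb hc scaler_sumr.
rewrite exchange_big; apply: eq_bigr => j _ /=; rewrite rmorph_sum scaler_suml.
by apply: eq_bigr => i _; rewrite rmorphM scalerA.
Qed.

Lemma const_span_full k (e : 'I_k -> V) l (y : 'I_l -> V) :
  (forall i, exists al : 'I_k -> F, y i = \sum_j iota (al j) *: e j) ->
  const_indep y -> (k <= l)%N ->
  forall j, exists al : 'I_l -> F, e j = \sum_i iota (al i) *: y i.
Proof.
move=> /choice[b hb] ind kl.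
pose B : 'M[F]_(l, k) := \matrix_(i, j) b i j.
have comb (w : 'rV[F]_l) : \sum_i iota (w 0 i) *: y i = \sum_j iota ((w *m B) 0 j) *: e j.
  under eq_bigr do rewrite hb scaler_sumr.
  rewrite exchange_big; apply: eq_bigr => j _ /=; rewrite mxE rmorph_sum scaler_suml.
  by apply: eq_bigr => i _; rewrite mxE rmorphM scalerA.
have inj (w : 'rV[F]_l) : w *m B = 0 -> w = 0.
  move=> wB; apply/rowP => i; rewrite mxE; apply: (ind (fun i => w 0 i)).
  by rewrite comb wB big1 // => j _; rewrite mxE rmorph0 scale0r.
have kl' : k = l.
  apply/eqP; rewrite eqn_leq kl leqNgt; apply/negP => lt.
  by have [w /eqP w0 /inj] := tall_mx_kernel B lt.
subst l => j.
have Bu : B \in unitmx.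
  rewrite -row_free_unit -kermx_eq0; apply/eqP/row_matrixP => i.
  by rewrite row0; apply: inj; rewrite -row_mul mulmx_ker row0.
exists (fun i => ((delta_mx 0 j : 'rV_k) *m invmx B) 0 i).
rewrite comb mulmxKV // (bigD1 j) //= mxE !eqxx rmorph1 scale1r big1 ?addr0 // => i ij.
by rewrite mxE (negbTE ij) andbF rmorph0 scale0r.
Qed.
End Constants.

Section ConstantRank.
Variables (F : finFieldType) (K : fieldType) (iotaF : {rmorphism F -> K}).
Variables (v : place K) (Kv : completion v) (A : subringClosed K).
Local Notation iota := (cincl Kv).
Local Notation Ov := (val_ring (cplace Kv)).
Hypothesis AF : forall a, a \in A <-> exists c, a = iotaF c.
Variables (D : falgType K) (R : subringClosed D) (I : zmodClosed D).
Hypothesis Ddiv : is_division D.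
Variables (nR nI : nat) (rg : 'I_nR -> D) (xg : 'I_nI -> D).
Hypothesis Rg : forall x, x \in R <->
  exists2 a : 'I_nR -> K, (forall i, a i \in A) & x = \sum_i a i *: rg i.
Hypothesis Ig : forall x, x \in I <->
  exists2 a : 'I_nI -> K, (forall i, a i \in A) & x = \sum_i a i *: xg i.
Hypothesis Ispan : forall x, exists a : 'I_nI -> K, x = \sum_i a i *: xg i.
Hypothesis IR : forall x y, x \in I -> y \in R -> x * y \in I.
Variables (T : pzRingType) (s : {rmorphism Kv -> T}).
Variables (S N : {pred T}) (rho sigma : D -> Kv -> T) (pi : Kv).
Hypothesis hrho : is_alg_tensor iota A R Ov s S rho.
Hypothesis hsigma : is_tensor iota A I Ov N sigma.
Hypothesis hmod : forall x y a b, x \in I -> y \in R -> a \in Ov -> b \in Ov ->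
  sigma (x * y) (a * b) = sigma x a * rho y b.
Hypothesis vpi : cplace Kv pi = 1.
Hypothesis boundedS : forall Z, exists n, s (pi ^+ n) * Z \in S.

Let AO a : a \in A -> iota a \in Ov.
Proof. by move=> /AF[c ->]; rewrite in_val_ring /vge fmorph_eq0 cplace_incl; exact: vge_const. Qed.
Let pi0 : pi != 0.
Proof. by apply/eqP => e'; move: vpi; rewrite e' val_of0. Qed.
Let Rc : zmod_closed R. Proof. by split; [exact: rpred0 | move=> x y; exact: rpredB]. Qed.
Let Ic : zmod_closed I. Proof. by split; [exact: rpred0 | move=> x y; exact: rpredB]. Qed.
Let Oc : zmod_closed Ov. Proof. by split; [exact: rpred0 | move=> x y; exact: rpredB]. Qed.
Let rhoT : is_tensor iota A R Ov S rho. Proof. by case: hrho. Qed.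
Let Sc : zmod_closed S. Proof. by case: rhoT. Qed.
Let Nc : zmod_closed N. Proof. by case: hsigma. Qed.

(* The tensors y_j (x) 1 are Kv-independent in T, which is spanned over Kv by
   the e_i (x) 1. *)
Lemma const_rank_le k (e : 'I_k -> D) l (y : 'I_l -> D) :
  (forall i, e i \in R) -> (forall x, x \in R -> exists al : 'I_k -> F, x = \sum_i iotaF (al i) *: e i) ->
  (forall i, y i \in I) -> const_indep iotaF y ->
  (forall x, x \in I -> exists al : 'I_l -> F, x = \sum_i iotaF (al i) *: y i) -> (l <= k)%N.
Proof.
move=> eR Re yI ind Iy; rewrite leqNgt; apply/negP => kl.
have [n hn] := bounded_family hrho vpi boundedS (fun j => sigma (y j) 1).
have /choice[C hC] : forall j, exists C : 'I_k -> Kv, (forall i, C i \in Ov) /\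
    s (pi ^+ n) * sigma (y j) 1 = \sum_i rho (e i) (C i).
  move=> j; have [|||C CO hC] := tensor_span_gens (y := e) Rc Oc rhoT _ eR _ _ (hn j).
  - by move=> a c aO cA; rewrite rpredM ?AO.
  - by move=> i c cA; have [_ h] := gens_closed Rg; exact: h.
  - move=> x /Re[al ->]; exists (fun i => iotaF (al i)) => // i.
    by apply/AF; exists (al i).
  by exists C.
have [w [j0 wj0] hw] : exists2 w : 'I_l -> Kv, exists j, w j != 0 &
    forall i, \sum_j w j * C j i = 0 by apply: tall_relation; rewrite !card_ord.
have [m hm] : exists m : nat, forall j, pi ^+ m * w j \in Ov.
  exists (\max_j `|cplace Kv (w j)|)%N => j; rewrite in_val_ring /vge mulf_eq0.
  have [->|w0] := eqVneq (w j) 0; first by rewrite orbT.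
  rewrite val_ofM ?expf_neq0 // placeX vpi mul1r.
  have := leq_bigmax (F := fun j => `|cplace Kv (w j)|%N) j.
  move: (\max_j _)%N => M /=; move: (cplace Kv (w j)) => z h.
  by apply/orP; right; lia.
have rel : \sum_j sigma (y j) (pi ^+ m * w j) = 0.
  apply: (@s_unit _ _ s (pi ^+ n)); first by rewrite expf_neq0.
  rewrite mulr0 mulr_sumr.
  transitivity (\sum_j (\sum_i rho (e i) 1 * s (C j i)) * s (pi ^+ m * w j)).
    apply: eq_bigr => j _; have [CO eC] := hC j.
    rewrite -[X in sigma _ X]mul1r (sigma_scal hrho hmod) ?rpred1 // mulrA eC.
    congr (_ * _); apply: eq_bigr => i _.
    by rewrite -(rho_scal hrho) ?rpred1 // mul1r.
  under eq_bigr do rewrite mulr_suml; rewrite exchange_big big1 // => i _.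
  under eq_bigr do rewrite -mulrA -rmorphM; rewrite -mulr_sumr -rmorph_sum.
  rewrite (_ : \sum_j _ = 0) ?rmorph0 ?mulr0 //.
  transitivity (pi ^+ m * \sum_j w j * C j i); last by rewrite hw mulr0.
  by rewrite mulr_sumr; apply: eq_bigr => j _; rewrite mulrCA [C j i * _]mulrC.
have /choice[la hla] : forall x, exists al : 'I_l -> F, x \in I -> x = \sum_i iotaF (al i) *: y i.
  move=> x; have [/Iy[al h]|_] := boolP (x \in I); first by exists al.
  by exists (fun _ => 0).
have la_uniq x (al : 'I_l -> F) : x \in I -> x = \sum_i iotaF (al i) *: y i -> forall j, la x j = al j.
  move=> xI ex j; apply/eqP; rewrite -subr_eq0; apply/eqP.
  apply: (ind (fun j => la x j - al j)).
  under eq_bigr do rewrite rmorphB scalerBl.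
  by rewrite sumrB -ex -hla // subrr.
(* As [A] is the field of constants, the [j0]-th coordinate over it is [A]-linear and extends to the
   tensor product. There it sends the relation [rel] to [pi ^+ m * w j0], which is nonzero. *)
have hb : balanced iota A I Ov (fun x a => iota (iotaF (la x j0)) * a).
  split=> [x x' a xI xI' aO|x a a' xI aO aO'|c x a cA xI aO].
  - rewrite (la_uniq _ (fun j => la x j + la x' j)) ?rpredD //.
      by rewrite !rmorphD mulrDl.
    under eq_bigr do rewrite rmorphD scalerDl.
    by rewrite big_split -!hla.
  - by rewrite mulrDr.
  - have /AF[d ed] := cA; have cxI : c *: x \in I by have [_ h] := gens_closed Ig; exact: h.
    rewrite (la_uniq _ (fun j => d * la x j)) // ?ed.
      by rewrite !rmorphM -mulrA mulrCA.
    under eq_bigr do rewrite rmorphM -scalerA.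
    by rewrite -scaler_sumr -hla.
have [h hadd hE] := tensor_lift hsigma hb.
have := congr1 h rel; rewrite (additive_on0 Nc hadd) (additive_on_sum Nc hadd); last first.
  by move=> j; apply: (tensor_in hsigma).
under eq_bigr do rewrite hE //.
have la_y j : la (y j) j0 = (j == j0)%:R.
  rewrite (la_uniq _ (fun i => (j == i)%:R)) //.
  rewrite (bigD1 j) //= eqxx rmorph1 scale1r big1 ?addr0 // => i ij.
  by rewrite eq_sym (negbTE ij) rmorph0 scale0r.
rewrite (bigD1 j0) //= la_y eqxx !rmorph1 mul1r big1 => [|j jj0]; last first.
  by rewrite la_y (negbTE jj0) !rmorph0 mul0r.
by move/eqP; rewrite addr0 mulf_eq0 expf_eq0 (negbTE pi0) andbF (negbTE wj0).
Qed.

Lemma const_trace_elt1 : trace_elt R I 1.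
Proof.
have [k [e [eR inde Re]]] := const_basis AF Rg.
have [l [y [yI indy Iy]]] := const_basis AF Ig.
have [i0 x00] := nonzero_gen Ispan; set x0 := xg i0 in x00.
have x0I : x0 \in I by have [h _] := gens_closed Ig; exact: h.
have lk : (l <= k)%N.
  apply: (const_rank_le eR _ yI indy) => x; [by move/Re | by move/Iy].
have full := @const_span_full _ _ iotaF D l y k (fun i => x0 * e i).
have hy j : exists al : 'I_k -> F, y j = \sum_i iotaF (al i) *: (x0 * e i).
  apply: full => // [i|al h i].
    by apply/Iy; exact: IR.
  apply: (inde al); apply: (mulrI (Ddiv x00)); rewrite mulr0 -[RHS]h mulr_sumr.
  by apply: eq_bigr => j' _; rewrite scalerAr.
exists 1%N, (fun _ => x0), (fun _ => x0^-1); split.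
  move=> _; split=> // x /Iy[al ->]; rewrite mulr_sumr; apply: rpred_sum => j _.
  have [be ->] := hy j; rewrite -scalerAr; have [_ RA] := gens_closed Rg.
  apply: (RA); first by apply/AF; exists (al j).
  rewrite mulr_sumr; apply: rpred_sum => i _.
  rewrite -scalerAr mulKr ?Ddiv //; apply: (RA) => //; apply/AF; by exists (be i).
by rewrite big_ord1 divrr // Ddiv.
Qed.
End ConstantRank.

(** Right multiplication by [y] is injective on [R], a finite-dimensional space over [F], hence
    surjective. *)
Lemma const_order_division (F : finFieldType) (K : fieldType) (iotaF : {rmorphism F -> K})
    (A : subringClosed K) (D : falgType K) (R : subringClosed D) n (g : 'I_n -> D) :
  (forall a, a \in A <-> exists c, a = iotaF c) -> is_division D ->
  (forall x, x \in R <-> exists2 a : 'I_n -> K, (forall i, a i \in A) & x = \sum_i a i *: g i) ->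
  forall y, y \in R -> y != 0 -> y^-1 \in R.
Proof.
move=> AF Ddiv Rg y yR y0; have [k [e [eR inde Re]]] := const_basis AF Rg.
have full := @const_span_full _ _ iotaF D k e k (fun i => e i * y).
have he j : exists al : 'I_k -> F, e j = \sum_i iotaF (al i) *: (e i * y).
  apply: full => // [i|al h i]; first by apply/Re; exact: rpredM.
  apply: (inde al); apply: (mulIr (Ddiv _ y0)); rewrite mul0r -[RHS]h mulr_suml.
  by apply: eq_bigr => j' _; rewrite scalerAl.
have /Re[al e1] : 1 \in R by exact: rpred1.
have /choice[b hb] := he.
have -> : y^-1 = \sum_j iotaF (al j) *: (\sum_i iotaF (b j i) *: e i).
  apply: (mulIr (Ddiv _ y0)); rewrite mulVr ?Ddiv // e1 mulr_suml.
  apply: eq_bigr => j _; rewrite -scalerAl {1}hb mulr_suml; congr (_ *: _).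
  by apply: eq_bigr => i _; rewrite scalerAl.
apply: rpred_sum => j _; have [_ RA] := gens_closed Rg.
apply: (RA); first by apply/AF; exists (al j).
apply: rpred_sum => i _; apply: (RA) => //; apply/AF; by exists (b j i).
Qed.

(** * Transfer of heredity *)

Section DualBasis.
Import finmap monalg.
Variables (R : nzRingType) (P : lmodType R).

Lemma projective_of_dual_basis n (lam : 'I_n -> P -> R) (w : 'I_n -> P) :
  (forall i a x y, lam i (a *: x + y) = a * lam i x + lam i y) ->
  (forall y, \sum_i lam i y *: w i = y) -> projective P.
Proof.
move=> lamL hw M N p f psurj.
have /choice[m hm] : forall i, exists m, p m = f (w i) by move=> i; exact: psurj.
pose g y := \sum_i lam i y *: m i.
have gL : linear g.
  move=> a x y; rewrite /g scaler_sumr -big_split; apply: eq_bigr => i _ /=.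
  by rewrite lamL scalerDl scalerA.
pose G : {linear P -> M} := HB.pack g (GRing.isLinear.Build R P M *:%R g gL).
exists G => y; rewrite -[LHS]/(p (g y)) /g linear_sum.
rewrite -[in RHS](hw y) linear_sum; apply: eq_bigr => i _.
by rewrite !linearZ hm.
Qed.

(** The functionals are the coordinates of a section of the surjection onto [P] from the free module
    on all elements of [P]. *)
Lemma projective_dual_basis : projective P ->
  exists lam : P -> P -> R, (forall w a x y, lam w (a *: x + y) = a * lam w x + lam w y) /\
    forall y, exists s : seq P, (forall w, w \notin s -> lam w y = 0) /\
      y = \sum_(w <- s) lam w y *: w.
Proof.
pose M := {malg R[P]}; pose ev (t : M) := \sum_(w <- msupp t) t@_w *: w.
have evw (t : M) (d : {fset P}) : (msupp t `<=` d)%fset -> ev t = \sum_(w <- d) t@_w *: w.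
  move=> td; apply: big_fset_incl => // w _ wt.
  by rewrite mcoeff_outdom // scale0r.
have evL : linear ev.
  move=> a t u; pose d := (msupp t `|` msupp u `|` msupp (a *: t + u))%fset.
  rewrite (evw _ d) ?fsubsetUr // (evw t d) /d ?(evw u d) /d.
  - rewrite scaler_sumr -big_split; apply: eq_bigr => w _ /=.
    by rewrite mcoeffD mcoeffZ scalerDl scalerA.
  - by apply: fsubset_trans (fsubsetUl _ _); exact: fsubsetUr.
  - by apply: fsubset_trans (fsubsetUl _ _); exact: fsubsetUl.
pose E : {linear M -> P} := HB.pack ev (GRing.isLinear.Build R M P *:%R ev evL).
move=> proj; have [|g hg] := proj M P E idfun.
  move=> y; exists (mkmalgU y 1); rewrite -[LHS]/(ev _) (evw _ [fset y]%fset).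
    by rewrite big_seq_fset1 mcoeffUU scale1r.
  by rewrite msuppU oner_eq0.
exists (fun w y => (g y)@_w); split=> [w a x y|y].
  by rewrite linearP mcoeffD mcoeffZ.
exists (msupp (g y)); split=> [w|]; first exact: mcoeff_outdom.
by rewrite -[LHS](hg y).
Qed.
End DualBasis.


Lemma submod_valP (R : nzRingType) (V : lmodType R) (S : submodClosed V) r (Y Z : submod_type S) :
  submod_val (r *: Y + Z) = r *: submod_val Y + submod_val Z.
Proof. exact: (linearP (\val : submod_type S -> V)). Qed.

Section IdealValue.
Variables (D : nzRingType) (S : subringClosed D) (Jp : submodClosed (subring_type S)^o).
Implicit Types (Y Z : submod_type Jp) (r : subring_type S).

Lemma subring_valD r r' : subring_val (r + r') = subring_val r + subring_val r'.
Proof. exact: (rmorphD (\val : subring_type S -> D)). Qed.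

Lemma subring_valM r r' : subring_val (r * r') = subring_val r * subring_val r'.
Proof. exact: (rmorphM (\val : subring_type S -> D)). Qed.

Lemma subring_val_inj : injective (@subring_val D S).
Proof. exact: val_inj. Qed.

Lemma subring_val1 : subring_val (1 : subring_type S) = 1.
Proof. exact: (rmorph1 (\val : subring_type S -> D)). Qed.

Definition ideal_val Y : D := subring_val (submod_val Y).

Lemma ideal_valP r Y Z :
  ideal_val (r *: Y + Z) = subring_val r * ideal_val Y + ideal_val Z.
Proof. by rewrite /ideal_val submod_valP subring_valD -subring_valM. Qed.

Lemma ideal_val_inj : injective ideal_val.
Proof. by move=> Y Z /(@val_inj _ _ (subring_type S)) /(@val_inj _ _ (submod_type Jp)). Qed.

Lemma ideal_valD Y Z : ideal_val (Y + Z) = ideal_val Y + ideal_val Z.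
Proof. by rewrite -[Y in LHS]scale1r ideal_valP subring_val1 mul1r. Qed.

Lemma ideal_val0 : ideal_val 0 = 0.
Proof. by apply: (addrI (ideal_val 0)); rewrite -ideal_valD !addr0. Qed.

Lemma ideal_valZ r Y : ideal_val (r *: Y) = subring_val r * ideal_val Y.
Proof. by rewrite -[r *: Y]addr0 ideal_valP ideal_val0 addr0. Qed.

Lemma ideal_val_sum (J : Type) (r : seq J) (Y : J -> submod_type Jp) :
  ideal_val (\sum_(j <- r) Y j) = \sum_(j <- r) ideal_val (Y j).
Proof. exact: (big_morph _ ideal_valD ideal_val0). Qed.
End IdealValue.

(** * Heredity passes to the left order *)

Section HereditaryTransfer.
Variables (D : unitRingType) (R : subringClosed D) (I : zmodClosed D).
Hypothesis Ddiv : is_division D.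
Hypothesis Rher : hereditary (subring_type R).
Hypothesis Ore : forall y y0, y \in R -> y0 \in R -> y0 != 0 ->
  exists r r0, [/\ r \in R, r0 \in R, r != 0 & r * y = r0 * y0].
Hypothesis IR : forall x y, x \in I -> y \in R -> x * y \in I.
Hypothesis tr1 : trace_elt R I 1.

Lemma submod_of_ideal (S : subringClosed D) (J : {pred D}) : zmod_closed J ->
  (forall a x, a \in S -> x \in J -> a * x \in J) ->
  exists Jp : submodClosed (subring_type S)^o, forall r, (r \in Jp) = (subring_val r \in J).
Proof.
move=> Jc SJ; have [J0 JB] := Jc.
pose Jp0 : {pred (subring_type S)^o} := [pred r : subring_type S | subring_val r \in J].
have h : submod_closed Jp0.
  split=> [|a x y]; rewrite !inE; first by rewrite (_ : subring_val _ = 0) ?raddf0.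
  move=> xJ yJ; rewrite -[subring_val _]/(subring_val a * subring_val x + subring_val y).
  by apply: (zmod_closed_add Jc) => //; apply: SJ => //; exact: (valP a).
pose Jp : submodClosed (subring_type S)^o :=
  HB.pack Jp0 (GRing.isSubmodClosed.Build _ _ Jp0 (GRing.submod_closed_semi h)).
by exists Jp.
Qed.

(* A functional J -> R is the right multiplication by an element of D. *)
Lemma projective_ideal_dual_basis (J : {pred D}) y0 : zmod_closed J -> {subset J <= R} ->
  (forall a x, a \in R -> x \in J -> a * x \in J) -> y0 \in J -> y0 != 0 ->
  span_over (fun q => forall y, y \in J -> y * q \in R) (fun w => w \in J) 1.
Proof.
move=> Jc JR RJ y0J y00; have [Jp hJp] := submod_of_ideal Jc RJ.
have [lam [lamL hlam]] := projective_dual_basis (@Rher Jp).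
pose vv := @ideal_val _ _ Jp.
have vvJ Y : vv Y \in J by rewrite -hJp; exact: (valP Y).
have lift y : y \in J -> exists Y, vv Y = y.
  move=> yJ; pose r : subring_type R := SubringType (JR _ yJ).
  have rJ : r \in Jp by rewrite hJp.
  by exists (SubmodType rJ).
have lamZ w a Y : lam w (a *: Y) = a * lam w Y.
  have l0 : lam w 0 = 0.
    by have := lamL w 1 0 0; rewrite scaler0 addr0 mul1r => /eqP; rewrite -subr_eq subrr => /eqP.
  by have := lamL w a Y 0; rewrite !addr0 l0 addr0.
have [Y0 eY0] := lift _ y0J.
pose q w := y0^-1 * subring_val (lam w Y0).
have lamE w Y : subring_val (lam w Y) = vv Y * q w.
  (* [vv Y] and [y0] have a common left multiple, so that linearity over [R] ties the value at [Y]
     to the value at [Y0]. *)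
  have [r [r0 [rR r0R rn0 e]]] := Ore (JR _ (vvJ Y)) (JR _ y0J) y00.
  apply: (mulrI (Ddiv rn0)).
  have e1 : SubringType rR *: Y = SubringType r0R *: Y0.
    by apply: ideal_val_inj; rewrite !ideal_valZ -/(vv Y) -/(vv Y0) eY0.
  have := congr1 (fun Z => subring_val (lam w Z)) e1; rewrite !lamZ !subring_valM /= => ->.
  by rewrite mulrA e /q -mulrA mulVKr ?Ddiv.
have [s [s0 es]] := hlam Y0.
(* Expanding the single element [y0] and cancelling it on the left gives a finite relation out of a
   possibly infinite dual basis. *)
have e1 : y0 = \sum_(w <- s) y0 * q w * vv w.
  rewrite -{1}eY0 {1}es /vv ideal_val_sum; apply: eq_bigr => w _.
  by rewrite ideal_valZ lamE eY0.
exists (size s), (fun i => q (nth Y0 s i)), (fun i => vv (nth Y0 s i)); split=> [i|].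
  by split=> [y /lift[Y <-]|]; [rewrite -lamE; exact: (valP (lam _ _)) | exact: vvJ].
apply: (mulrI (Ddiv y00)); rewrite mulr1 {1}e1 (big_nth Y0) big_mkord mulr_sumr.
by apply: eq_bigr => i _; rewrite -mulrA.
Qed.

Lemma left_order_hereditary : hereditary (subring_type (left_order I)).
Proof.
move=> Jp; pose P := submod_type Jp.
have loP y : reflect (forall z, z \in I -> y * z \in I) (y \in left_order I) by exact: asboolP.
pose vv : P -> D := @ideal_val _ _ Jp.
pose J : {pred D} := [pred y | `[< exists Y, vv Y = y >]].
have JP y : reflect (exists Y, vv Y = y) (y \in J) by exact: asboolP.
have JL y : y \in J -> forall z, z \in I -> y * z \in I.
  by move=> /JP[Y <-]; apply/loP; exact: (valP (submod_val Y)).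
have [[y1 y1J y10]|triv] := pselect (exists2 y, y \in J & y != 0); last first.
  have Y0 (Y : P) : Y = 0.
    apply: ideal_val_inj; rewrite ideal_val0; apply/eqP; apply: contrapT => /negP h.
    by apply: triv; exists (vv Y) => //; apply/JP; exists Y.
  by apply: (@projective_of_dual_basis _ _ 0 (fun _ _ => 0) (fun _ => 0)) => [[]//|y]; rewrite big_ord0 [RHS]Y0.
have [n [x [phi [hx e1]]]] := tr1.
have [i0 x00] : exists i, x i != 0.
  apply: contrapT => h; move/eqP: e1; rewrite big1 ?oner_eq0 // => i _.
  have [->|xi] := eqVneq (x i) 0; first by rewrite mul0r.
  by case: h; exists i.
pose u0 := x i0.
have u0I : u0 \in I by case: (hx i0).
(* J' is I^* J u0, a left ideal of R; a dual basis of J' gives one of J since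
   I I^* J = J. *)
pose IJ := span_over (fun psi => forall z, z \in I -> psi * z \in R) (fun j => j \in J).
pose J' : {pred D} := [pred y | `[< IJ (y * u0^-1) >]].
have J'P y : reflect (IJ (y * u0^-1)) (y \in J') by exact: asboolP.
(* The factor [u0] is what brings [J'] into [R]: the set [J u0] is included in [I], and each [psi]
   maps [I] into [R]. *)
have J'R : {subset J' <= R}.
  move=> y /J'P[k [psi [j [h e]]]].
  rewrite -[y](divrK (Ddiv x00)) e mulr_suml; apply: rpred_sum => i _; have [hpsi jJ] := h i.
  by rewrite -mulrA hpsi // JL.
have RJ' a y : a \in R -> y \in J' -> a * y \in J'.
  move=> aR /J'P[k [psi [j [h e]]]]; apply/J'P; exists k, (fun i => a * psi i), j; split.
    by move=> i; have [hpsi jJ] := h i; split=> // z zI; rewrite -mulrA rpredM ?hpsi.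
  by rewrite -mulrA e mulr_sumr; apply: eq_bigr => i _; rewrite mulrA.
have J'c : zmod_closed J'.
  have J'0 : 0 \in J' by apply/J'P; rewrite mul0r; exact: span_over0.
  split=> // y z yJ zJ; apply/J'P; rewrite mulrBl; apply: span_overD; first exact/J'P.
  by rewrite -mulNr; apply/J'P; rewrite -mulN1r; apply: RJ' => //; rewrite rpredN rpred1.
have [y0 y0J y00] : exists2 y, y \in J' & y != 0.
  apply: contrapT => h; have /eqP : y1 * u0 = 0.
    rewrite -[y1]mul1r e1 !mulr_suml big1 // => i _; rewrite -!mulrA.
    suff -> : phi i * (y1 * u0) = 0 by rewrite mulr0.
    apply/eqP; apply: contrapT => /negP nz; apply: h; exists (phi i * (y1 * u0)) => //.
    apply/J'P; exists 1%N, (fun _ => phi i), (fun _ => y1); split.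
      by move=> _; split=> //; case: (hx i).
    by rewrite big_ord1 -!mulrA divrr ?Ddiv // mulr1.
  by apply/negP; apply: contra y10 => /eqP h'; apply/eqP/(mulIr (Ddiv x00)); rewrite mul0r.
have [k [q [w [hq eq1]]]] := projective_ideal_dual_basis J'c J'R RJ' y0J y00.
have [l [a [j [haj eaj]]]] : span_over
    (fun a => forall y, y \in J -> y * a \in left_order I) (fun j => j \in J) 1.
  (* The dual basis of [J'] is conjugated by [u0], and each [w t / u0] is written as a sum of
     products [psi i * jj i]; this leads to the multipliers [u0 * q t * psi i]. They carry [J] into
     the left order because an element [y] of [J] equals the sum of the [x_i phi_i y], where
     [phi_i y u0] is in [J']. *)
  rewrite -(divrr (Ddiv x00)) -[X in X / _](mulr1 (x i0)) {}eq1 mulr_sumr mulr_suml.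
  elim/big_ind: _ => [|y z|t _]; [exact: span_over0 | exact: span_overD |].
  have [hqt /J'P[r [psi [jj [hj ew]]]]] := hq t.
  exists r, (fun i => u0 * q t * psi i), jj; split; last first.
    by rewrite -!mulrA ew !mulr_sumr; apply: eq_bigr => i _; rewrite !mulrA.
  move=> i; have [hpsi jJ] := hj i; split=> // y yJ; apply/loP => z zI.
  rewrite -[y]mul1r e1 !mulr_suml; apply: rpred_sum => i' _; have [xI hphi] := hx i'.
  rewrite -!mulrA; apply: IR => //; rewrite !mulrA -[_ * psi i * z]mulrA.
  apply: rpredM; last exact: hpsi.
  apply: hqt; apply/J'P; exists 1%N, (fun _ => phi i'), (fun _ => y); split=> //.
  by rewrite big_ord1 -!mulrA divrr ?Ddiv // mulr1.
have /choice[lam hlam] : forall iY : 'I_l * P, exists r : subring_type (left_order I), subring_val r = vv iY.2 * a iY.1.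
  move=> [i Y] /=; have h : vv Y * a i \in left_order I by apply: (haj i).1; apply/JP; exists Y.
  by exists (SubringType h).
have /choice[W hW] : forall i, exists Y, vv Y = j i by move=> i; apply/JP; exact: (haj i).2.
apply: (@projective_of_dual_basis _ _ l (fun i Y => lam (i, Y)) W).
  by move=> i r Y Z; apply: subring_val_inj; rewrite subring_valD subring_valM !hlam /= /vv ideal_valP mulrDl mulrA.
move=> Y; apply: ideal_val_inj; rewrite -[RHS]mulr1 eaj mulr_sumr ideal_val_sum.
by apply: eq_bigr => i _; rewrite ideal_valZ hlam -/(vv _) hW mulrA.
Qed.
End HereditaryTransfer.

(** A nonzero [x] has a nonzero image in [E], as seen from a coordinate of [x] extended to the
    tensor product. Thus [D] has no zero divisors, and injective multiplications are bijective in
    finite dimension. *)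
Lemma division_of_definite (K : fieldType) (oo : place K) (Koo : completion oo) (D : falgType K) :
  is_definite D Koo -> is_division D.
Proof.
move=> [E [tau [[ht htau _] Ediv]]].
have Tc : zmod_closed (predT : {pred E}) by split.
have tau_neq0 x : x != 0 -> tau x 1 != 0.
  move=> x0; have [i ci] : exists i, coord (vbasis {:D}) i x != 0.
    apply: contrapT => h; case/eqP: x0; rewrite (coord_vbasis (memvf x)) big1 // => i _.
    have [->|ci] := eqVneq (coord (vbasis {:D}) i x) 0; first by rewrite scale0r.
    by case: h; exists i.
  have hb : balanced (cincl Koo) predT predT predT
      (fun (d : D) a => cincl Koo (coord (vbasis {:D}) i d) * a).
    split=> [d d' a _ _ _|d a a' _ _ _|c d a _ _ _].
    - by rewrite linearD rmorphD mulrDl.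
    - by rewrite mulrDr.
    - by rewrite linearZ /= rmorphM [RHS]mulrCA mulrA.
  have [h hadd hE] := tensor_lift ht hb.
  apply/eqP => e; have := hE x 1 isT isT.
  by rewrite e (additive_on0 Tc hadd) mulr1 => /esym/eqP; rewrite fmorph_eq0 (negbTE ci).
have tau0 : tau 0 1 = 0.
  have [_ _ [h _ _] _] := ht; have := h 0 0 1 isT isT isT.
  by rewrite addr0 => /eqP; rewrite -subr_eq subrr => /eqP.
have noz (x y : D) : x * y = 0 -> x != 0 -> y = 0.
  move=> xy x0; apply: contrapT => /eqP y0.
  have := htau x y 1 1 isT isT isT isT; rewrite xy mulr1 tau0 => /eqP.
  have ux := Ediv _ (tau_neq0 _ x0).
  by rewrite -[X in _ == X](mulr0 (tau x 1)) (inj_eq (mulrI ux)) (negbTE (tau_neq0 _ y0)).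
move=> x x0.
have k0 : lker (amulr x) == 0%VS.
  apply/lker0P => y z; rewrite !lfunE /= => /eqP; rewrite -subr_eq0 -mulrBl => /eqP h.
  by apply/eqP; rewrite -subr_eq0; apply: contraT => /(noz _ _ h)/eqP; rewrite (negbTE x0).
have [y e] : exists y, y * x = 1.
  by exists ((amulr x)^-1%VF 1); have := lker0_lfunVK k0 1; rewrite lfunE.
apply/unitrP; exists y; split=> //.
apply/eqP; rewrite -subr_eq0; apply/eqP/(noz y); last first.
  by apply: contra_eq_neq e => ->; rewrite mul0r eq_sym oner_eq0.
by rewrite mulrBr mulrA e mul1r mulr1 subrr.
Qed.

Section ScalarMatrices.
Variables (L : fieldType) (Delta : falgType L) (m : nat).

Definition scalar_morph : {rmorphism L -> 'M[Delta]_m} :=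
  (@scalar_mx Delta m \o in_alg Delta).

Lemma scalar_morphE a X : scalar_morph a * X = (a%:A)%:M *m X.
Proof. by []. Qed.

Lemma scalar_morph_entry a X i j : (scalar_morph a * X) i j = a%:A * X i j.
Proof. by rewrite scalar_morphE mul_scalar_mx mxE. Qed.

Lemma scalar_morph_central a X : scalar_morph a * X = X * scalar_morph a.
Proof.
apply/matrixP => i j; rewrite scalar_morph_entry -[X * _]/(X *m _) mxE.
rewrite (bigD1 j) //= big1 => [|k kj]; last by rewrite mxE (negbTE kj) mulr0n mulr0.
by rewrite addr0 mxE eqxx mulr1n mulr_algl mulr_algr.
Qed.
End ScalarMatrices.

Section TraceIdeal.
Variables (K : fieldType) (A : subringClosed K) (D : falgType K).
Variables (R : subringClosed D) (I : zmodClosed D).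
Hypothesis RA : forall c x, c \in A -> x \in R -> c *: x \in R.

Lemma trace_elt1 (a : K -> Prop) : (forall b, a b -> trace_elt R I b%:A) ->
  span_over a (fun c => c \in A) 1 -> trace_elt R I 1.
Proof.
move=> ha [k [b [c [h e]]]].
rewrite -[1]scale1r e scaler_suml; elim/big_ind: _ => [|x y|i _].
- exact: span_over0.
- exact: span_overD.
have [ab cA] := h i; have [l [x [phi [hx ex]]]] := ha _ ab.
exists l, x, (fun j => c i *: phi j); split=> [j|].
  by have [xI hphi] := hx j; split=> // y yI; rewrite -scalerAl RA ?hphi.
rewrite mulrC -scalerA ex scaler_sumr; by apply: eq_bigr => j _; rewrite scalerAr.
Qed.

Hypothesis IR : forall x y, x \in I -> y \in R -> x * y \in I.
Hypothesis Ilat : is_lattice A I.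
Hypothesis tr1 : trace_elt R I 1.

(** For [y] in the left order, [y = sum_i (y x_i) phi_i] with [y x_i] in [I]; hence the products of
    the generators of [I] with the [phi_i] generate. The same expansion with coefficients in [K]
    shows that they span [D]. *)
Lemma left_order_lattice : is_lattice A (left_order I).
Proof.
have [nI [xg [Ig Ispan]]] := Ilat; have [n [x [phi [hx e1]]]] := tr1.
have [xgI IA] := gens_closed Ig.
have loP y : reflect (forall z, z \in I -> y * z \in I) (y \in left_order I) by exact: asboolP.
pose g (r : 'I_#|{: 'I_nI * 'I_n}|) := xg (enum_val r).1 * phi (enum_val r).2.
have sum_g (a : 'I_nI * 'I_n -> K) : \sum_r a (enum_val r) *: g r =
    \sum_i (\sum_k a (k, i) *: xg k) * phi i.
  under [RHS]eq_bigr do rewrite mulr_suml.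
  rewrite exchange_big pair_big /= [RHS](reindex (@enum_val _ (mem predT))) /=.
    by apply: eq_bigr => r _; rewrite -scalerAl -surjective_pairing.
  by exists enum_rank => r _; rewrite ?enum_valK ?enum_rankK.
have expand y (b : 'I_n -> 'I_nI -> K) : (forall i, y * x i = \sum_k b i k *: xg k) ->
    y = \sum_r (b (enum_val r).2 (enum_val r).1) *: g r.
  move=> hb; rewrite (sum_g (fun p => b p.2 p.1)) -[LHS]mulr1 e1 mulr_sumr.
  by apply: eq_bigr => i _; rewrite mulrA hb.
exists _, g; split=> [y|y]; last first.
  have /choice[b hb] : forall i, exists b : 'I_nI -> K, y * x i = \sum_k b k *: xg k.
    by move=> i; exact: Ispan.
  by exists (fun r => b (enum_val r).2 (enum_val r).1); exact: expand.
split=> [/loP yI|[a aA ->]].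
  have /choice[b hb] : forall i, exists b : 'I_nI -> K, (forall k, b k \in A) /\ y * x i = \sum_k b k *: xg k.
    by move=> i; have /yI/Ig[b ? ?] := (hx i).1; exists b.
  exists (fun r => b (enum_val r).2 (enum_val r).1) => [r|]; first by have [h _] := hb (enum_val r).2.
  by apply: expand => i; case: (hb i).
apply/loP => z zI; rewrite mulr_suml; apply: rpred_sum => r _.
by rewrite -scalerAl IA // -mulrA IR ?(hx _).2.
Qed.
End TraceIdeal.

(** * The local and global statements combined *)

Section Main.
Variables (F : finFieldType) (K : fieldType) (iota : {rmorphism F -> K}).
Hypothesis hK : is_global_function_field iota.
Variables (oo : place K) (D : falgType K).
Local Notation A := (regular_outside oo).

Lemma constant_or_transcendental :
  (exists2 z, z \in A & ~ algebraicOver iota z) \/ (forall a, a \in A <-> exists c, a = iota c).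
Proof.
have [[z zA ztr]|h] := pselect (exists2 z, z \in A & ~ algebraicOver iota z).
  by left; exists z.
right=> a; split=> [aA|[c ->]]; last exact: const_regular.
by apply: hK.2; apply: contrapT => atr; apply: h; exists a.
Qed.

(** If [oo] were the only place, every element of [K] would be regular outside it, hence constant.
    Without a finite place there would be no local data to compare the ranks of [R] and [I]. *)
Lemma exists_finite_place : (forall a, a \in A <-> exists c, a = iota c) -> finite_place oo.
Proof.
move=> AF; apply: cid; apply: contrapT => h.
have [[t [ttr _]] _] := hK; apply: ttr.
have /AF[c ->] : t \in A by apply/regularP => v voo; case: h; exists v.
exact: algebraic_id.
Qed.

Variables (R : subringClosed D) (I : zmodClosed D).
Hypothesis Ddiv : is_division D.
Hypothesis Rlat : is_lattice A R.
Hypothesis Ilat : is_lattice A I.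
Hypothesis IR : forall x y, x \in I -> y \in R -> x * y \in I.

(** A denominator [c] of [y y0^-1] gives the common left multiple; if [A] is the field of constants,
    [R] is itself a division ring. *)
Lemma order_left_ore y y0 : y \in R -> y0 \in R -> y0 != 0 ->
  exists r r0, [/\ r \in R, r0 \in R, r != 0 & r * y = r0 * y0].
Proof.
move=> yR y0R y00; have [nR [rg [Rg Rspan]]] := Rlat.
have [[z zA ztr]|AF] := constant_or_transcendental; last first.
  exists 1, (y * y0^-1); rewrite rpred1 oner_neq0 mul1r divrK ?Ddiv // rpredM //.
  exact: (const_order_division AF Ddiv Rg).
have [c cA [c0 h]] := order_denominator (regular_denominator hK zA ztr) Rg Rspan (y * y0^-1).
have [_ RA] := gens_closed Rg.
exists c%:A, (c *: (y * y0^-1)); split=> //.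
- by rewrite RA ?rpred1.
- by rewrite scaler_eq0 negb_or c0 oner_neq0.
by rewrite -!scalerAl mul1r divrK ?Ddiv.
Qed.

Variable Kc : forall v : place K, completion v.
Variable ls : forall v : finite_place oo, local_structure D (Kc (sval v)).
Variable f : finite_place oo -> seq nat.
Hypothesis hf : forall v, is_composition (ls v) (f v).
Variable rho : forall v : finite_place oo, D -> Kc (sval v) -> 'M[ls_div (ls v)]_(ls_m (ls v)).
Hypothesis hrho : forall v, local_identification A R (f v) (@rho v).
Variable g : finite_place oo -> seq nat.
Hypothesis hgsize : forall v, size (g v) = size (f v).
Hypothesis hgsum : forall v, sumn (g v) = ls_m (ls v).
Hypothesis hIg : forall v, local_module_iso A R I (f v) (g v) (@rho v).

Section AtPlace.
Variable v : finite_place oo.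
Local Notation s := (scalar_morph (ls_div (ls v)) (ls_m (ls v))).

Lemma rho_tensor : is_alg_tensor (cincl (Kc (sval v))) A R (val_ring (cplace (Kc (sval v)))) s
  (Mat_order (ls := ls v) (f v)) (@rho v).
Proof. exact: hrho. Qed.

Lemma scalar_bounded_order pi Z : cplace (Kc (sval v)) pi = 1 ->
  exists n, s (pi ^+ n) * Z \in Mat_order (ls := ls v) (f v).
Proof.
move=> hpi; have [n hn] := matrix_bounded hK Z hpi; exists n.
apply/block_ofP => i j; rewrite scalar_morph_entry; have [h1 h2] := hn i j.
by case: ifP.
Qed.

Lemma scalar_bounded_module pi Z : cplace (Kc (sval v)) pi = 1 ->
  exists n, s (pi ^+ n) * Z \in row_module_sum (ls := ls v) (f v) (g v).
Proof.
move=> hpi; have [n hn] := matrix_bounded hK Z hpi; exists n.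
apply/(row_module_sumP hK (hf v) (hgsize v) (hgsum v)) => i j.
by rewrite scalar_morph_entry; have [h1 h2] := hn i j; case: ifP.
Qed.

Lemma regular_vge c : c \in A -> vge (sval v) 0 c.
Proof. by move/regularP; apply; exact: (svalP v). Qed.
End AtPlace.

Lemma right_ideal_trace1 : trace_elt R I 1.
Proof.
have [nR [rg [Rg Rspan]]] := Rlat; have [nI [xg [Ig Ispan]]] := Ilat.
have [_ RA] := gens_closed Rg.
have [[z zA ztr]|AF] := constant_or_transcendental; last first.
  have v := exists_finite_place AF.
  have [sigma [hsigma hmod]] := hIg v.
  have [pi pi0 hpi] := val_of_normalized (cplace (Kc (sval v))).
  apply: (const_trace_elt1 AF Ddiv Rg Ig Ispan IR
    (rho_tensor v) hsigma hmod hpi) => Z.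
  exact: scalar_bounded_order.
have Afrac := regular_denominator hK zA ztr.
apply: (trace_elt1 RA (a := fun b => b \in A /\ trace_elt R I b%:A)); first by move=> b [].
apply: (regular_ideal1 hK zA ztr).
- by move=> y [].
- by have [b bA [b0 h]] := trace_elt_nonzero Afrac Ddiv Rg Rspan Ig Ispan; exists b.
move=> w woo; pose v : finite_place oo := exist _ w woo.
have [sigma [hsigma hmod]] := hIg v.
have [pi pi0 hpi] := val_of_normalized (cplace (Kc (sval v))).
have [c [e [cN eN ce]]] := row_module_sum_dual_basis hK (hf v) (hgsize v) (hgsum v).
have [|||b bA [b0 vb h]] := @local_trace_elt K w (Kc w) A (@regular_vge v) _ Afrac D R I Ddiv
  _ _ rg xg Rg Rspan Ig Ispan IR _ _ (@scalar_morph_central _ _ _) _ _ _ sigma pi (rho_tensor v) hsigma hmod hpi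
  _ _ _ c e cN eN ce.
- by move=> x hx; exact: (local_denominator hK zA ztr woo hx).
- by move=> Z; exact: scalar_bounded_order.
- by move=> Z; exact: scalar_bounded_module.
by exists b; rewrite ?vb.
Qed.

Lemma left_order_local_iso v : local_iso A (ls v) (left_order I) [seq k <- g v | (0 < k)%N].
Proof.
have [nR [rg [Rg Rspan]]] := Rlat; have [nI [xg [Ig Ispan]]] := Ilat.
have [_ IA] := gens_closed Ig.
have [n [x [phi [hx e1]]]] := right_ideal_trace1.
have [sigma [hsigma hmod]] := hIg v.
have [pi pi0 hpi] := val_of_normalized (cplace (Kc (sval v))).
have AO c : c \in A -> cincl (Kc (sval v)) c \in val_ring (cplace (Kc (sval v))).
  by move=> /(regular_vge v) h; rewrite in_val_ring /vge fmorph_eq0 cplace_incl.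
have piO : pi \in val_ring (cplace (Kc (sval v))) by rewrite inE hpi.
apply: (left_order_tensor (@scalar_morph_central _ _ _) AO IA IR (rho_tensor v) hsigma hmod pi0 piO
  _ _ (x := x) (phi := phi)).
- by move=> Z; exact: scalar_bounded_order.
- by move=> Z; exact: scalar_bounded_module.
- by move=> i; case: (hx i).
- by move=> i y yI; case: (hx i) => _; apply.
- by [].
- exact: Mat_order_zmod.
- exact: (left_multiplier_row_module_sum hK (hf v) (hgsize v) (hgsum v)).
Qed.
End Main.

Theorem proposition6p2
  (F : finFieldType) (K : fieldType) (iota : {rmorphism F -> K})
  (hK : is_global_function_field iota)
  (oo : place K) (Kc : forall v : place K, completion v)
  (n : nat) (D : falgType K)
  (hDdim : \dim {:D} = (n ^ 2)%N) (hDcentral : is_central D)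
  (hDsimple : is_simple D) (hDdef : is_definite D (Kc oo))
  (ls : forall v : finite_place oo, local_structure D (Kc (sval v)))
  (R : subringClosed D)
  (hR : is_hereditary_order (regular_outside oo) R)
  (f : finite_place oo -> seq nat)
  (hf : forall v, is_composition (ls v) (f v))
  (rho : forall v : finite_place oo,
     D -> Kc (sval v) -> 'M[ls_div (ls v)]_(ls_m (ls v)))
  (hrho : forall v,
     local_identification (regular_outside oo) R (f v) (rho v))
  (g : finite_place oo -> seq nat)
  (hgsize : forall v, size (g v) = size (f v))
  (hgsum : forall v, sumn (g v) = ls_m (ls v))
  (I : zmodClosed D)
  (hI : is_right_ideal (regular_outside oo) R I)
  (hIg : forall v,
     local_module_iso (regular_outside oo) R I (f v) (g v) (rho v)) :
  (forall v : finite_place oo,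
     local_iso (regular_outside oo) (ls v) (left_order I)
       [seq k <- g v | (0 < k)%N])
  /\ is_hereditary_order (regular_outside oo) (left_order I)
  /\ (forall v : finite_place oo,
        local_invariant (regular_outside oo) (ls v) (left_order I)
          [seq k <- g v | (0 < k)%N]).
Proof.
have Ddiv := division_of_definite hDdef.
have [Rlat Rher] := hR; have [Ilat IR] := hI.
have liso := left_order_local_iso hK Ddiv Rlat Ilat IR hf hrho hgsize hgsum hIg.
have tr1 := right_ideal_trace1 hK Ddiv Rlat Ilat IR hf hrho hgsize hgsum hIg.
split; first exact: liso.
split=> [|v]; first split.
- exact: (left_order_lattice IR Ilat tr1).
- exact: (left_order_hereditary Ddiv Rher (order_left_ore hK Ddiv Rlat) IR tr1).
split; last exact: liso.
by split; [exact: filter_all | rewrite sumn_filter_pos hgsum].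
Qed.
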